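(* Let $s\in\mathbb R$ and $p,q\in(0,+\infty]$. If the wavelet system $\{\psi^{(i)}_{j,k}\}$ satisfies the dyadic covering property, then the set of sequences $\mathcal C\in b^{s,q}_p$ whose wavelet series is maximally divergent in $\mathbb R^d$ is prevalent in $b^{s,q}_p$.
   Context: Setting: integers $d,N\ge1$, bounded fast-decaying $\psi^{(1)},\dots,\psi^{(N)}:\mathbb R^d\to\mathbb C$ (for all $n$, $|\psi^{(i)}(x)|\le C_n(1+|x|)^{-n}$), wavelets $\psi^{(i)}_{j,k}(x)=\psi^{(i)}(2^jx-k)$, $j\ge0$, $k\in\mathbb Z^d$; dyadic cubes $\lambda_{j,k}=\prod_{m=1}^d[k_m2^{-j},(k_m+1)2^{-j})$ of scale $j$; coefficients indexed by $(i,\lambda)$; $\Lambda_j$ = pairs $(i,\lambda)$ with $\lambda$ of scale $j$. $b^{s,q}_p$: sequences $(c^{(i)}_\lambda)$ with $\big(\big(\sum_{(i,\lambda)\in\Lambda_j}|c^{(i)}_\lambda2^{(s-d/p)j}|^p\big)^{1/p}\big)_{j\ge0}\in\ell^q$ (supremum if $p=\infty$), a complete metric vector space for the corresponding $\ell^q$ (quasi-)norm. Divergence exponent $\delta_{\mathcal C}(x)$: supremum of $\gamma$ such that there exist $C>0$ and $(i_n,j_n,k_n)$ with $j_n\to\infty$ and $|c^{(i_n)}_{j_n,k_n}\psi^{(i_n)}_{j_n,k_n}(x)|\ge C2^{\gamma j_n}$. Maximal divergence in a nonempty open $A\subset\mathbb R^d$: (i) $\delta_{\mathcal C}(x)\in[-s,d/p-s]$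 for all $x\in A$; (ii) $\delta_{\mathcal C}=-s$ Lebesgue-a.e. on $A$; (iii) for every nonempty open $B\subset A$ and $\gamma\in[-s,d/p-s]$, $\dim_H\{x\in B:\delta_{\mathcal C}(x)=\gamma\}=d-sp-\gamma p$ (for $p=\infty$: $\delta_{\mathcal C}=-s$ on $A$). Dyadic covering property: there exist $C_0>0$ and finitely many triplets $(i_l,j_l,k_l)$ with $j_l\ge1$ such that every $x\in[0,1)^d$ has some $l$ with $|\psi^{(i_l)}(2^{j_l}x-k_l)|\ge C_0$. Prevalence: in a complete metric vector space $E$, a Borel set $A$ is Haar-null if there is a compactly supported Borel probability measure $\mu$ on $E$ with $\mu(x+A)=0$ for all $x\in E$; a set is Haar-null if contained in a Haar-null Borel set; a set is prevalent if its complement is Haar-null. *)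

(* Defs.v *)
From HB Require Import structures.
From mathcomp Require Import all_boot all_order all_algebra.
From mathcomp Require Import all_classical all_reals all_analysis.
From mathcomp.real_closed Require Import complex.

Set Implicit Arguments.
Unset Strict Implicit.
Unset Printing Implicit Defensive.

Import Order.TTheory GRing.Theory Num.Theory.
Local Open Scope classical_set_scope.
Local Open Scope ring_scope.

(* R[i] is a pointed type (needed to build the Borel sigma-algebra type). *)
HB.instance Definition _ (R : rcfType) := isPointed.Build R[i] 0%R.

Definition cabs {R : rcfType} (z : R[i]) : R := ComplexField.Normc.normc z.

Section Wavelets.
Context {R : realType} (d N : nat).

Definition pt := 'I_d -> R.
Definition idx := {ffun 'I_d -> int}.
(* coefficient sequences (c^{(i)}_{j,k}) indexed by i < N, scale j, k in Z^d *)
Definition Seq := 'I_N -> nat -> idx -> R[i].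

Definition edist (x y : pt) : R := Num.sqrt (\sum_(m < d) (x m - y m) ^+ 2).
Definition enorm (x : pt) : R := edist x (fun _ => 0).

Definition wav (psi : 'I_N -> pt -> R[i]) (i : 'I_N) (j : nat) (k : idx) (x : pt)
  : R[i] := psi i (fun m => 2 ^+ j * x m - (k m)%:~R).

Definition d_over (p : \bar R) : R :=
  match p with r%:E => d%:R / r | _ => 0 end.

Definition level (s : R) (p : \bar R) (C : Seq) (j : nat) : \bar R :=
  match p with
  | r%:E => poweR (\esum_(ik in [set: 'I_N * idx])
               ((cabs (C ik.1 j ik.2) * 2 `^ ((s - d_over p) * j%:R)) `^ r)%:E)
             r^-1
  | _ => ereal_sup [set ((cabs (C ik.1 j ik.2) * 2 `^ ((s - d_over p) * j%:R)))%:E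
                   | ik in [set: 'I_N * idx]]
  end.

Definition bnorm (s : R) (p q : \bar R) (C : Seq) : \bar R :=
  match q with
  | r%:E => poweR (\esum_(j in [set: nat]) poweR (level s p C j) r) r^-1
  | _ => ereal_sup [set level s p C j | j in [set: nat]]
  end.

Definition inB (s : R) (p q : \bar R) : set Seq :=
  [set C | (bnorm s p q C < +oo)%E].

Definition sadd (C C' : Seq) : Seq := fun i j k => C i j k + C' i j k.
Definition ssub (C C' : Seq) : Seq := fun i j k => C i j k - C' i j k.

Definition openB (s : R) (p q : \bar R) (U : set Seq) : Prop :=
  U `<=` inB s p q /\
  forall C, U C -> exists2 r : R, 0 < r &
    [set C' | inB s p q C' /\ (bnorm s p q (ssub C' C) < r%:E)%E] `<=` U.

(* the measurable space of Borel subsets (carrier Seq, sigma-algebra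
   generated by the open subsets of b^{s,q}_p) *)
Definition BorelB (s : R) (p q : \bar R) := g_sigma_algebraType (openB s p q).

Definition compactB (s : R) (p q : \bar R) (K : set Seq) : Prop :=
  K `<=` inB s p q /\
  forall G : set (set Seq), G `<=` openB s p q -> K `<=` \bigcup_(U in G) U ->
    exists2 F : seq (set Seq), {subset F <= G} &
      K `<=` \bigcup_(U in [set` F]) U.

Definition haar_null_borel (s : R) (p q : \bar R) (A : set Seq) : Prop :=
  A `<=` inB s p q /\ measurable (A : set (BorelB s p q)) /\
  exists mu : probability (BorelB s p q) R,
    (exists2 K, compactB s p q K & mu K = 1%E) /\
    forall x, inB s p q x -> mu (sadd x @` A) = 0%E.

Definition haar_null (s : R) (p q : \bar R) (S : set Seq) : Prop :=
  exists2 A, S `<=` A & haar_null_borel s p q A.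

Definition prevalent (s : R) (p q : \bar R) (S : set Seq) : Prop :=
  haar_null s p q (inB s p q `\` S).

Definition divexp (psi : 'I_N -> pt -> R[i]) (C : Seq) (x : pt) : \bar R :=
  ereal_sup [set g%:E | g in [set g : R | exists2 c : R, 0 < c &
     exists (i : nat -> 'I_N) (j : nat -> nat) (k : nat -> idx),
       (forall M : nat, exists n0, forall n, (n0 <= n)%N -> (M <= j n)%N) /\
       forall n, c * 2 `^ (g * (j n)%:R)
                 <= cabs (C (i n) (j n) (k n) * wav psi (i n) (j n) (k n) x)]].

Definition lnull (A : set pt) : Prop :=
  forall eps : R, 0 < eps -> exists a b : nat -> pt,
    (forall n m, a n m <= b n m) /\
    A `<=` \bigcup_n [set x | forall m, a n m <= x m < b n m] /\
    (\esum_(n in [set: nat]) (\prod_(m < d) (b n m - a n m))%:E < eps%:E)%E.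

Definition diam (U : set pt) : \bar R :=
  ereal_sup [set r | exists x y, U x /\ U y /\ r = (edist x y)%:E].

Definition hterm (t : R) (U : set pt) : \bar R :=
  if pselect (U = set0) then 0%E else poweR (diam U) t.

Definition hcontent (t delta : R) (A : set pt) : \bar R :=
  ereal_inf [set \esum_(n in [set: nat]) hterm t (U n) | U in
    [set U : nat -> set pt | A `<=` \bigcup_n U n /\
                             forall n, (diam (U n) <= delta%:E)%E]].

Definition hmeasure (t : R) (A : set pt) : \bar R :=
  ereal_sup [set hcontent t delta A | delta in [set delta : R | 0 < delta]].

Definition dimH (A : set pt) : \bar R :=
  if pselect (A = set0) then -oo%E
  else ereal_inf [set t%:E | t in [set t : R | 0 <= t /\ hmeasure t A = 0%E]].

Definition openRd (B : set pt) : Prop :=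
  forall x, B x -> exists2 e : R, 0 < e & forall y, edist x y < e -> B y.

Definition max_divergent (s : R) (p : \bar R) (psi : 'I_N -> pt -> R[i])
    (C : Seq) (A : set pt) : Prop :=
  match p with
  | r%:E =>
      (forall x, A x -> ((-s)%:E <= divexp psi C x <= (d_over p - s)%:E)%E) /\
      lnull [set x | A x /\ divexp psi C x <> (-s)%:E] /\
      (forall B, openRd B -> B !=set0 -> B `<=` A ->
         forall g : R, -s <= g <= d_over p - s ->
           dimH [set x | B x /\ divexp psi C x = g%:E]
             = (d%:R - s * r - g * r)%:E)
  | _ => forall x, A x -> divexp psi C x = (-s)%:E
  end.

Definition fast_decay (psi : 'I_N -> pt -> R[i]) : Prop :=
  forall (i : 'I_N) (n : nat), exists Cn : R,
    forall x, cabs (psi i x) <= Cn / (1 + enorm x) ^+ n.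

Definition dyadic_covering (psi : 'I_N -> pt -> R[i]) : Prop :=
  exists2 C0 : R, 0 < C0 &
    exists L : seq ('I_N * nat * idx),
      (forall l, l \in L -> (1 <= l.1.2)%N) /\
      forall x : pt, (forall m, 0 <= x m < 1) ->
        exists2 l, l \in L & C0 <= cabs (wav psi l.1.1 l.1.2 l.2 x).

End Wavelets.

(* Main.v *)
Require Import Defs.
From HB Require Import structures.
From mathcomp Require Import all_boot all_order all_algebra.
From mathcomp Require Import all_classical all_reals all_analysis.
From mathcomp.real_closed Require Import complex.
From mathcomp Require Import ring lra zify.
Import Order.TTheory GRing.Theory Num.Theory.
Import numFieldNormedType.Exports.
Local Open Scope classical_set_scope.
Local Open Scope ring_scope.

Set Implicit Arguments.
Unset Strict Implicit.
Unset Printing Implicit Defensive.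

(* A sequence c in b^{s,q}_p is bounded scale by scale, so fast decay and
   counting the large coefficients give delta <= d/p - s everywhere and
   dim {delta > g} <= d - sp - gp; these bounds hold for every sequence.
   The reverse inequalities hold almost surely for f + (random probe), whatever
   f is. The probe has coefficients F xi: F is a saturating profile, of size
   2^{(d/p - s)j - dJ/p} up to subexponential factors near the corners of the
   dyadic cubes of scale J <= j, and xi is uniform on 2^m equally spaced values
   with m of order sqrt j. At most one value of xi makes a given coefficient of
   f + F xi small, so the probability that some dyadic cube of a bounded region
   sees only small coefficients on about sqrt n successive scales is tiny.
   Hence infinitely often every dyadic cube sees a large coefficient, so that
   delta >= -s, and every corner of scale n sees a large coefficient at scales
   close to n / alpha for each alpha in [0, 1]. The points whose binary digits
   are free on [j_k, n_k) and zero on [n_k, j_{k+1}), with n_k >> j_k and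
   n_k ~ alpha j_{k+1}, then satisfy delta >= d/p - s - alpha d/p; coin tossing on
   the free digits shows that they are not covered by countably many sets of
   dimension < alpha d, in particular not by the sets {delta > g + 1/n}. *)

(** * Extended sums and dyadic cubes *)

(** The exceptional set must be small for all points at once. A union bound over the cubes of scale
    n in a box costs about 2^(dn), while one coefficient may carry only o(n) random bits, since
    resolving [F xi] up to [F / 2^m] shrinks the usable size by 2^m and this loss has to stay
    subexponential. No single scale is enough. But r distinct scales, all at least r^2, carry a
    multiple of r bits each, hence a multiple of r^2 independent bits, and this beats the entropy of
    cubes of scale about r^2. The price is that only one of the r scales is known to succeed, and
    not which one; so the zero digits of the Cantor points have to run through a whole window of
    scales. Windows start anywhere between r^2 and r^4, so that r^2 divided by the starting scale
    can tend to any alpha in [0, 1], including 0. Hausdorff measure is traded for covers by dyadic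
    cubes, which are countable in number and are the sets that the coefficients see. The case p =
    +oo goes through the same estimates with 1/p read as 0. *)

Lemma esum_subset (R : realType) (T : choiceType) (A B : set T)
    (a : T -> \bar R) :
  A `<=` B -> (\esum_(i in A) a i <= \esum_(i in B) a i)%E.
Proof.
move=> AB; apply: le_ereal_sup => _ [F [finF FA] <-].
by exists F => //; split=> // x /FA /AB.
Qed.

(** The sets may overlap; choosing one index [g x] per point embeds the union into the set of pairs,
    where the iterated sum is exact. *)
Lemma esum_bigcup_le (R : realType) (T I : choiceType) (J : set I)
    (S : I -> set T) (a : T -> \bar R) : (forall x, 0 <= a x)%E ->
  (\esum_(x in \bigcup_(i in J) S i) a x
   <= \esum_(i in J) \esum_(x in S i) a x)%E.
Proof.
move=> a0; rewrite esum_esum//; set U := \bigcup_(i in J) S i.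
case: (pselect (J = set0)) => [J0|/eqP/set0P[i0 _]].
  by rewrite /U J0 bigcup_set0 esum_set0 esum_ge0.
have [g gP] : exists g : T -> I, forall x, U x -> J (g x) /\ S (g x) x.
  have h x : exists i, U x -> J i /\ S i x.
    have [[i Ji Si]|nU] := pselect (U x); first by exists i.
    by exists i0.
  by have [g gP] := choice h; exists g.
rewrite (_ : \esum_(x in U) a x =
    \esum_(k in (fun x => (g x, x)) @` U) a k.2); last first.
  by rewrite esum_image// => x y _ _ [].
apply: esum_subset => _ [x Ux <-] /=; exact: gP.
Qed.

(** Covers in [hcontent] and [lnull], and countable subadditivity, are indexed by [nat]; this passes
    between them and sums over a countable type. *)
Lemma esum_pickle (R : realType) (T : countType) (S : set T)
    (g : T -> \bar R) :
  \esum_(n in [set: nat]) (if (pickle_inv n : option T) is Some q then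
     if q \in S then g q else 0%E else 0%E) = \esum_(q in S) g q.
Proof.
rewrite (_ : \esum_(q in S) g q = \esum_(n in pickle @` S)
   (if (pickle_inv n : option T) is Some q then g q else 0%E)); last first.
  rewrite esum_image.
    by apply: eq_esum => q _; rewrite pickleK_inv.
  by move=> x y _ _; exact: (pcan_inj pickleK).
rewrite [RHS]esum_mkcond; apply: eq_esum => n _.
case: ifPn => [|].
  by rewrite inE => -[q Sq <-]; rewrite pickleK_inv mem_set.
rewrite notin_setE => nS; case E : (pickle_inv n : option T) => [q|//].
case: ifPn => //; rewrite inE => Sq; exfalso; apply: nS; exists q => //.
by have := @pickle_invK T n; rewrite E.
Qed.

Lemma esum_geo_half (R : realType) (e : R) : 0 <= e ->
  (\esum_(n in [set: nat]) (e / (2 ^ n.+1)%:R)%:E <= e%:E)%E.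
Proof.
move=> e0; rewrite -nneseries_esumT; first exact: epsilon_trick0.
by move=> n; rewrite lee_fin divr_ge0.
Qed.

Lemma esum_image_le (R : realType) (T I : choiceType) (P : set I) (e : I -> T)
    (a : T -> \bar R) : (forall x, 0 <= a x)%E ->
  (\esum_(j in e @` P) a j <= \esum_(i in P) a (e i))%E.
Proof.
move=> a0; rewrite (_ : e @` P = \bigcup_(i in P) [set e i]); last first.
  by apply/seteqP; split=> [_ [i Pi <-]|x [i Pi ->]]; exists i.
apply: (le_trans (esum_bigcup_le _ _ a0)).
by apply: le_esum => i _; rewrite esum_set1.
Qed.

Lemma esum_finType (R : realType) (T : finType) (f : T -> \bar R) :
  (forall x, 0 <= f x)%E -> \esum_(i in [set: T]) f i = (\sum_(i : T) f i)%E.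
Proof.
move=> f0; rewrite -big_enum/= fsbig_seq ?enum_uniq// (_ : [set` _] = setT).
  by rewrite -esum_fset//; exact: finite_finset.
by apply/seteqP; split=> // x _; rewrite /= mem_enum.
Qed.

Lemma esumZl (R : realType) (T : choiceType) (S : set T) (c : R)
    (a : T -> \bar R) : 0 <= c -> (forall x, 0 <= a x)%E ->
  (\esum_(i in S) (c%:E * a i) <= c%:E * \esum_(i in S) a i)%E.
Proof.
move=> c0 a0; apply: ge_ereal_sup => _ [F [finF FS] <-].
rewrite -ge0_mule_fsumr//; apply: lee_wpmul2l; rewrite ?lee_fin//.
by apply: ereal_sup_ubound; exists F.
Qed.

Section Dyadic.
Context {R : realType} {d : nat}.
Local Notation pt := (@pt R d).
Local Notation idx := (idx d).
Implicit Types (x y : pt) (A B : set pt).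

Definition flr (m : nat) x : idx := [ffun i => Num.floor (2 ^+ m * x i)].

Definition cube (q : nat * idx) : set pt := [set x | flr q.1 x = q.2].

Lemma flr_itv m x i : (flr m x i)%:~R <= 2 ^+ m * x i < (flr m x i)%:~R + 1.
Proof. by rewrite ffunE; have := floor_itv (2 ^+ m * x i); rewrite intrD. Qed.

(** Nesting of dyadic cubes. Integer division by a positive power of two rounds down, so negative
    coordinates are covered too. *)
Lemma flr_div m n x i : (m <= n)%N ->
  flr m x i = (flr n x i %/ 2 ^+ (n - m))%Z.
Proof.
move=> mn; rewrite [LHS]ffunE; apply: floor_def.
set D : int := 2 ^+ (n - m); have D0 : 0 < D by rewrite exprn_gt0.
have /andP[h1 h2] := flr_itv n x i; move: h1 h2.
set q := flr n x i; rewrite -{1 2}(subnK mn) exprD -mulrA.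
set y := 2 ^+ m * x i => h1 h2.
have DE : D%:~R = 2 ^+ (n - m) :> R by rewrite /D rmorphXn.
rewrite -DE in h1 h2; have D0R : 0 < D%:~R :> R by rewrite ltr0z.
have qE := divz_eq q D.
have r0 := modz_ge0 q (lt0r_neq0 D0); have r1 := ltz_pmod q D0.
rewrite -(ler_pM2l D0R) -[X in _ && X](ltr_pM2l D0R) -!intrM; apply/andP; split.
  by apply: le_trans h1; rewrite ler_int {2}qE; lia.
apply: (lt_le_trans h2); rewrite (_ : 1 = 1%:~R)// -intrD ler_int {1}qE.
rewrite mulrDr mulr1; lia.
Qed.

Lemma edist_coord x y i : `|x i - y i| <= Defs.edist x y.
Proof.
rewrite /Defs.edist -sqrtr_sqr ler_wsqrtr// (bigD1 i)//= lerDl.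
by apply: sumr_ge0 => j _; exact: sqr_ge0.
Qed.

Lemma edist_ge0 x y : 0 <= Defs.edist x y.
Proof. exact: sqrtr_ge0. Qed.

Lemma edist_le x y (a : R) : 0 <= a -> (forall i, `|x i - y i| <= a) ->
  Defs.edist x y <= d.+1%:R * a.
Proof.
move=> a0 H; rewrite -(ler_sqr (edist_ge0 _ _)) ?nnegrE ?mulr_ge0//.
rewrite sqr_sqrtr; last by apply: sumr_ge0 => i _; exact: sqr_ge0.
apply: (@le_trans _ _ (\sum_(i < d) a ^+ 2)).
  by apply: ler_sum => i _; rewrite -[leLHS]real_normK ?num_real// lerXn2r ?nnegrE.
rewrite sumr_const card_ord -[leLHS]mulr_natl exprMn.
by apply: ler_wpM2r; rewrite ?sqr_ge0// -natrX ler_nat; nia.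
Qed.

Lemma flr_eq_edist m x y : flr m x = flr m y ->
  Defs.edist x y <= d.+1%:R * 2 ^- m.
Proof.
move=> xy; apply: edist_le => [|i]; first by rewrite invr_ge0 exprn_ge0.
have P : 0 < 2 ^+ m :> R by rewrite exprn_gt0.
rewrite -(ler_pM2l P) divff ?gt_eqF// -{1}(gtr0_norm P) -normrM mulrBr.
have := flr_itv m x i; have := flr_itv m y i; rewrite xy.
set u := 2 ^+ m * x i; set v := 2 ^+ m * y i => /andP[? ?] /andP[? ?].
by rewrite ler_norml; apply/andP; split; lra.
Qed.

Lemma edist_flr m x y i : Defs.edist x y <= 2 ^- m ->
  `|flr m x i - flr m y i| <= 1.
Proof.
move=> /(le_trans (edist_coord x y i)) h.
have P : 0 < 2 ^+ m :> R by rewrite exprn_gt0.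
move: h; rewrite -(ler_pM2l P) divff ?gt_eqF// -{1}(gtr0_norm P) -normrM mulrBr.
set u := 2 ^+ m * x i; set v := 2 ^+ m * y i.
have := flr_itv m x i; have := flr_itv m y i.
rewrite -/u -/v ler_norml => /andP[? ?] /andP[? ?] /andP[h1 h2].
have a1 : (flr m x i)%:~R < ((flr m y i) + 2)%:~R :> R by rewrite intrD; lra.
have a2 : (flr m y i)%:~R < ((flr m x i) + 2)%:~R :> R by rewrite intrD; lra.
move: a1 a2; rewrite !ltr_int => a1 a2; rewrite ler_norml; apply/andP; split; lia.
Qed.

End Dyadic.

(** * Dyadic null sets and Hausdorff measure *)

Section DyadicNull.
Context {R : realType} {d : nat}.
Local Notation pt := (@pt R d).
Local Notation idx := (idx d).
Implicit Types (x y : pt) (A B : set pt).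

Definition dweight (t : R) (q : nat * idx) : \bar R :=
  (2 `^ (- (t * q.1%:R)))%:E.

(** Null sets of the dyadic net measure, without a bound on the cube sizes: for [t > 0] a small
    total weight already forces small cubes. For [t <= 0] every weight is at least 1, so only the
    empty set is null. *)
Definition dnull (t : R) A := forall eta : R, 0 < eta ->
  exists2 S : set (nat * idx), A `<=` \bigcup_(q in S) cube q &
    (\esum_(q in S) dweight t q <= eta%:E)%E.

Lemma dweight_ge0 t q : (0 <= dweight t q)%E.
Proof. by rewrite lee_fin powR_ge0. Qed.

Lemma dnull_sub t A B : A `<=` B -> dnull t B -> dnull t A.
Proof.
by move=> AB nB eta /nB [S BS Sl]; exists S => // x /AB /BS.
Qed.

Lemma dnull_bigcup t (A : nat -> set pt) :
  (forall n, dnull t (A n)) -> dnull t (\bigcup_n A n).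
Proof.
move=> nA eta eta0.
have h n : exists S, A n `<=` \bigcup_(q in S) cube q /\
    (\esum_(q in S) dweight t q <= (eta / (2 ^ n.+1)%:R)%:E)%E.
  have [|S ? ?] := nA n (eta / (2 ^ n.+1)%:R); last by exists S.
  by rewrite divr_gt0// ltr0n expn_gt0.
have [S SP] := choice h; exists (\bigcup_n S n).
  move=> x [n _ Anx]; have [/(_ _ Anx)[q Sq xq] _] := SP n.
  by exists q => //; exists n.
apply: (le_trans (esum_bigcup_le _ _ (dweight_ge0 t))).
apply: le_trans (esum_geo_half (ltW eta0)).
by apply: le_esum => n _; have [_] := SP n.
Qed.

Lemma hterm_ge0 t (U : set pt) : (0 <= hterm t U)%E.
Proof. by rewrite /hterm; case: pselect => // ?; exact: poweR_ge0. Qed.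

Lemma hcontent_ge0 t e A : (0 <= hcontent t e A)%E.
Proof.
apply: le_ereal_inf_tmp => _ [U _ <-]; apply: esum_ge0 => n _; exact: hterm_ge0.
Qed.

Lemma hmeasure_eq0P t A : hmeasure t A = 0%E <->
  forall e, 0 < e -> hcontent t e A = 0%E.
Proof.
split=> [h e e0|h].
  apply/eqP; rewrite eq_le hcontent_ge0 andbT -h.
  by apply: ereal_sup_ubound; exists e.
apply/eqP; rewrite eq_le; apply/andP; split.
  by apply: ge_ereal_sup => _ [e /= e0 <-]; rewrite h.
by rewrite -(h 1 ltr01); apply: ereal_sup_ubound; exists 1 => //=.
Qed.

Lemma exists_powR_lt (t e : R) : 0 < t -> 0 < e ->
  exists m0, forall m, (m0 <= m)%N -> 2 `^ (- (t * m%:R)) < e.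
Proof.
move=> t0 e0; have l2 : 0 < ln (2 : R) by rewrite ln_gt0// ltr1n.
exists (Num.truncn (- ln e / (t * ln 2))).+1 => m mm0.
rewrite /powR pnatr_eq0/= -[ltRHS]lnK ?posrE// ltr_expR.
have : - ln e / (t * ln 2) < m%:R.
  by apply: (lt_le_trans (truncnS_gt _)); rewrite ler_nat.
by rewrite ltr_pdivrMr ?mulr_gt0//; lra.
Qed.

(** The scale makes [2 ^- m] comparable to the diameter. The extra [e] pays for empty sets and
    single points, for which a fine scale is taken arbitrarily. *)
Lemma small_scale t t' (U : set pt) (e : R) : 0 <= t -> t <= t' -> 0 < t' ->
  (diam U <= 1)%E -> 0 < e ->
  exists m, (forall x y, U x -> U y -> Defs.edist x y <= 2 ^- m) /\
    ((2 `^ (- (t' * m%:R)))%:E <= (2 `^ t')%:E * hterm t U + e%:E)%E.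
Proof.
move=> t0 tt' t'0 U1 e0; have [m0 Hm0] := exists_powR_lt t'0 e0.
have small : ((2 `^ (- (t' * m0%:R)))%:E <= (2 `^ t')%:E * hterm t U + e%:E)%E.
  apply: (@le_trans _ _ e%:E); first by rewrite lee_fin ltW// Hm0.
  by rewrite leeDr// mule_ge0 ?hterm_ge0// lee_fin powR_ge0.
have [U0|nU0] := pselect (U = set0).
  by exists m0; split=> // x y; rewrite U0.
have [u Uu] : exists u, U u by apply/set0P/eqP.
have dU x y : U x -> U y -> ((Defs.edist x y)%:E <= diam U)%E.
  by move=> Ux Uy; apply: ereal_sup_ubound; exists x, y.
have [r rE] : exists r : R, diam U = r%:E.
  case E : (diam U) U1 => [r| |]//; first by exists r.
  by move=> _; have := dU _ _ Uu Uu; rewrite E.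
rewrite rE in U1 dU; rewrite lee_fin in U1.
have {}dU x y : U x -> U y -> Defs.edist x y <= r.
  by move=> Ux Uy; rewrite -lee_fin; exact: dU.
have r0 : 0 <= r.
  by apply: le_trans (dU _ _ Uu Uu); exact: edist_ge0.
have [r00|rn0] := eqVneq r 0.
  exists m0; split=> // x y Ux Uy; apply: (le_trans (dU _ _ Ux Uy)).
  by rewrite r00 invr_ge0 exprn_ge0.
have rgt : 0 < r by rewrite lt_def rn0.
have ex : exists m, 2 ^- m.+1 < r.
  have [m1 Hm1] := exists_powR_lt (@ltr01 R) rgt; exists m1.
  have := Hm1 m1.+1 (leqnSn _).
  by rewrite mul1r powRN powR_mulrn.
(* Minimality of [m] will give [r <= 2 ^- m]; for [m = 0] this is the bound [r <= 1]. *)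
have [m mr mmin] := ex_minnP ex.
exists m; split.
  move=> x y Ux Uy; apply: (le_trans (dU _ _ Ux Uy)).
  have [m0'|mpos] := posnP m; first by rewrite m0' expr0 invr1.
  rewrite leNgt -(prednK mpos); apply/negP => /mmin; lia.
rewrite /hterm; case: pselect => // ?; rewrite rE poweR_EFin -EFinM -EFinD.
rewrite lee_fin ler_wpDr ?(ltW e0)//.
apply: (@le_trans _ _ (2 `^ t' * r `^ t')); last first.
  by rewrite ler_wpM2l ?powR_ge0// ger_powR// rgt.
rewrite -powRM//; have -> : 2 `^ (- (t' * m%:R)) = (2 ^- m : R) `^ t'.
  by rewrite -powR_invn// -powRrM mulrC mulNr.
apply: ge0_ler_powR; rewrite ?nnegrE ?invr_ge0 ?mulr_ge0 ?(ltW t'0)//.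
have := ltW mr; rewrite exprS invfM ler_pdivrMl//.
Qed.

(** Each covering set is replaced by [3 ^ d] neighbouring cubes of comparable size. Allowing
    [t' > t] lets [t = 0] be treated with a positive exponent. *)
Lemma hmeasure_dnull t t' A : 0 <= t -> t <= t' -> 0 < t' ->
  hmeasure t A = 0%E -> dnull t' A.
Proof.
move=> t0 tt' t'0 /hmeasure_eq0P /(_ 1 ltr01) hA eta eta0.
pose K : R := 3 ^+ d; have K0 : 0 < K by rewrite exprn_gt0.
pose c : R := 2 `^ t'; have c0 : 0 < c by rewrite powR_gt0.
(* In [c * e + e], the first [e] is the slack in the infimum and the second is the sum of the errors
   [e / 2 ^ n.+1] from [small_scale]. *)
have [e [e0 eK]] : exists e, 0 < e /\ K * (c * e + e) <= eta.
  exists (eta / (K * (c + 1))); split.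
    by rewrite divr_gt0// mulr_gt0// addr_gt0.
  rewrite -{2}(mul1r (_ / _)) -mulrDl mulrA mulrCA divff ?mulr1//.
  by rewrite gt_eqF// mulr_gt0// addr_gt0.
have [|w] := @lb_ereal_inf_adherent R [set \esum_(n in [set: nat]) hterm t (U n)
   | U in [set U : nat -> set pt | A `<=` \bigcup_n U n /\
                             forall n, (diam (U n) <= 1%:E)%E]] _ e0.
  by rewrite -/(hcontent t 1 A) hA.
move=> [U [AU dU] <-]; rewrite -/(hcontent t 1 A) hA add0e => Ue.
have h n : exists m, (forall x y, U n x -> U n y -> Defs.edist x y <= 2 ^- m) /\
    ((2 `^ (- (t' * m%:R)))%:E <= c%:E * hterm t (U n) +
       (e / (2 ^ n.+1)%:R)%:E)%E.
  by apply: small_scale => //; rewrite divr_gt0// ltr0n expn_gt0.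
have [m Hm] := choice h.
have h' n : exists z : pt, (exists x, U n x) -> U n z.
  have [[x Ux]|nx] := pselect (exists x, U n x); first by exists x.
  by exists (fun _ => 0).
have [z Hz] := choice h'.
pose nb n (u : {ffun 'I_d -> 'I_3}) : nat * idx :=
  (m n, [ffun i => flr (m n) (z n) i + (u i)%:Z - 1]).
exists (\bigcup_n (nb n @` setT)).
  move=> x /AU [n _ Unx].
  have Uz : U n (z n) by apply: Hz; exists x.
  have near i : `|flr (m n) x i - flr (m n) (z n) i| <= 1.
    by apply: edist_flr; have [H _] := Hm n; exact: H.
  exists (m n, flr (m n) x) => //; exists n => //.
  pose u : {ffun 'I_d -> 'I_3} :=
    [ffun i => inord `|(flr (m n) x i - flr (m n) (z n) i + 1)%R|%N].
  have uE i : u i = `|(flr (m n) x i - flr (m n) (z n) i + 1)%R|%N :> nat.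
    by have := near i; rewrite [u i]ffunE => nr; rewrite inordK//; lia.
  exists u => //; congr pair; apply/ffunP => i; rewrite [LHS]ffunE uE.
  move: (near i) => /=; move: (flr _ _ _) (flr _ _ _) => a b nr.
  rewrite gez0_abs; lia.
apply: (le_trans (esum_bigcup_le _ _ (dweight_ge0 t'))).
apply: (@le_trans _ _ (\esum_(n in [set: nat]) (K%:E *
   (c%:E * hterm t (U n) + (e / (2 ^ n.+1)%:R)%:E)))%E).
  apply: le_esum => n _.
  apply: (le_trans (esum_image_le _ _ (dweight_ge0 t'))).
  rewrite esum_finType; last by move=> u; exact: dweight_ge0.
  rewrite /dweight /= sumEFin sumr_const card_ffun !card_ord.
  have [_ Hn] := Hm n; apply: le_trans (_ : K%:E * (2 `^ (- (t' * (m n)%:R)))%:E <= _)%E.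
    by rewrite -EFinM lee_fin -[leLHS]mulr_natl natrX.
  by apply: lee_wpmul2l => //; rewrite lee_fin ltW.
have p2 n : (0 <= (e / (2 ^ n.+1)%:R)%:E)%E.
  by rewrite lee_fin divr_ge0 ?(ltW e0).
apply: (le_trans (esumZl _ (ltW K0) _)).
  by move=> n; rewrite adde_ge0// mule_ge0 ?hterm_ge0// lee_fin ltW.
rewrite esumD//; last by move=> n _; rewrite mule_ge0 ?hterm_ge0// lee_fin ltW.
apply: (@le_trans _ _ (K%:E * (c%:E * e%:E + e%:E))%E); last first.
  by rewrite (_ : _ * _ = (K * (c * e + e))%:E)%E ?lee_fin.
apply: lee_wpmul2l; first by rewrite lee_fin ltW.
apply: leeD; last exact: esum_geo_half (ltW e0).
apply: (le_trans (esumZl _ (ltW c0) _)); first by move=> n; exact: hterm_ge0.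
by apply: lee_wpmul2l; rewrite ?lee_fin ltW.
Qed.

Lemma diam_cube q : (diam (cube q : set pt) <= (d.+1%:R * 2 ^- q.1)%:E)%E.
Proof.
apply: ge_ereal_sup => _ [x [y [xq [yq ->]]]]; rewrite lee_fin.
by apply: flr_eq_edist; rewrite xq yq.
Qed.

Lemma hterm_cube t q : 0 <= t ->
  (hterm t (cube q : set pt) <= (d.+1%:R `^ t)%:E * dweight t q)%E.
Proof.
move=> t0; rewrite /hterm; case: pselect => [?|n0].
  by rewrite mule_ge0 ?dweight_ge0// lee_fin powR_ge0.
rewrite /dweight -EFinM (_ : 2 `^ _ = (2 ^- q.1 : R) `^ t); last first.
  by rewrite -powR_invn// -powRrM mulrC mulNr.
rewrite -powRM// ?invr_ge0 ?exprn_ge0// -poweR_EFin.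
have [x xq] : exists x, cube q x by apply/set0P/eqP.
apply: gt0_ler_poweR => //; last exact: diam_cube.
  rewrite in_itv/= leey andbT.
  apply: (@le_trans _ _ (Defs.edist x x)%:E); first by rewrite lee_fin edist_ge0.
  by apply: ereal_sup_ubound; exists x, x.
by rewrite in_itv/= leey andbT lee_fin mulr_ge0// invr_ge0 exprn_ge0.
Qed.

Definition seq_cube (S : set (nat * idx)) (n : nat) : set pt :=
  if (pickle_inv n : option (nat * idx)) is Some q then
     if q \in S then cube q else set0 else set0.

Lemma seq_cube_cover S : \bigcup_(q in S) cube q `<=` \bigcup_n seq_cube S n.
Proof.
move=> x [q Sq xq]; exists (pickle q) => //.
by rewrite /seq_cube pickleK_inv mem_set.
Qed.

Lemma dnull_hmeasure t A : 0 < t -> dnull t A -> hmeasure t A = 0%E.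
Proof.
move=> t0 nA; apply/hmeasure_eq0P => e e0.
apply/eqP; rewrite eq_le hcontent_ge0 andbT; apply/lee_addgt0Pr => f f0.
rewrite add0e; pose c : R := d.+1%:R `^ t.
have c0 : 0 < c by rewrite powR_gt0.
(* The first bound controls the sum; the second makes each single cube so small that its diameter is
   at most [e]. *)
pose eta := Num.min (f / c) ((e / d.+1%:R) `^ t).
have eta0 : 0 < eta by rewrite lt_min divr_gt0// powR_gt0// divr_gt0.
have [S AS Sl] := nA _ eta0.
have Sq q : S q -> 2 ^- q.1 <= e / d.+1%:R :> R.
  move=> Sq; have : (dweight t q <= eta%:E)%E.
    apply: le_trans Sl; rewrite -(@esum_set1 _ _ q (dweight t)) ?dweight_ge0//.
    by apply: esum_subset => _ ->.
  rewrite /dweight (_ : 2 `^ _ = (2 ^- q.1 : R) `^ t); last first.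
    by rewrite -powR_invn// -powRrM mulrC mulNr.
  rewrite lee_fin /eta le_min => /andP[_]; apply: contraTT; rewrite -!ltNge => h.
  apply: gt0_ltr_powR => //; rewrite nnegrE ?invr_ge0 ?exprn_ge0//.
  by rewrite divr_ge0// ltW.
apply: (@le_trans _ _ (\esum_(n in [set: nat]) hterm t (seq_cube S n))).
  apply: ereal_inf_lbound; exists (seq_cube S) => //; split.
    by move=> x /AS /seq_cube_cover.
  move=> n; rewrite /seq_cube; case: (pickle_inv n) => [q|]; last first.
    by apply: ge_ereal_sup => _ [? [? [[]]]].
  case: ifPn => [|_]; last by apply: ge_ereal_sup => _ [? [? [[]]]].
  rewrite inE => /Sq h; apply: (le_trans (diam_cube q)).
  by rewrite lee_fin mulrC -ler_pdivlMr.
apply: (@le_trans _ _ (c%:E * \esum_(q in S) dweight t q)%E); last first.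
  apply: (@le_trans _ _ (c%:E * eta%:E)%E).
    by apply: lee_wpmul2l => //; rewrite lee_fin ltW.
  by rewrite -EFinM lee_fin mulrC -ler_pdivlMr// /eta ge_min lexx.
rewrite -(esum_pickle S).
apply: le_trans (esumZl _ (ltW c0) _); last first.
  move=> n; case: (pickle_inv n) => [q|]//; case: ifP => // _.
  exact: dweight_ge0.
apply: le_esum => n _; rewrite /seq_cube; case: (pickle_inv n) => [q|].
  case: ifPn => _; first exact: hterm_cube (ltW t0).
  by rewrite /hterm; case: pselect => //; rewrite mule0.
by rewrite /hterm; case: pselect => //; rewrite mule0.
Qed.

Lemma dnull_lnull A : (0 < d)%N -> dnull d%:R A -> lnull A.
Proof.
move=> d0 nA eps eps0; have [|S AS Sl] := nA (eps / 2); first by rewrite divr_gt0.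
(* Indices that code no cube of [S] get a degenerate box, of volume zero since [0 < d]. *)
pose lo n : pt := if (pickle_inv n : option (nat * idx)) is Some q then
     if q \in S then (fun i => (q.2 i)%:~R * 2 ^- q.1) else (fun=> 0) else (fun=> 0).
pose hi n : pt := if (pickle_inv n : option (nat * idx)) is Some q then
     if q \in S then (fun i => ((q.2 i)%:~R + 1) * 2 ^- q.1) else (fun=> 0) else (fun=> 0).
have P q : 0 < 2 ^+ q :> R by rewrite exprn_gt0.
exists lo, hi; split; [|split].
- move=> n m; rewrite /lo /hi; case: (pickle_inv n) => [q|]//; case: ifP => // _.
  by rewrite ler_wpM2r ?invr_ge0 ?exprn_ge0// lerDl.
- move=> x /AS [q Sq xq]; exists (pickle q) => //= i.
  rewrite /lo /hi pickleK_inv mem_set// -xq.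
  by rewrite ler_pdivrMr// ltr_pdivlMr// ![x i * _]mulrC flr_itv.
- apply: (@le_lt_trans _ _ (\esum_(q in S) dweight d%:R q)); last first.
    by apply: (le_lt_trans Sl); rewrite lte_fin; lra.
  rewrite -(esum_pickle S); apply: le_esum => n _; rewrite /lo /hi.
  case: (pickle_inv n) => [q|]; last first.
    by rewrite subrr prodr_const card_ord expr0n eqn0Ngt d0.
  case: ifP => _; last by rewrite subrr prodr_const card_ord expr0n eqn0Ngt d0.
  rewrite (eq_bigr (fun=> 2 ^- q.1)); last by move=> i _; rewrite -mulrBl; lra.
  rewrite prodr_const card_ord /dweight lee_fin powRN -natrM powR_mulrn//.
  by rewrite exprVn -exprM mulnC.
Qed.

End DyadicNull.

(** * Powers of two and geometric tails *)

Section Powers.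
Context {R : realType}.
Implicit Types (a b t A : R).

Lemma nat_above (z : R) : exists m : nat, forall r, (m <= r)%N -> z < r%:R.
Proof.
exists (Num.truncn z).+1 => r h.
by apply: (lt_le_trans (truncnS_gt _)); rewrite ler_nat.
Qed.

Lemma pow2_gt0 a : 0 < 2 `^ a :> R. Proof. by rewrite powR_gt0. Qed.

Lemma pow2D a b : 2 `^ (a + b) = 2 `^ a * 2 `^ b :> R.
Proof. by rewrite powRD// pnatr_eq0 implybT. Qed.

Lemma pow2_le a b : a <= b -> 2 `^ a <= 2 `^ b :> R.
Proof. by move=> ab; rewrite ler_powR// ler1n. Qed.

Lemma pow2_nat n : 2 `^ n%:R = 2 ^+ n :> R.
Proof. by rewrite powR_mulrn. Qed.

Lemma pow2_unbounded t A : 0 < t -> exists m0, forall m, (m0 <= m)%N ->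
  A < 2 `^ (t * m%:R).
Proof.
move=> t0; have A0 : 0 < (`|A| + 1)^-1 by rewrite invr_gt0 ltr_wpDl.
have [m0 Hm0] := exists_powR_lt t0 A0; exists m0 => m /Hm0.
rewrite powRN ltf_pV2 ?posrE ?pow2_gt0// ?ltr_wpDl// => /(lt_trans _); apply.
by rewrite (le_lt_trans (ler_norm A))// ltrDl.
Qed.

Lemma pow2_dom a b A : a < b -> exists m0, forall m, (m0 <= m)%N ->
  A * 2 `^ (a * m%:R) < 2 `^ (b * m%:R).
Proof.
move=> ab; have ba : 0 < b - a by rewrite subr_gt0.
have [m0 Hm0] := pow2_unbounded A ba; exists m0 => m /Hm0 h.
have -> : b * m%:R = (b - a) * m%:R + a * m%:R by ring.
by rewrite pow2D ltr_pM2r ?pow2_gt0.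
Qed.

(** Serves twice: with a geometric [u] for tails of covers, and with [u j] proportional to
    [1 / (j + 1)] for the tails of the probe. *)
Lemma esum_telescope (u : nat -> R) j1 : (forall j, 0 <= u j) ->
  (forall j, u j.+1 <= u j) ->
  (\esum_(j in [set j | (j1 <= j)%N]) (u j - u j.+1)%:E <= (u j1)%:E)%E.
Proof.
move=> u0 ud; rewrite -(@nneseries_esum _ _ (fun j => j1 <= j)%N).
  2: by move=> n _; rewrite lee_fin subr_ge0.
apply: lime_le; first by apply: is_cvg_nneseries => n _ _; rewrite lee_fin subr_ge0.
apply: nearW => n; rewrite sumEFin lee_fin.
suff -> : \sum_(0 <= i < n | (j1 <= i)%N) (u i - u i.+1) =
    if (j1 <= n)%N then u j1 - u n else 0.
  by case: ifP => _ //; rewrite lerBlDr lerDl.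
elim: n => [|n IH]; first by rewrite big_geq//; case: j1 => [|?]//=; rewrite subrr.
rewrite big_mkcond big_nat_recr//= -big_mkcond IH.
case: ltngtP => [h|h|->].
- by rewrite leqW ?(ltnW h)// addrA subrK.
- rewrite addr0; case: ifP => // h'.
  have -> : j1 = n.+1 by lia.
  by rewrite subrr.
- by rewrite subrr add0r leqnSn.
Qed.

Lemma esum_geometric (B a : R) j1 : 0 <= B -> 0 <= a < 1 ->
  (\esum_(j in [set j | (j1 <= j)%N]) (B * a ^+ j)%:E
     <= (B / (1 - a) * a ^+ j1)%:E)%E.
Proof.
move=> B0 /andP[a0 a1]; pose u j := B / (1 - a) * a ^+ j.
have a1' : 0 < 1 - a by rewrite subr_gt0.
have u0 j : 0 <= u j by rewrite mulr_ge0 ?exprn_ge0// divr_ge0// ltW.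
have uE j : B * a ^+ j = u j - u j.+1.
  by rewrite /u exprS; field; rewrite gt_eqF.
under eq_esum do rewrite uE.
apply: (@esum_telescope u) => // j; rewrite -subr_ge0 -uE.
by rewrite mulr_ge0 ?exprn_ge0.
Qed.

End Powers.

(** * Sequence quasi-norms *)

Section Lq.
Context {R : realType}.
Implicit Types (q : \bar R) (I : choiceType).
Local Open Scope ereal_scope.

(* [level] and [bnorm] are both instances of this l^q quasi-norm. *)
Definition lq I q (f : I -> \bar R) : \bar R :=
  match q with
  | r%:E => poweR (\esum_(i in [set: I]) poweR (f i) r) r^-1
  | _ => ereal_sup [set f i | i in [set: I]]
  end.

Lemma poweR_le r (x y : \bar R) : (0 <= r)%R -> 0 <= x -> x <= y ->
  poweR x r <= poweR y r.
Proof.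
by move=> r0 x0 xy; apply: gt0_ler_poweR => //; rewrite in_itv/= leey andbT// (le_trans x0).
Qed.

Lemma poweRK r (x : \bar R) : (0 < r)%R -> 0 <= x -> poweR (poweR x r) r^-1 = x.
Proof.
by move=> r0 x0; rewrite -poweRrM mulfV ?gt_eqF// poweRe1.
Qed.

Lemma poweRVK r (x : \bar R) : (0 < r)%R -> 0 <= x -> poweR (poweR x r^-1) r = x.
Proof.
by move=> r0 x0; rewrite -poweRrM mulVf ?gt_eqF// poweRe1.
Qed.

Lemma lq_ge0 I q (f : I -> \bar R) (i : I) : (forall i, 0 <= f i) -> 0 <= lq q f.
Proof.
move=> f0; case: q => [r| |] /=; first exact: poweR_ge0.
- by apply: le_trans (f0 i) _; apply: ereal_sup_ubound; exists i.
- by apply: le_trans (f0 i) _; apply: ereal_sup_ubound; exists i.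
Qed.

Lemma lq_ge I q (f : I -> \bar R) i : 0 < q -> (forall i, 0 <= f i) ->
  f i <= lq q f.
Proof.
move=> q0 f0; case: q q0 => [r| |] //=; last first.
  by move=> _; apply: ereal_sup_ubound; exists i.
rewrite lte_fin => r0; rewrite -[leLHS](poweRK r0)//.
apply: poweR_le; rewrite ?invr_ge0 ?(ltW r0) ?poweR_ge0//.
rewrite -(@esum_set1 _ _ i (fun i => poweR (f i) r)) ?poweR_ge0//.
exact: esum_subset.
Qed.

Lemma lq_le I q (f g : I -> \bar R) : 0 < q -> (forall i, 0 <= f i) ->
  (forall i, f i <= g i) -> lq q f <= lq q g.
Proof.
move=> q0 f0 fg; case: q q0 => [r| |] //=; last first.
  move=> _; apply: ge_ereal_sup => _ [i _ <-]; apply: (le_trans (fg i)).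
  by apply: ereal_sup_ubound; exists i.
rewrite lte_fin => r0; apply: poweR_le; rewrite ?invr_ge0 ?(ltW r0)//.
  by apply: esum_ge0 => i _; exact: poweR_ge0.
by apply: le_esum => i _; apply: poweR_le => //; exact: ltW.
Qed.

(** Minkowski fails for exponents below 1, but [(x + y)^r <= 2^r (x^r + y^r)] holds for every
    [r > 0]. The constant [K] allows two successive uses, inside each scale and then across
    scales. *)
Lemma lq_quasi q (K : R) : 0 < q -> (0 <= K)%R -> exists2 K' : R, (0 <= K')%R &
  forall I (f g h : I -> \bar R), (forall i, 0 <= f i) -> (forall i, 0 <= g i) ->
  (forall i, 0 <= h i <= K%:E * (f i + g i)) -> 
  forall M : R, lq q f <= M%:E -> lq q g <= M%:E -> lq q h <= (K' * M)%:E.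
Proof.
case: q => [r| |] // q0 K0; last first.
  exists (K * 2)%R; first by rewrite mulr_ge0.
  move=> I f g h f0 g0 h0 M fM gM; apply: ge_ereal_sup => _ [i _ <-].
  have /andP[_ hi] := h0 i; apply: (le_trans hi).
  rewrite -mulrA EFinM; apply: lee_wpmul2l; rewrite ?lee_fin//.
  rewrite mulr_natl mulr2n EFinD; apply: leeD.
    by apply: le_trans fM; apply: ereal_sup_ubound; exists i.
  by apply: le_trans gM; apply: ereal_sup_ubound; exists i.
rewrite lte_fin in q0.
exists ((2 * ((2 * K) `^ r))%R `^ r^-1)%R; first by rewrite powR_ge0.
move=> I f g h f0 g0 h0 M fM gM.
have i0 : (0 <= r^-1)%R by rewrite invr_ge0 ltW.
have M0 : (0 <= M)%R by rewrite -lee_fin; apply: le_trans fM; exact: poweR_ge0.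
have bnd (u : I -> \bar R) : (forall i, 0 <= u i) -> lq r%:E u <= M%:E ->
    \esum_(i in [set: I]) poweR (u i) r <= (M `^ r)%:E.
  move=> u0 uM; have S0 : 0 <= \esum_(i in [set: I]) poweR (u i) r.
    by apply: esum_ge0 => *; exact: poweR_ge0.
  rewrite -[leLHS](poweRVK q0)// -poweR_EFin.
  by apply: poweR_le; rewrite ?poweR_ge0 ?(ltW q0).
have -> : ((2 * ((2 * K) `^ r)) `^ r^-1 * M)%:E =
    poweR (((2 * K) `^ r)%:E * ((M `^ r)%:E + (M `^ r)%:E)) r^-1.
  rewrite -EFinD -EFinM poweR_EFin; congr EFin.
  rewrite (_ : (_ * (_ + _))%R = (2 * (2 * K) `^ r) * M `^ r)%R; last by ring.
  rewrite [RHS]powRM ?mulr_ge0 ?powR_ge0// -(powRrM M) mulfV ?gt_eqF//.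
  by rewrite powRr1.
apply: poweR_le => //; first by apply: esum_ge0 => *; exact: poweR_ge0.
have c0 : (0 <= (2 * K) `^ r)%R by rewrite powR_ge0.
apply: (@le_trans _ _ (\esum_(i in [set: I])
   (((2 * K) `^ r)%:E * (poweR (f i) r + poweR (g i) r)))).
  apply: le_esum => i _; have /andP[hi0 hi] := h0 i.
  wlog gf : f g f0 g0 {h0 fM gM} hi / g i <= f i.
    move=> H; case/orP: (le_total (g i) (f i)) => ?; first exact: H.
    by rewrite addeC; apply: H => //; rewrite addeC.
  apply: (@le_trans _ _ (poweR ((2 * K)%:E * f i) r)).
    apply: poweR_le => //; first exact: ltW.
    apply: (le_trans hi); rewrite mulrC EFinM -muleA.
    apply: lee_wpmul2l; rewrite ?lee_fin//.
    by rewrite (_ : 2%:E * f i = f i + f i) ?leeD2l// mule_natl mule2n.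
  rewrite poweRM ?lee_fin ?mulr_ge0// poweR_EFin; apply: lee_wpmul2l => //.
  by rewrite leeDl// poweR_ge0.
apply: (le_trans (esumZl _ c0 _)); first by move=> i; rewrite adde_ge0 ?poweR_ge0.
apply: lee_wpmul2l; rewrite ?lee_fin//.
rewrite esumD; try by move=> *; exact: poweR_ge0.
by apply: leeD; exact: bnd.
Qed.

End Lq.

(** * Upper bounds valid for every sequence *)

Section Upper.
Context {R : realType} {d N : nat}.
Local Notation pt := (@pt R d).
Local Notation idx := (idx d).
Local Notation Seq := (@Seq R d N).
Implicit Types (s g t : R) (p q : \bar R) (C : Seq).

Lemma cabs_ge0 (z : R[i]) : 0 <= cabs z.
Proof. by case: z => a b; exact: sqrtr_ge0. Qed.

Lemma cabsM (z w : R[i]) : cabs (z * w) = cabs z * cabs w.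
Proof. exact: ComplexField.Normc.normcM. Qed.

Lemma cabsN (z : R[i]) : cabs (- z) = cabs z.
Proof. exact: normcN. Qed.

Lemma cabs_triangle (z w : R[i]) : cabs (z + w) <= cabs z + cabs w.
Proof. exact: le_normcD. Qed.

Lemma cabs_real (x : R) : cabs (x%:C)%C = `|x|.
Proof. by rewrite /cabs /= expr0n addr0 sqrtr_sqr. Qed.

Definition wcoef s p C (j : nat) (ik : 'I_N * idx) : \bar R :=
  (cabs (C ik.1 j ik.2) * 2 `^ ((s - d_over d p) * j%:R))%:E.

Lemma wcoef_ge0 s p C j ik : (0 <= wcoef s p C j ik)%E.
Proof. by rewrite lee_fin mulr_ge0 ?cabs_ge0 ?powR_ge0. Qed.

Lemma level_lq s p C j : level s p C j = lq p (wcoef s p C j).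
Proof. by case: p. Qed.

Lemma bnorm_lq s p q C : bnorm s p q C = lq q (level s p C).
Proof. by case: q. Qed.

Hypothesis N_ge1 : (1 <= N)%N.

Lemma level_ge0 s p C j : (0 <= level s p C j)%E.
Proof.
rewrite level_lq; apply: (@lq_ge0 _ _ _ _ (Ordinal N_ge1, 0 : idx)).
exact: wcoef_ge0.
Qed.

Lemma coef_le_level s p C i j k : (0 < p)%E ->
  (wcoef s p C j (i, k) <= level s p C j)%E.
Proof. by move=> p0; rewrite level_lq; apply: lq_ge => // ik; exact: wcoef_ge0. Qed.

Lemma level_le_bnorm s p q C j : (0 < q)%E ->
  (level s p C j <= bnorm s p q C)%E.
Proof. by move=> q0; rewrite bnorm_lq; apply: lq_ge => // i; exact: level_ge0. Qed.

Lemma bnorm_ge0 s p q C : (0 <= bnorm s p q C)%E.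
Proof. by rewrite bnorm_lq; apply: (@lq_ge0 _ _ _ _ 0%N) => j; exact: level_ge0. Qed.

Lemma bnorm_fin s p q C : inB s p q C ->
  exists2 M : R, 0 <= M & (bnorm s p q C <= M%:E)%E.
Proof.
rewrite /inB /=; have := bnorm_ge0 s p q C.
by case: (bnorm s p q C) => [M| |]// M0 _; exists M.
Qed.

Lemma level_fin s p q C j : (0 < q)%E -> inB s p q C ->
  exists2 m : R, 0 <= m & level s p C j = m%:E.
Proof.
move=> q0 /bnorm_fin[M M0 CM].
have := le_trans (level_le_bnorm s p C j q0) CM; have := level_ge0 s p C j.
by case: (level s p C j) => [m| |]// m0 _; exists m.
Qed.

Lemma inB_sub s p q C C' : (0 < p)%E -> (0 < q)%E ->
  inB s p q C -> inB s p q C' -> inB s p q (ssub C C').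
Proof.
move=> p0 q0 /bnorm_fin[M M0 CM] /bnorm_fin[M' M'0 C'M].
have [K K0 HK] := lq_quasi p0 (@ler01 R).
have lvl j : (level s p (ssub C C') j <= K%:E * (level s p C j + level s p C' j))%E.
  have [m m0 mE] := level_fin j q0 (le_lt_trans CM (ltry _)).
  have [m' m'0 m'E] := level_fin j q0 (le_lt_trans C'M (ltry _)).
  rewrite mE m'E -EFinD -EFinM level_lq.
  apply: (HK _ (wcoef s p C j) (wcoef s p C' j)).
  - by move=> ik; exact: wcoef_ge0.
  - by move=> ik; exact: wcoef_ge0.
  - move=> ik; rewrite wcoef_ge0 mul1e -EFinD lee_fin -mulrDl.
    rewrite ler_wpM2r ?powR_ge0// (le_trans (cabs_triangle _ _))//.
    by rewrite cabsN.
  - by rewrite -level_lq mE lee_fin lerDl.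
  - by rewrite -level_lq m'E lee_fin lerDr.
have [K2 K20 HK2] := lq_quasi q0 K0.
rewrite /inB /= bnorm_lq; apply: le_lt_trans (ltry (K2 * (M + M'))).
apply: (HK2 _ (level s p C) (level s p C')).
- by move=> j; exact: level_ge0.
- by move=> j; exact: level_ge0.
- by move=> j; rewrite level_ge0 lvl.
- by rewrite -bnorm_lq (le_trans CM)// lee_fin lerDl.
- by rewrite -bnorm_lq (le_trans C'M)// lee_fin lerDr.
Qed.

Lemma coef_bound s p q C : (0 < p)%E -> (0 < q)%E -> inB s p q C ->
  exists2 M : R, 0 < M & forall i j k,
    cabs (C i j k) <= M * 2 `^ ((d_over d p - s) * j%:R).
Proof.
move=> p0 q0 /bnorm_fin[M M0 CM]; exists (M + 1); first by rewrite ltr_wpDl.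
move=> i j k; have : (wcoef s p C j (i, k) <= M%:E)%E.
  by apply: le_trans CM; apply: (le_trans (coef_le_level _ _ _ _ _ p0)); exact: level_le_bnorm.
rewrite lee_fin /= -(opprB s) mulNr powRN -ler_pdivlMr ?pow2_gt0// => /le_trans; apply.
by rewrite ler_wpM2r ?invr_ge0 ?powR_ge0// lerDl.
Qed.

Lemma level_sum_bound s r q C : 0 < r -> (0 < q)%E -> inB s r%:E q C ->
  exists2 M : R, 0 <= M & forall j,
    (\esum_(ik in [set: 'I_N * idx]) poweR (wcoef s r%:E C j ik) r <= M%:E)%E.
Proof.
move=> r0 q0 /bnorm_fin[M M0 CM]; exists (M `^ r); first exact: powR_ge0.
move=> j; have S0 : (0 <= \esum_(ik in [set: 'I_N * idx]) poweR (wcoef s r%:E C j ik) r)%E.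
  by apply: esum_ge0 => *; exact: poweR_ge0.
rewrite -[leLHS](poweRVK r0)// -poweR_EFin.
apply: poweR_le; rewrite ?poweR_ge0 ?(ltW r0)//.
by apply: le_trans CM; exact: level_le_bnorm.
Qed.

Variable psi : 'I_N -> pt -> R[i].
Hypothesis psi_decay : fast_decay psi.

Lemma enorm_ge0 (x : pt) : 0 <= enorm x. Proof. exact: edist_ge0. Qed.

Lemma psi_bound n : exists2 c : R, 0 < c &
  forall i x, cabs (psi i x) <= c / (1 + enorm x) ^+ n.
Proof.
have [c Hc] := choice (fun i => psi_decay i n).
exists (1 + \sum_i `|c i|).
  by rewrite ltr_pwDl// sumr_ge0.
move=> i x; apply: (le_trans (Hc i x)); rewrite ler_wpM2r//.
  by rewrite invr_ge0 exprn_ge0// addr_ge0// enorm_ge0.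
rewrite (bigD1 i)//= addrCA; apply: (le_trans (ler_norm _)).
by rewrite lerDl addr_ge0// sumr_ge0.
Qed.

Lemma divexp_gt C x g : (g%:E < divexp psi C x)%E ->
  exists2 g', g < g' & exists2 c : R, 0 < c & forall j0 : nat,
   exists i j k, (j0 <= j)%N /\
     c * 2 `^ (g' * j%:R) <= cabs (C i j k * wav psi i j k x).
Proof.
move=> /ereal_sup_gt [_ [g' [c c0 [i [j [k [jj H]]]]] <-]]; rewrite lte_fin => gg'.
exists g' => //; exists c => // j0; have [n0 Hn0] := jj j0.
by exists (i n0), (j n0), (k n0); split; [exact: Hn0|exact: H].
Qed.

Lemma divexp_ge_of C x g (c : R) : 0 < c ->
  (forall j0 : nat, exists i j k, (j0 <= j)%N /\
     c * 2 `^ (g * j%:R) <= cabs (C i j k * wav psi i j k x)) ->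
  (g%:E <= divexp psi C x)%E.
Proof.
move=> c0 H; apply: ereal_sup_ubound; exists g => //; exists c => //.
have h n : exists u : 'I_N * nat * idx, (n <= u.1.2)%N /\
    c * 2 `^ (g * u.1.2%:R) <= cabs (C u.1.1 u.1.2 u.2 * wav psi u.1.1 u.1.2 u.2 x).
  by have [i [j [k ijk]]] := H n; exists (i, j, k).
have [u Hu] := choice h.
exists (fun n => (u n).1.1), (fun n => (u n).1.2), (fun n => (u n).2); split.
  by move=> M; exists M => n Mn; have [nu _] := Hu n; exact: leq_trans nu.
by move=> n; have [] := Hu n.
Qed.

Lemma divexp_le s p q C x : (0 < p)%E -> (0 < q)%E -> inB s p q C ->
  (divexp psi C x <= (d_over d p - s)%:E)%E.
Proof.
move=> p0 q0 CB; rewrite leNgt; apply/negP => /divexp_gt[g' gg' [c c0 H]].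
have [M M0 CM] := coef_bound p0 q0 CB; have [A A0 psiA] := psi_bound 0.
have [j0 Hj0] := pow2_dom (M * A / c) gg'.
have [i [j [k [jj0]]]] := H j0; have {Hj0} := Hj0 _ jj0.
set e := 2 `^ _; set f := 2 `^ (g' * _) => h1; rewrite cabsM.
have h2 : cabs (C i j k) <= M * e by exact: CM.
have h3 : cabs (wav psi i j k x) <= A.
  by have := psiA i (fun m => 2 ^+ j * x m - (k m)%:~R); rewrite expr0 divr1.
apply/negP; rewrite -ltNge; apply: (@le_lt_trans _ _ (M * e * A)).
  by rewrite ler_pM ?cabs_ge0.
rewrite -(ltr_pM2l c0) in h1; apply: le_lt_trans h1.
by rewrite le_eqVlt; apply/orP; left; apply/eqP; field; rewrite gt_eqF.
Qed.

End Upper.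

Lemma leq_add3P (a b c n : nat) : (a + b + c <= n)%N ->
  [/\ (a <= n)%N, (b <= n)%N & (c <= n)%N].
Proof. by move=> h; split; lia. Qed.

Section UpperNull.
Context {R : realType} {d N : nat}.
Local Notation pt := (@pt R d).
Local Notation idx := (idx d).
Local Notation Seq := (@Seq R d N).
Hypothesis N_ge1 : (1 <= N)%N.
Variable psi : 'I_N -> pt -> R[i].
Hypothesis psi_decay : fast_decay psi.
Variables (s r : R) (q : \bar R) (C : Seq).
Hypotheses (r0 : 0 < r) (q0 : (0 < q)%E) (CB : inB s r%:E q C).

(** Boundedness of [psi] makes the coefficient itself large. Fast decay keeps [k] near [2 ^ j x]:
    coefficients grow at most exponentially in [j], and at distance [2 ^ (e j)] a decay of order [n]
    gains [2 ^ (- e n j)]. *)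
Lemma large_coef_near (e g : R) (x : pt) : 0 < e ->
  (g%:E < divexp psi C x)%E -> forall j1 : nat, exists i j k, (j1 <= j)%N /\
   2 `^ (g * j%:R) <= cabs (C i j k) /\
   forall m, `|2 ^+ j * x m - (k m)%:~R| <= 2 `^ (e * j%:R).
Proof.
move=> e0 /divexp_gt[g' gg' [c c0 H]] j1.
have p0 : (0 < r%:E)%E by rewrite lte_fin.
have [M M0 CM] := coef_bound N_ge1 p0 q0 CB; have [A A0 psiA] := psi_bound psi_decay 0.
pose D := d_over d r%:E - s.
(* A decay order for which the largest possible coefficient, damped at distance [2 ^ (e j)], has
   growth exponent below [g]. *)
pose n := (Num.truncn ((D - g) / e)).+1.
have nD : D - e * n%:R < g'.
  have : (D - g) / e < n%:R by exact: truncnS_gt.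
  by rewrite ltr_pdivrMr//; lra.
have [B B0 psiB] := psi_bound psi_decay n.
have [ja Hja] := pow2_dom (A / c) gg'.
have [jb Hjb] := pow2_dom (M * B / c) nD.
have [i [j [k [jj0 Hj]]]] := H (j1 + ja + jb)%N.
have [j1j jaj jbj] := leq_add3P jj0; exists i, j, k; split=> //.
have {}Hja : A * 2 `^ (g * j%:R) < c * 2 `^ (g' * j%:R).
  have := Hja j jaj; rewrite -(ltr_pM2l c0); apply: le_lt_trans.
  by rewrite mulrA mulrCA divff ?mulr1// gt_eqF.
have {}Hjb : M * B * 2 `^ ((D - e * n%:R) * j%:R) < c * 2 `^ (g' * j%:R).
  have := Hjb j jbj; rewrite -(ltr_pM2l c0); apply: le_lt_trans.
  by rewrite mulrA mulrCA divff ?mulr1// gt_eqF.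
rewrite cabsM in Hj; split.
  have h := psiA i (fun m => 2 ^+ j * x m - (k m)%:~R); rewrite expr0 divr1 in h.
  rewrite -(ler_pM2l A0) mulrC; apply: ltW; rewrite mulrC; apply: (lt_le_trans Hja).
  by apply: (le_trans Hj); rewrite mulrC ler_wpM2r ?cabs_ge0.
move=> m; rewrite leNgt; apply/negP => far.
have := Hj; apply/negP; rewrite -ltNge; apply: le_lt_trans Hjb.
rewrite mulrBl -addrC pow2D.
set z := (fun m => 2 ^+ j * x m - (k m)%:~R).
have zfar : 2 `^ (e * j%:R) <= 1 + enorm z.
  apply: (le_trans (ltW far)); apply: (@le_trans _ _ (enorm z)); last by rewrite lerDr.
  by have := edist_coord z (fun=> 0) m; rewrite subr0.
have E0 : 0 < 2 `^ (e * j%:R) :> R by rewrite pow2_gt0.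
have h : cabs (psi i z) <= B * 2 `^ (- (e * n%:R * j%:R)).
  apply: (le_trans (psiB i z)); rewrite ler_wpM2l ?(ltW B0)// powRN.
  rewrite lef_pV2 ?posrE ?pow2_gt0//; last first.
    by rewrite exprn_gt0// (lt_le_trans E0).
  rewrite (_ : e * n%:R * j%:R = (e * j%:R) * n%:R); last by ring.
  rewrite powRrM powR_mulrn ?powR_ge0// lerXn2r// nnegrE ?powR_ge0//.
  by rewrite (le_trans _ zfar)// ltW.
rewrite [2 `^ (- _) * _]mulrC mulrACA.
by apply: ler_pM; rewrite ?cabs_ge0//; exact: CM.
Qed.

(** Chebyshev: bounded [l^r] sums leave about [2 ^ (D j)] coefficients of size [2 ^ (g j)], each
    responsible for about [2 ^ (e d j)] cubes of scale [j]. As [D + e d < t], the total weight is a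
    geometric tail. *)
Lemma dnull_divexp_gt (g t : R) : d%:R - s * r - g * r < t ->
  dnull t [set x | (g%:E < divexp psi C x)%E].
Proof.
move=> tD eta eta0; pose D := d%:R - s * r - g * r.
have tD0 : 0 < t - D by rewrite subr_gt0.
pose h := (t - D) / 2; have h0 : 0 < h by rewrite divr_gt0.
have [e e0 ed] : exists2 e, 0 < e & e * d%:R - t + D <= - h.
  exists ((t - D) / (2 * d.+1%:R)); first by rewrite divr_gt0// mulr_gt0.
  have -> : - h = (t - D) / (2 * d.+1%:R) * d.+1%:R - t + D.
    have : d.+1%:R != 0 :> R by rewrite pnatr_eq0.
    by rewrite /h; move: d.+1%:R => x x0; field.
  rewrite lerD2r lerD2r ler_wpM2l ?ler_nat//.
  by rewrite ltW// divr_gt0// mulr_gt0.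
have [M M0 CM] := level_sum_bound N_ge1 r0 q0 CB.
(* [7] comes from [2 W + 1 <= 2 E + 5 <= 7 E], where [E = 2 ^ (e j) >= 1]. *)
pose B := 7 ^+ d * M; have B0 : 0 <= B by rewrite mulr_ge0.
pose a : R := 2 `^ (- h).
have a0 : 0 <= a by rewrite powR_ge0.
have a1 : a < 1.
  rewrite /a powRN invf_lt1 ?pow2_gt0//.
  have := gt0_ltr_powR h0; move=> /(_ 1 2); rewrite !nnegrE powR1; apply => //.
  by rewrite ltr1n.
have [j1 Hj1] : exists j1, B / (1 - a) * a ^+ j1 <= eta.
  have K0 : 0 <= B / (1 - a) by rewrite divr_ge0// subr_ge0 ltW.
  have K1 : 0 < eta / (B / (1 - a) + 1) by rewrite divr_gt0// ltr_wpDl.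
  have [j1 Hj1] := exists_powR_lt h0 K1; exists j1.
  have := ltW (Hj1 j1 (leqnn _)).
  rewrite (_ : - (h * _) = - h * j1%:R); last by rewrite mulNr.
  rewrite powRrM powR_mulrn// ler_pdivlMr ?ltr_wpDl// mulrC; apply: le_trans.
  by rewrite ler_wpM2r ?exprn_ge0// lerDl.
(* One unit makes [W j] exceed the real bound, the other pays for rounding [2 ^ j x] down. *)
pose W j := (Num.truncn (2 `^ (e * j%:R) : R)).+2.
pose bad j : set ('I_N * idx) := [set ik | 2 `^ (g * j%:R) <= cabs (C ik.1 j ik.2)].
pose nb j (ik : 'I_N * idx) (u : {ffun 'I_d -> 'I_(W j).*2.+1}) : nat * idx :=
  (j, [ffun m => ik.2 m + (u m)%:Z - (W j)%:Z]).
exists (\bigcup_(j in [set j | (j1 <= j)%N]) \bigcup_(ik in bad j) (nb j ik @` setT)).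
  move=> x /(large_coef_near e0) /(_ j1) [i [j [k [jj1 [Ck near]]]]].
  exists (j, flr j x) => //; exists j => //; exists (i, k) => //.
  have near' m : `|flr j x m - k m| <= (W j)%:Z.
    have /andP[f1 f2] := flr_itv j x m.
    have := near m; rewrite ler_norml => /andP[n1 n2].
    have W1 : 2 `^ (e * j%:R) + 1 < (W j)%:~R :> R.
      by rewrite -[ltRHS]/((W j)%:R : R) /W -[ltRHS]natr1 ltrD2r truncnS_gt.
    have l1 : (flr j x m - k m)%:~R < (W j)%:~R :> R by rewrite intrB; lra.
    have l2 : (- (W j)%:Z)%:~R < (flr j x m - k m)%:~R :> R.
      by rewrite intrN intrB; lra.
    rewrite !ltr_int in l1 l2; rewrite ler_norml; clear -l1 l2; apply/andP; split; lia.
  pose u : {ffun 'I_d -> 'I_(W j).*2.+1} :=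
    [ffun m => inord `|(flr j x m - k m + (W j)%:Z)%R|%N].
  have uE m : u m = `|(flr j x m - k m + (W j)%:Z)%R|%N :> nat.
    by have := near' m; rewrite [u m]ffunE => nr; rewrite inordK//; clear -nr; lia.
  exists u => //; congr pair; apply/ffunP => m; rewrite [LHS]ffunE uE /=.
  move: (near' m); move: (flr j x m) => v nr; clear -nr.
  rewrite gez0_abs; lia.
apply: (le_trans (esum_bigcup_le _ _ (dweight_ge0 t))).
apply: le_trans (_ : (B / (1 - a) * a ^+ j1)%:E <= _)%E; last by rewrite lee_fin.
apply: le_trans (esum_geometric _ B0 _); last by rewrite a0 a1.
apply: le_esum => j _.
apply: (le_trans (esum_bigcup_le _ _ (dweight_ge0 t))).
pose c := 7 ^+ d * 2 `^ ((e * d%:R - t + D) * j%:R).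
have c0 : 0 <= c by rewrite mulr_ge0// powR_ge0.
apply: (@le_trans _ _ (\esum_(ik in bad j) (c%:E * poweR (wcoef s r%:E C j ik) r))%E).
  apply: le_esum => ik Bik.
  apply: (le_trans (esum_image_le _ _ (dweight_ge0 t))).
  rewrite esum_finType; last by move=> u; exact: dweight_ge0.
  rewrite /dweight /= sumEFin sumr_const card_ffun !card_ord -EFinM lee_fin.
  rewrite -[leLHS]mulr_natl natrX.
  have E1 : 1 <= 2 `^ (e * j%:R) :> R.
    by rewrite -[leLHS](powRr0 2); apply: pow2_le; rewrite mulr_ge0// ltW.
  have W7 : (W j).*2.+1%:R <= 7 * 2 `^ (e * j%:R) :> R.
    have W2 : (W j)%:R <= 2 `^ (e * j%:R) + 2 :> R.
      by rewrite /W -addn2 natrD lerD2r truncn_le powR_ge0.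
    by rewrite -addn1 -muln2 natrD natrM; lra.
  apply: (@le_trans _ _ ((7 * 2 `^ (e * j%:R)) ^+ d * 2 `^ (- (t * j%:R)))).
    by rewrite ler_wpM2r ?powR_ge0// lerXn2r// nnegrE// mulr_ge0// powR_ge0.
  (* Chebyshev's step: after normalisation each coefficient of [bad j] contributes at least 1, so
     counting becomes summing. *)
  have Bk : 1 <= 2 `^ (D * j%:R) *
      ((cabs (C ik.1 j ik.2) * 2 `^ ((s - d_over d r%:E) * j%:R)) `^ r).
    have e1 : 2 `^ (D * j%:R) * ((2 `^ (g * j%:R) *
           2 `^ ((s - d_over d r%:E) * j%:R)) `^ r) = 1 :> R.
      rewrite -pow2D -powRrM -pow2D -[RHS](powRr0 2); congr (_ `^ _).
      by rewrite /D /d_over; field; rewrite gt_eqF.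
    rewrite -[leLHS]e1 ler_wpM2l ?powR_ge0//; apply: ge0_ler_powR; rewrite ?(ltW r0)//.
    - by rewrite nnegrE mulr_ge0 ?powR_ge0.
    - by rewrite nnegrE mulr_ge0 ?powR_ge0 ?cabs_ge0.
    - by rewrite ler_wpM2r ?powR_ge0.
  rewrite exprMn /c -!mulrA ler_wpM2l ?exprn_ge0//.
  have e2 : (2 `^ (e * j%:R)) ^+ d * 2 `^ (- (t * j%:R)) =
      2 `^ ((e * d%:R - t) * j%:R) :> R.
    by rewrite -powR_mulrn ?powR_ge0// -powRrM -pow2D; congr (_ `^ _); ring.
  rewrite e2 -[leLHS]mulr1.
  rewrite (mulrDl (e * d%:R - t)) pow2D -[leRHS]mulrA.
  by apply: ler_wpM2l; rewrite ?powR_ge0.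
apply: (le_trans (esumZl _ c0 _)); first by move=> ik; exact: poweR_ge0.
apply: (@le_trans _ _ (c%:E * M%:E)%E).
  apply: lee_wpmul2l; rewrite ?lee_fin//; apply: le_trans (CM j).
  exact: esum_subset.
rewrite -EFinM lee_fin /c /B mulrAC ler_wpM2l ?mulr_ge0//.
rewrite /a -powR_mulrn ?powR_ge0// -powRrM.
by apply: pow2_le; rewrite ler_wpM2r.
Qed.

End UpperNull.

(** * Measurability of countable combinations of events *)

Section MeasurableLogic.
Context {dd : measure_display} {T : measurableType dd}.

Lemma measurable_exists (I : countType) (P : I -> T -> Prop) :
  (forall i, measurable [set w | P i w]) -> measurable [set w | exists i, P i w].
Proof.
move=> mP; rewrite (_ : [set w | _] =
   \bigcup_n (if (pickle_inv n : option I) is Some i then [set w | P i w] else set0)).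
  apply: bigcupT_measurable => n; case: (pickle_inv n) => [i|]//.
apply/seteqP; split=> [w [i Pi]|w [n _]].
  by exists (pickle i) => //; rewrite pickleK_inv.
by case: (pickle_inv n) => [i|]// Pi; exists i.
Qed.

Lemma measurable_forall (I : countType) (P : I -> T -> Prop) :
  (forall i, measurable [set w | P i w]) -> measurable [set w | forall i, P i w].
Proof.
move=> mP; rewrite (_ : [set w | _] = ~` [set w | exists i, ~ P i w]).
  apply: measurableC; apply: measurable_exists => i.
  by rewrite (_ : [set w | _] = ~` [set w | P i w])//; exact: measurableC.
apply/seteqP; split=> [w h [i ni]|w h i]; first exact: ni (h i).
by apply: contrapT => n; apply: h; exists i.
Qed.

Lemma measurable_imp (Q : Prop) (P : T -> Prop) :
  measurable [set w | P w] -> measurable [set w | Q -> P w].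
Proof.
move=> mP; have [q|nq] := pselect Q.
  by rewrite (_ : [set w | _] = [set w | P w])//; apply/seteqP; split=> w /= h; [exact: h|].
by rewrite (_ : [set w | _] = setT)//; apply/seteqP; split=> w //= _ /nq.
Qed.

Lemma measurable_and (Q : Prop) (P : T -> Prop) :
  measurable [set w | P w] -> measurable [set w | Q /\ P w].
Proof.
move=> mP; have [q|nq] := pselect Q.
  by rewrite (_ : [set w | _] = [set w | P w])//; apply/seteqP; split=> w /= h; [case: h|].
by rewrite (_ : [set w | _] = set0)//; apply/seteqP; split=> w //= -[/nq].
Qed.

Lemma measurable_not (P : T -> Prop) :
  measurable [set w | P w] -> measurable [set w | ~ P w].
Proof. by move=> mP; exact: measurableC. Qed.

Variable b : nat -> T -> bool.
Hypothesis mb : forall n, measurable [set w | b n w].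

Lemma measurable_bits (a : nat -> bool) (Q : nat -> Prop) :
  measurable [set w | forall n, Q n -> b n w = a n].
Proof.
apply: measurable_forall => n; apply: measurable_imp; case: (a n).
  by rewrite (_ : [set w | _] = [set w | b n w])//; apply/seteqP; split.
rewrite (_ : [set w | _] = ~` [set w | b n w]).
  exact: measurableC.
by apply/seteqP; split=> w /=; [move=> ->|move/negP/negbTE].
Qed.

(** [Q] is open in the Cantor space, hence a countable union of cylinders, one for each finite word
    [a] that forces it. *)
Lemma measurable_local (Q : (nat -> bool) -> Prop) :
  (forall c, Q c -> exists M, forall c', (forall n, (n < M)%N -> c' n = c n) -> Q c') ->
  measurable [set w | Q (b ^~ w)].
Proof.
move=> Qloc; rewrite (_ : [set w | _] = [set w | exists a : seq bool,
    (forall c, (forall n, (n < size a)%N -> c n = nth false a n) -> Q c) /\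
    forall n, (n < size a)%N -> b n w = nth false a n]).
  apply: measurable_exists => a; apply: measurable_and.
  exact: (measurable_bits (nth false a) (fun n => n < size a)%N).
apply/seteqP; split=> [w /= Qw|w [a [Ha aw]]]; last exact: Ha.
have [M HM] := Qloc _ Qw; exists (mkseq (b ^~ w) M); rewrite size_mkseq; split.
  by move=> c Hc; apply: HM => n nM; rewrite Hc// nth_mkseq.
by move=> n nM; rewrite nth_mkseq.
Qed.

End MeasurableLogic.

(** * Coin tossing *)

Section UnitInterval.
Context {R : realType}.

Definition unit_lebesgue : set (measurableTypeR R) -> \bar R :=
  mrestr lebesgue_measure (measurable_itv `[0%R, 1%R[).

HB.instance Definition _ := Measure.on unit_lebesgue.

Lemma unit_lebesgueT : unit_lebesgue [set: _] = 1%E.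
Proof.
by rewrite /unit_lebesgue /mrestr setTI lebesgue_measure_itv/= lte01 oppr0 adde0.
Qed.

HB.instance Definition _ :=
  @Measure_isProbability.Build _ _ R unit_lebesgue unit_lebesgueT.

Definition bit (n : nat) (w : R) : bool := odd (Num.truncn (2 ^+ n.+1 * w)).

Lemma truncn_eqP (y : R) (v : nat) : 0 <= y ->
  Num.truncn y = v <-> v%:R <= y < v.+1%:R.
Proof.
move=> y0; split=> [<-|h]; last by apply: truncn_def.
by rewrite truncn_le y0 truncnS_gt.
Qed.

Lemma measurable_bit n : measurable [set w : measurableTypeR R | bit n w].
Proof.
pose e : R := 2 ^+ n.+1; have e0 : 0 < e by rewrite exprn_gt0.
rewrite (_ : [set w | _] =
    \bigcup_(v in [set v | odd v]) [set` `[v%:R / e, v.+1%:R / e[]); last first.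
  apply/seteqP; split=> [w|w [v /= ov]]; rewrite /bit -/e /=.
    move=> ow; exists (Num.truncn (e * w)) => //=.
    have w0 : 0 <= e * w by move: ow; rewrite truncn_floor; case: ifP.
    have := (truncn_eqP _ w0).1 erefl.
    by rewrite in_itv/= ler_pdivrMr// ltr_pdivlMr// [w * e]mulrC.
  rewrite in_itv/= ler_pdivrMr// ltr_pdivlMr// [w * e]mulrC => h.
  have w0 : 0 <= e * w by have /andP[h1 _] := h; apply: le_trans h1.
  by have /(truncn_eqP _ w0) -> := h.
by apply: bigcup_measurable => v _; exact: measurable_itv.
Qed.

(** Doubling the scale appends one bit to [Num.truncn], so the first [n] bits determine the dyadic
    interval. *)
Lemma bits_prefix n (w w' : R) : 0 <= w < 1 -> 0 <= w' < 1 ->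
  (forall i, (i < n)%N -> bit i w = bit i w') ->
  Num.truncn (2 ^+ n * w) = Num.truncn (2 ^+ n * w').
Proof.
move=> w01 w'01; have half (v : R) k : 0 <= v ->
    Num.truncn (2 ^+ k * v) = (Num.truncn (2 ^+ k.+1 * v))./2.
  move=> v0; have k0 i : 0 <= 2 ^+ i * v by rewrite mulr_ge0 ?exprn_ge0.
  apply/(truncn_eqP _ (k0 k)); have /(truncn_eqP _ (k0 k.+1)) := erefl (Num.truncn (2 ^+ k.+1 * v)).
  move: (Num.truncn _) => m; rewrite -{1 2}(odd_double_half m) exprS -[2 * _ * v]mulrA.
  move: (2 ^+ k * v) => y /andP[h1 h2]; apply/andP; split.
    have : (m./2).*2%:R <= 2 * y by apply: le_trans h1; rewrite ler_nat leq_addl.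
    by rewrite -mul2n natrM ler_pM2l.
  have : 2 * y < (m./2.+1).*2%:R.
    by apply: (lt_le_trans h2); rewrite ler_nat doubleS; case: (odd m); lia.
  by rewrite -mul2n natrM ltr_pM2l.
elim: n => [_|n IH H].
  rewrite expr0 !mul1r; transitivity 0%N; last apply/esym.
    exact: (@truncn_def _ w 0 w01).
  exact: (@truncn_def _ w' 0 w'01).
rewrite -[LHS]odd_double_half -[RHS]odd_double_half.
have [/andP[w0 _] /andP[w'0 _]] := (w01, w'01).
rewrite -!half// (IH (fun i h => H i (leqW h))).
by have := H n (ltnSn n); rewrite /bit => ->.
Qed.

Lemma cylinder_measure n (a : nat -> bool) :
  (unit_lebesgue [set w | forall i, (i < n)%N -> bit i w = a i] <= (2 ^- n)%:E)%E.
Proof.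
set E := [set w | _]; pose e : R := 2 ^+ n; have e0 : 0 < e by rewrite exprn_gt0.
have mE : measurable (E : set (measurableTypeR R)).
  exact: (measurable_bits measurable_bit a (fun i => i < n)%N).
rewrite /unit_lebesgue /mrestr.
have [[w1 [E1 u1]]|none] := pselect (exists w, (E `&` [set` `[0%R, 1%R[]) w); last first.
  rewrite (_ : E `&` _ = set0) ?measure0 ?lee_fin ?invr_ge0 ?exprn_ge0//.
  by apply/seteqP; split=> // w Ew; apply: none; exists w.
pose v := Num.truncn (e * w1).
apply: (@le_trans _ _ (lebesgue_measure [set` `[v%:R / e, v.+1%:R / e[])).
  apply: le_measure; rewrite ?inE//; first by apply: measurableI => //; exact: measurable_itv.
  move=> w [Ew uw] /=; move: u1 uw; rewrite /= !in_itv/= => u1 uw.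
  have h : Num.truncn (e * w) = v.
    by apply: bits_prefix => // i ni; rewrite Ew// E1.
  have w0 : 0 <= e * w by rewrite mulr_ge0 ?(ltW e0)//; case/andP: uw.
  have /(truncn_eqP _ w0) := h.
  by rewrite ler_pdivrMr// ltr_pdivlMr// [w * e]mulrC.
rewrite lebesgue_measure_itv/= lte_fin ltr_pM2r ?invr_gt0// ltr_nat ltnSn.
by rewrite -EFinD -mulrBl -natrB// subSnn mul1r.
Qed.

End UnitInterval.

Lemma measure_cover_le {R : realType} {dd} {T : measurableType dd}
    (P : {measure set T -> \bar R}) (I : countType) (S : set I)
    (E : I -> set T) (A : set T) :
  measurable A -> (forall i, measurable (E i)) -> A `<=` \bigcup_(i in S) E i ->
  (P A <= \esum_(i in S) P (E i))%E.
Proof.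
move=> mA mE AE; pose F n := if (pickle_inv n : option I) is Some i then
   if i \in S then E i else set0 else set0.
have mF n : measurable (F n).
  by rewrite /F; case: (pickle_inv n) => [i|]//; case: ifP.
apply: (@le_trans _ _ (\sum_(n <oo) P (F n))%E).
  apply: measure_sigma_subadditive => // x /AE [i Si Ex].
  by exists (pickle i) => //; rewrite /F pickleK_inv mem_set.
rewrite nneseries_esumT// -(esum_pickle S); apply: le_esum => n _.
by rewrite /F; case: (pickle_inv n) => [i|]; [case: ifP => // _|]; rewrite measure0.
Qed.

(** The coins are the binary digits under Lebesgue measure on [[0, 1)]. [S] is arbitrary because the
    events of interest read scattered bits; the bound sums over the [2 ^ (n - size S)] words of
    length [n] compatible with [a]. *)
Lemma fair_bits (R : realType) : exists dd (T : measurableType dd)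
    (P : probability T R) (b : nat -> T -> bool),
  (forall n, measurable [set w | b n w]) /\
  forall (S : seq nat) (a : nat -> bool), uniq S ->
    (P [set w | forall i, i \in S -> b i w = a i] <= (2 ^- size S)%:E)%E.
Proof.
exists _, (measurableTypeR R), (unit_lebesgue : probability _ R), bit.
split=> [n|S a uS]; first exact: measurable_bit.
pose n := (\max_(i <- S) i).+1.
have Sn i : i \in S -> (i < n)%N by move=> iS; rewrite ltnS leq_bigmax_seq.
pose F := [set f : {ffun 'I_n -> bool} | forall i : 'I_n, (i : nat) \in S -> f i = a i].
pose ext (f : {ffun 'I_n -> bool}) (i : nat) := if insub i is Some j then f j else false.
apply: (@le_trans _ _ (\esum_(f in F) unit_lebesgue
    [set w | forall i, (i < n)%N -> bit i w = ext f i])%E).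
  apply: measure_cover_le.
  - exact: (measurable_bits measurable_bit a (fun i => i \in S)).
  - by move=> f; exact: (measurable_bits measurable_bit (ext f) (fun i => i < n)%N).
  - move=> w Ew; exists [ffun i : 'I_n => bit i w].
      by move=> i iS; rewrite ffunE Ew.
    by move=> i ni; rewrite /ext insubT ffunE.
apply: (@le_trans _ _ (\esum_(f in F) (2 ^- n : R)%:E)%E).
  by apply: le_esum => f _; exact: cylinder_measure.
rewrite esum_mkcond esum_finType; last first.
  by move=> f; case: ifP => // _; rewrite lee_fin invr_ge0 exprn_ge0.
rewrite -big_mkcond/= sumEFin lee_fin sumr_const.
have -> : #|[pred f | f \in F]| = (2 ^ (n - size S))%N.
  pose Fa (i : 'I_n) : pred bool := if (i : nat) \in S then pred1 (a i) else predT.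
  rewrite (_ : #|_| = #|family Fa|); last first.
    apply: eq_card => f; rewrite !inE; apply/idP/familyP.
      move=> h i; rewrite /Fa; case: ifP => // iS; rewrite inE.
      by apply/eqP; move: h; rewrite in_setE; apply.
    move=> h; rewrite in_setE => i iS; have := h i; rewrite /Fa iS inE.
    by move/eqP.
  rewrite card_family foldrE big_map big_enum/=.
  rewrite (eq_bigr (fun i : 'I_n => if (i : nat) \in S then 1 else 2)%N); last first.
    move=> i _; rewrite /Fa; case: ifP => _; first exact: card1.
    by rewrite card_bool.
  rewrite -(big_mkord xpredT (fun i => if i \in S then 1 else 2)%N).
  rewrite (bigID (mem S))/= big1; last by move=> i ->.
  rewrite mul1n (eq_bigr (fun=> 2%N)); last by move=> i /negbTE ->.
  rewrite big_const_seq iter_muln_1; congr (2 ^ _)%N.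
  have <- : count (mem S) (index_iota 0 n) = size S.
    rewrite -size_filter; apply/eqP; rewrite -(uniq_size_uniq uS) ?filter_uniq ?iota_uniq//.
    by move=> i; rewrite mem_filter mem_index_iota /=; case: (boolP (i \in S)) => //= /Sn ->.
  have := count_predC (mem S) (index_iota 0 n).
  rewrite size_iota subn0 => h.
  transitivity (count (predC (mem S)) (index_iota 0 n)); last by lia.
  exact: eq_count.
have Sle : (size S <= n)%N.
  rewrite -[leqRHS](size_iota 0); apply: uniq_leq_size => // i /Sn.
  by rewrite mem_iota.
rewrite -[leLHS]mulr_natl natrX -{2}(subnK Sle) exprD invfM mulrA divff ?mul1r//.
Qed.

(** * Cantor sets of prescribed binary digits *)

Fixpoint binz (k : int) (dig : nat -> bool) (n : nat) : int :=
  if n is m.+1 then binz k dig m * 2 + (dig m : nat)%:Z else k.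

Lemma binz_inj k dig dig' n : binz k dig n = binz k dig' n ->
  forall i, (i < n)%N -> dig i = dig' i.
Proof.
elim: n => [//|n IH] /= H i.
have H1 : binz k dig n = binz k dig' n.
  by move: H; case: (dig n); case: (dig' n) => /=; lia.
rewrite ltnS leq_eqVlt => /orP[/eqP->|]; last exact: IH.
by move: H; rewrite H1; case: (dig n); case: (dig' n) => //=; lia.
Qed.

Lemma binz_zero k dig n m : (n <= m)%N ->
  (forall e, (n <= e < m)%N -> dig e = false) ->
  binz k dig m = binz k dig n * 2 ^+ (m - n).
Proof.
move=> nm; rewrite -{1 2}(subnK nm); elim: (m - n)%N => [|i IH] H.
  by rewrite add0n expr0 mulr1.
rewrite addSn /= H ?leq_addl//= addr0 IH; first by rewrite exprSr mulrA.
by move=> e he; apply: H; lia.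
Qed.

(* Infinitely many zero digits are what makes the floor of the scaled limit
   agree with the truncated expansion. *)
Lemma binary_expansion (R : realType) (k : int) (dig : nat -> bool) :
  (forall n0, exists2 n, (n0 <= n)%N & dig n = false) ->
  exists y : R, forall n, Num.floor (2 ^+ n * y) = binz k dig n.
Proof.
move=> zeros; pose z n : R := (binz k dig n)%:~R.
have zS n : z n.+1 = z n * 2 + (dig n)%:R.
  by rewrite /z /= intrD intrM.
have P n : 0 < 2 ^+ n :> R by rewrite exprn_gt0.
have zlo n i : z n * 2 ^+ i <= z (n + i)%N.
  elim: i => [|i IH]; first by rewrite addn0 expr0 mulr1.
  rewrite addnS zS exprSr mulrA; have : 0 <= (dig (n + i)%N)%:R :> R by [].
  lra.
have zhi n i : z (n + i)%N + 1 <= (z n + 1) * 2 ^+ i.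
  elim: i => [|i IH]; first by rewrite addn0 expr0 mulr1.
  rewrite addnS zS exprSr mulrA.
  have : (dig (n + i)%N)%:R <= 1 :> R by case: (dig _).
  lra.
pose U := range (fun n => z n / 2 ^+ n).
have ub n : ubound U ((z n + 1) / 2 ^+ n).
  move=> _ [m _ <-]; rewrite ler_pdivrMr// mulrAC ler_pdivlMr//.
  case: (leqP m n) => mn.
    have := zlo m (n - m)%N; rewrite subnKC// => h.
    rewrite -{1}(subnKC mn) exprD mulrA mulrAC.
    apply: (@le_trans _ _ (z n * 2 ^+ m)); last by rewrite ler_wpM2r ?(ltW (P _))// lerDl.
    by rewrite ler_wpM2r ?(ltW (P _)).
  have := zhi n (m - n)%N; rewrite subnKC ?(ltnW mn)// => h.
  rewrite -{2}(subnKC (ltnW mn)) exprD mulrA mulrAC.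
  apply: ler_wpM2r; first exact: (ltW (P _)).
  by apply: le_trans h; rewrite lerDl.
have hs : has_sup U.
  by split; [exists (z 0%N / 2 ^+ 0); exists 0%N|exists ((z 0%N + 1) / 2 ^+ 0)].
exists (sup U) => n; apply: floor_def; rewrite intrD -/(z n) /=.
have yhi m : sup U * 2 ^+ m <= z m + 1.
  by rewrite -ler_pdivlMr//; apply: ge_sup; [case: hs|exact: ub].
rewrite mulrC; apply/andP; split.
  by rewrite -ler_pdivrMr//; apply: ub_le_sup; [case: hs|exists n].
have [m nm dm] := zeros n.
have h1 := zhi n (m - n)%N; rewrite subnKC// in h1.
have h2 := yhi m.+1; rewrite zS dm addr0 in h2.
rewrite -(ltr_pM2r (P (m - n)%N)) -mulrA -exprD subnKC//.
apply: lt_le_trans h1; move: h2; rewrite exprSr mulrA; lra.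
Qed.

Section Cantor.
Context {R : realType} {d : nat}.
Local Notation pt := (@pt R d).
Local Notation idx := (idx d).

Definition nfree (free : pred nat) (m : nat) : nat := count free (iota 0 m).

Lemma nfreeS (free : pred nat) m : nfree free m.+1 = (nfree free m + free m)%N.
Proof. by rewrite /nfree -addn1 iotaD count_cat /= add0n addn0. Qed.

Lemma nfree_find (free : pred nat) m v : (v < nfree free m)%N ->
  exists e, [/\ (e < m)%N, free e & nfree free e = v].
Proof.
elim: m => [//|m IH]; rewrite nfreeS => h.
have [vm|mv] := ltnP v (nfree free m).
  by have [e [em fe <-]] := IH vm; exists e; split=> //; exact: leqW.
move: h; case fm : (free m) => h; last by lia.
by exists m; split=> //; lia.
Qed.

Lemma nfree_le (free : pred nat) m n : (m <= n)%N -> (nfree free m <= nfree free n)%N.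
Proof.
by move=> /subnKC <-; rewrite /nfree iotaD count_cat leq_addr.
Qed.

Lemma nfree_block (free : pred nat) m n : (m <= n)%N ->
  (forall e, (m <= e < n)%N -> free e) ->
  nfree free n = (nfree free m + (n - m))%N.
Proof.
move=> mn H; rewrite -{1}(subnKC mn) /nfree iotaD count_cat; congr addn.
rewrite -[RHS](size_iota (0 + m)); apply/eqP; rewrite -all_count.
by apply/allP => e; rewrite mem_iota => he; apply: H; lia.
Qed.

(** Coordinate [i] at free scale [e] reads bit [d * nfree free e + i]. This interleaving is why a
    cube of scale [j0 + m] determines the first [d * nfree free m] bits. *)
Lemma cantor_point (free : pred nat) (j0 : nat) (k : idx) :
  (forall n0, exists2 n, (n0 <= n)%N & ~~ free n) ->
  exists x : (nat -> bool) -> pt, forall b,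
  [/\ flr j0 (x b) = k,
      (forall b' m, flr (j0 + m) (x b) = flr (j0 + m) (x b') ->
          forall n, (n < d * nfree free m)%N -> b n = b' n) &
      (forall n m, (n <= m)%N -> (forall e, (n <= e < m)%N -> ~~ free e) ->
          forall i, flr (j0 + m) (x b) i = flr (j0 + n) (x b) i * 2 ^+ (m - n))].
Proof.
move=> nf; pose dig (b : nat -> bool) (i : 'I_d) e :=
  free e && b (d * nfree free e + i)%N.
have h b i : exists y : R, forall n, Num.floor (2 ^+ n * y) = binz (k i) (dig b i) n.
  apply: binary_expansion => n0; have [n nn fn] := nf n0.
  by exists n => //; rewrite /dig (negbTE fn).
have h' (bi : (nat -> bool) * 'I_d) := h bi.1 bi.2.
have [y Hy] := choice h'.
pose x b : pt := fun i => y (b, i) / 2 ^+ j0.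
have flrx b n i : flr (j0 + n) (x b) i = binz (k i) (dig b i) n.
  rewrite ffunE /x exprD mulrCA mulrA [in X in Num.floor X]mulrC -(Hy (b, i) n).
  by congr Num.floor; field; rewrite expf_neq0.
exists x => b; split.
- by apply/ffunP => i; rewrite -[j0 in LHS]addn0 flrx.
- move=> b' m E n nm; case d0 : (d == 0)%N.
    by move: nm; rewrite (eqP d0) mul0n.
  have dpos : (0 < d)%N by rewrite lt0n d0.
  have vm : (n %/ d < nfree free m)%N by rewrite ltn_divLR// mulnC.
  have [e [em fe ev]] := nfree_find vm.
  pose i := Ordinal (ltn_pmod n dpos).
  have : binz (k i) (dig b i) m = binz (k i) (dig b' i) m by rewrite -!flrx E.
  move=> /binz_inj /(_ e em); rewrite /dig fe ev /=.
  by rewrite mulnC -divn_eq.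
- move=> n m nm H i; rewrite !flrx; apply: binz_zero => // e he.
  by rewrite /dig (negbTE (H e he)).
Qed.

(** Mass distribution principle: under fair bits a cube of scale [m] has mass at most [2 ^- (nb m)],
    so the sets [A n] carry no mass and countably many of them, with exponents depending on [n],
    cannot exhaust a probability. *)
Lemma cantor_not_dnull (x : (nat -> bool) -> pt) (nb : nat -> nat)
    (A : nat -> set pt) (t : nat -> R) :
  (forall b b' m, flr m (x b) = flr m (x b') ->
     forall n, (n < nb m)%N -> b n = b' n) ->
  (forall n, exists2 K, 0 < K & forall m, 2 ^- (nb m) <= K * 2 `^ (- (t n * m%:R))) ->
  (forall n, dnull (t n) (A n)) ->
  ~ (forall b, exists n, A n (x b)).
Proof.
move=> xinj HK nA cov.
have [dd [T [P [b [mb Pb]]]]] := fair_bits R.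
have [K HK'] := choice (fun n => let: ex_intro2 K a c := HK n in
   ex_intro (fun K => 0 < K /\ forall m, 2 ^- (nb m) <= K * 2 `^ (- (t n * m%:R)))
     K (conj a c)).
(* The weights are chosen so that all masses together are at most [1 / 2]. *)
have h n : exists S : set (nat * idx), A n `<=` \bigcup_(q in S) cube q /\
    (\esum_(q in S) dweight (t n) q <= (2^-1 / (2 ^ n.+1)%:R / K n)%:E)%E.
  have [K0 _] := HK' n.
  have [|S ? ?] := nA n (2^-1 / (2 ^ n.+1)%:R / K n); last by exists S.
  by rewrite !divr_gt0// ltr0n expn_gt0.
have [S HS] := choice h.
pose bw w := fun n => b n w.
(* One representative per cube: by [xinj] all bit sequences sent into the cube agree with it on the
   first [nb] bits, so a cylinder covers the preimage. *)
have rep (q : nat * idx) : exists b0 : nat -> bool,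
    (exists w, cube q (x (bw w))) -> cube q (x b0).
  have [[w xw]|n] := pselect (exists w, cube q (x (bw w))).
    by exists (bw w).
  by exists (fun=> false) => /n.
have [b0 Hb0] := choice rep.
pose E (nq : nat * (nat * idx)) : set T :=
  [set w | forall i, i \in iota 0 (nb nq.2.1) -> b i w = b0 nq.2 i].
have mE nq : measurable (E nq).
  exact: (measurable_bits mb (b0 nq.2) (fun i => i \in iota 0 (nb nq.2.1))).
have : (P [set: T] <= \esum_(nq in [set: nat] `*`` S) P (E nq))%E.
  apply: measure_cover_le => // w _.
  have [n Anw] := cov (bw w); have [ASn _] := HS n.
  have [q Sq xq] := ASn _ Anw; exists (n, q) => //= i; rewrite mem_iota => /= iq.
  have : cube q (x (b0 q)) by apply: Hb0; exists w.
  by rewrite /cube /= -xq => /esym /xinj; exact.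
rewrite probability_setT -(esum_esum (a := fun n q => P (E (n, q))))//.
apply/negP; rewrite -ltNge.
apply: (@le_lt_trans _ _ (2^-1)%:E); last by rewrite lte_fin; lra.
apply: (@le_trans _ _ (\esum_(n in [set: nat]) (2^-1 / (2 ^ n.+1)%:R : R)%:E)); last first.
  by apply: esum_geo_half; rewrite invr_ge0.
apply: le_esum => n _; have [K0 HKn] := HK' n; have [_ HSn] := HS n.
apply: (@le_trans _ _ (\esum_(q in S n) ((K n)%:E * dweight (t n) q))%E).
  apply: le_esum => q _; apply: (@le_trans _ _ (2 ^- nb q.1)%:E).
    have := Pb (iota 0 (nb q.1)) (b0 q) (iota_uniq _ _); rewrite size_iota.
    exact.
  by rewrite -EFinM lee_fin.
apply: (le_trans (esumZl _ (ltW K0) (dweight_ge0 _))).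
apply: (@le_trans _ _ ((K n)%:E * (2^-1 / (2 ^ n.+1)%:R / K n)%:E)%E).
  by apply: lee_wpmul2l => //; rewrite lee_fin ltW.
by rewrite -EFinM lee_fin mulrC divfK// gt_eqF.
Qed.

End Cantor.

(** * Lower bounds from large coefficients *)

Lemma flr_box (R : realType) (d : nat) (x : @pt R d) (r H : nat) i :
  `|x i| + 1 <= r%:R -> `|flr H x i| <= r%:Z * 2 ^+ H.
Proof.
move=> hx; have /andP[h1 h2] := flr_itv H x i.
have xn := ler_norm (x i); have xn' := ler_norm (- x i); rewrite normrN in xn'.
have E1 : 1 <= 2 ^+ H :> R by rewrite exprn_ege1// ler1n.
rewrite -(ler_int R) intr_norm intrM rmorphXn/= ler_norml.
rewrite -[(r%:Z)%:~R]/(r%:R : R); move: (r%:R : R) hx => rr hx.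
have l1 : - rr * 2 ^+ H <= 2 ^+ H * x i - 1 by nra.
have l2 : 2 ^+ H * x i <= rr * 2 ^+ H by nra.
by apply/andP; split; lra.
Qed.

Section Lower.
Context {R : realType} {d N : nat}.
Local Notation pt := (@pt R d).
Local Notation idx := (idx d).
Local Notation Seq := (@Seq R d N).
Variables (s dp : R) (lo : nat -> R).
Variables (L : seq ('I_N * nat * idx)) (J0 : nat).

(** Saturating size at scale [j] near the corners of cubes of scale [J], reduced by a subexponential
    loss [lo j]. *)
Definition vthr (J j : nat) : R := 2 `^ ((dp - s) * j%:R - dp * J%:R - lo j).

Definition subpos (J j : nat) (K k : idx) : idx :=
  [ffun i => K i * 2 ^+ (j - J) + k i].

(** All triplets are demanded, because the one that sees a point depends on its place in the cube.
    [subpos] is the corner of the cube [(J, K)] read at the finer scale, shifted by the triplet. *)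
Definition trial_ok (C : Seq) (J j : nat) (K : idx) : Prop :=
  forall l, l \in L -> vthr J (j + l.1.2) <=
    cabs (C l.1.1 (j + l.1.2)%N (subpos J (j + l.1.2) K l.2)).

Definition anc (H J : nat) (v : idx) : idx :=
  [ffun i => (v i %/ 2 ^+ (H - J))%Z].

Definition trial_scale (j0 t : nat) : nat := (j0 + t * J0)%N.

(** Used at both ends of the range of [H]: with [H = r ^ 2] the cubes stay fixed while trials go
    deeper, for corner points; with [H = r ^ 2 + r * J0] and [j0 = r ^ 2] each trial tests the cubes
    of its own scale, for all points. *)
Definition window_ok (C : Seq) (r : nat) : Prop :=
  forall H j0 (v : idx), (r ^ 2 <= H <= r ^ 2 + r * J0)%N ->
    (r ^ 2 <= j0 <= r ^ 4)%N -> (forall i, `|v i| <= r%:Z * 2 ^+ H) ->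
    exists2 t, (t < r)%N & trial_ok C (minn H (trial_scale j0 t))
      (trial_scale j0 t) (anc H (minn H (trial_scale j0 t)) v).

Definition good_seq (C : Seq) : Prop :=
  forall r0, exists2 r, (r0 <= r)%N & window_ok C r.

Variable psi : 'I_N -> pt -> R[i].
Variable C0 : R.
Hypothesis C0_gt0 : 0 < C0.
Hypothesis L_scale : forall l, l \in L -> (1 <= l.1.2 <= J0)%N.
Hypothesis L_cover : forall x : pt, (forall m, 0 <= x m < 1) ->
  exists2 l, l \in L & C0 <= cabs (wav psi l.1.1 l.1.2 l.2 x).
Hypothesis dp_ge0 : 0 <= dp.
Hypothesis lo_small : forall e, 0 < e -> exists m0, forall m, (m0 <= m)%N ->
  lo m <= e * m%:R.

(** Self-similarity: when the cube of [x] at scale [j] sits at the corner of [(J, K)], the wavelet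
    placed by [subpos] takes at [x] the value that the triplet's wavelet takes at the fractional
    part [y] of [2 ^ j x], where dyadic covering applies. *)
Lemma trial_hit (C : Seq) (J j : nat) (K : idx) (x : pt) : (J <= j)%N ->
  (forall i, flr j x i = K i * 2 ^+ (j - J)) -> trial_ok C J j K ->
  exists i j' k, (j <= j' <= j + J0)%N /\
    C0 * vthr J j' <= cabs (C i j' k * wav psi i j' k x).
Proof.
move=> Jj xK ok; pose y : pt := fun m => 2 ^+ j * x m - (flr j x m)%:~R.
have y01 m : 0 <= y m < 1.
  by have /andP[h1 h2] := flr_itv j x m; rewrite /y; apply/andP; split; lra.
have [l lL hl] := L_cover y01; have /andP[l1 l2] := L_scale lL.
exists l.1.1, (j + l.1.2)%N, (subpos J (j + l.1.2) K l.2).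
split; first by rewrite leq_addr leq_add2l.
rewrite cabsM mulrC; apply: ler_pM; rewrite ?(ltW C0_gt0) ?powR_ge0//; last first.
  rewrite (_ : wav psi _ _ _ x = wav psi l.1.1 l.1.2 l.2 y)// /wav.
  congr psi; apply/funext => m; rewrite /y ffunE xK intrD !intrM.
  rewrite !rmorphXn /= (_ : (j + l.1.2 - J)%N = (l.1.2 + (j - J))%N); last first.
    by rewrite addnBA// addnC.
  by rewrite !exprD; ring.
exact: ok.
Qed.

(** With [H] beyond all trial scales, [J = j]; the cost [dp * j] in the threshold is at most its
    gain [dp * j'], which leaves [- s * j'] up to the loss. *)
Lemma divexp_ge_good (C : Seq) (x : pt) (g : R) : good_seq C -> g < - s -> (g%:E <= divexp psi C x)%E.
Proof.
move=> good gs; apply: (divexp_ge_of C0_gt0) => j0.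
have e0 : 0 < - s - g by lra.
have [m0 Hm0] := lo_small e0.
have [rx Hrx] : exists rx : nat, forall i, `|x i| + 1 <= rx%:R.
  exists (\max_i Num.truncn (`|x i| + 1)).+1 => i.
  by apply: (le_trans (ltW (truncnS_gt _))); rewrite ler_nat ltnS leq_bigmax.
have [r rr ok] := good (rx + m0 + j0).+1.
have [rxr m0r j0r r1] : [/\ (rx <= r)%N, (m0 <= r)%N, (j0 <= r)%N & (0 < r)%N].
  by clear -rr; split; lia.
have rn : (r <= r ^ 2)%N by rewrite -{1}(expn1 r) leq_pexp2l.
have rn4 : (r ^ 2 <= r ^ 4)%N by rewrite leq_pexp2l.
pose H := (r ^ 2 + r * J0)%N.
have [|||t tr] := ok H (r ^ 2)%N (flr H x).
- by rewrite leq_addr leqnn.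
- by rewrite leqnn.
- by move=> i; apply: flr_box; apply: (le_trans (Hrx i)); rewrite ler_nat.
pose j := trial_scale (r ^ 2) t; rewrite -/j.
have jH : (j <= H)%N.
  by rewrite /j /trial_scale /H leq_add2l leq_mul2r (ltnW tr) orbT.
rewrite (minn_idPr jH) => /(@trial_hit _ _ _ _ x (leqnn _)) [|i [j' [k [jj' Hk]]]].
  by move=> i; rewrite subnn expr0 mulr1 [RHS]ffunE; exact: flr_div.
have rj' : (r <= j')%N.
  by case/andP: jj' => h _; apply: leq_trans h; rewrite (leq_trans rn)// leq_addr.
exists i, j', k; split.
  exact: leq_trans j0r rj'.
apply: le_trans Hk; rewrite ler_wpM2l ?(ltW C0_gt0)//.
apply: pow2_le; have lj' := Hm0 j' (leq_trans m0r rj').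
have jj1 : j%:R <= j'%:R :> R by rewrite ler_nat; case/andP: jj'.
have : dp * j%:R <= dp * j'%:R by rewrite ler_wpM2l.
lra.
Qed.

Lemma divexp_ge_minus_s (C : Seq) (x : pt) : good_seq C -> ((- s)%:E <= divexp psi C x)%E.
Proof.
move=> good; apply/lee_subgt0Pr => e e0; rewrite -EFinB.
by apply: divexp_ge_good => //; lra.
Qed.

End Lower.

(** [jz r] is about [r ^ 2 / a]; for [a = 0] the latest start [r ^ 4] is used. *)
Lemma window_start (R : realType) (a : R) : 0 <= a <= 1 ->
  exists jz : nat -> nat,
  [/\ (exists r1, forall r, (r1 <= r)%N -> (r ^ 2 <= jz r <= r ^ 4)%N),
      (forall r, a * (jz r)%:R <= (r ^ 2)%:R) &
      (forall e, 0 < e -> exists r2, forall r, (r2 <= r)%N ->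
         (r ^ 2)%:R <= (a + e) * (jz r)%:R)].
Proof.
move=> /andP[a0 a1].
have sq r : (r <= r ^ 2)%N by case: r => // r; rewrite -{1}(expn1 r.+1) leq_pexp2l.
have [az|an] := eqVneq a 0.
  exists (fun r => r ^ 4)%N; split.
  - by exists 1%N => r r1; rewrite leqnn andbT leq_pexp2l.
  - by move=> r; rewrite az mul0r.
  - move=> e e0; have [m Hm] := nat_above e^-1; exists m => r /Hm h.
    rewrite az add0r (_ : (r ^ 4 = r ^ 2 * r ^ 2)%N); last by rewrite -expnD.
    rewrite natrM mulrA ler_peMl// -ler_pdivrMl// mulr1.
    by apply: (le_trans (ltW h)); rewrite ler_nat.
have apos : 0 < a by rewrite lt_def an.
exists (fun r => Num.truncn ((r ^ 2)%:R / a)); split.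
- have [m Hm] := nat_above a^-1; exists m => r /Hm h; apply/andP; split.
    rewrite -[leqLHS](@natrK R); apply: le_truncn.
    by rewrite ler_pdivlMr// ler_piMr.
  have : (Num.truncn ((r ^ 2)%:R / a))%:R <= (r ^ 4)%:R :> R.
    apply: (@le_trans _ _ ((r ^ 2)%:R / a)).
      by rewrite truncn_le divr_ge0// ltW.
    rewrite (_ : (r ^ 4 = r ^ 2 * r ^ 2)%N); last by rewrite -expnD.
    rewrite natrM ler_wpM2l//.
    by apply: (le_trans (ltW h)); rewrite ler_nat.
  by rewrite ler_nat.
- move=> r; by rewrite mulrC -ler_pdivlMr// truncn_le divr_ge0// ltW.
- move=> e e0; have [m Hm] := nat_above (a / e + 1); exists m => r /Hm h.
  have := truncnS_gt ((r ^ 2)%:R / a); rewrite -natr1 ltr_pdivrMr// => h1.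
  set T := (Num.truncn _)%:R in h1 *.
  have rT : (r ^ 2)%:R < T + 1 :> R.
    by apply: (lt_le_trans h1); rewrite ler_piMr// addr_ge0// ler0n.
  have h2 : r%:R <= (r ^ 2)%:R :> R by rewrite ler_nat.
  have h3 : a / e < T by lra.
  rewrite ltr_pdivrMr// in h3; lra.
Qed.

Lemma cantor_point_abs (R : realType) (d : nat) (free : pred nat) (j0 : nat)
    (k : idx d) :
  (forall n0, exists2 n, (n0 <= n)%N & ~~ free n) ->
  (forall e, (e < j0)%N -> ~~ free e) ->
  exists x : (nat -> bool) -> @pt R d, forall b,
  [/\ flr j0 (x b) = k,
      (forall b' m, flr m (x b) = flr m (x b') ->
          forall n, (n < d * nfree free m)%N -> b n = b' n) &
      (forall n m, (j0 <= n)%N -> (n <= m)%N ->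
          (forall e, (n <= e < m)%N -> ~~ free e) ->
          forall i, flr m (x b) i = flr n (x b) i * 2 ^+ (m - n))].
Proof.
move=> nf f0; pose free' n := free (j0 + n)%N.
have nf' n0 : exists2 n, (n0 <= n)%N & ~~ free' n.
  have [n nn fn] := nf (j0 + n0)%N; exists (n - j0)%N.
    by rewrite leq_subRL ?(leq_trans (leq_addr _ _) nn).
  by rewrite /free' subnKC// (leq_trans (leq_addr _ _) nn).
have nfr0 m : (m <= j0)%N -> nfree free m = 0%N.
  elim: m => [//|m IH] mj; rewrite nfreeS IH ?(ltnW mj)//.
  by rewrite (negbTE (f0 m mj)).
have nfrE m : nfree free (j0 + m)%N = nfree free' m.
  elim: m => [|m IH]; first by rewrite addn0 nfr0.
  by rewrite addnS !nfreeS IH.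
have [x Hx] := @cantor_point R d free' j0 k nf'.
exists x => b; have [h1 h2 h3] := Hx b; split=> //.
  move=> b' m; have [mj|jm] := leqP m j0.
    by move=> _ n; rewrite nfr0// muln0.
  by rewrite -(subnKC (ltnW jm)) nfrE => /h2.
move=> n m jn nm H i; have jm := leq_trans jn nm.
have := h3 (n - j0)%N (m - j0)%N (leq_sub2r _ nm).
rewrite !subnKC// (_ : (m - j0 - (n - j0))%N = (m - n)%N); last first.
  by clear -jn nm; lia.
apply=> e he; apply: H; clear -he jn nm jm; lia.
Qed.

Lemma increasing_find (n : nat -> nat) k0 m :
  (forall k, (n k < n k.+1)%N) -> (n k0 <= m)%N ->
  exists k, (k0 <= k)%N /\ (n k <= m <= n k.+1)%N.
Proof.
move=> ninc; elim: m => [|m IH].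
  by move=> h; exists k0; split=> //; rewrite h.
rewrite leq_eqVlt => /orP[/eqP<-|].
  by exists k0; split=> //; rewrite leqnn (ltnW (ninc k0)).
rewrite ltnS => /IH [k [kk /andP[h1 h2]]].
have [mk|mk] := ltnP m (n k.+1).
  by exists k; split=> //; rewrite mk leqW.
exists k.+1; split; first exact: leqW.
have e : m = n k.+1 by apply/eqP; rewrite eqn_leq h2.
by rewrite e leqnSn (ninc k.+1).
Qed.

Section Scales.
Variables (j n : nat -> nat).
Hypothesis jn : forall k, (j k < n k)%N.
Hypothesis nj : forall k, (n k < j k.+1)%N.

Definition free_scales : pred nat := fun e => `[< exists k, (j k <= e < n k)%N >].

Lemma scales_mono k k' : (k <= k')%N -> (j k <= j k')%N /\ (n k <= n k')%N.
Proof.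
elim: k' => [|k' IH]; first by rewrite leqn0 => /eqP->.
rewrite leq_eqVlt => /orP[/eqP->|]//; rewrite ltnS => /IH[h1 h2].
split; first by rewrite (leq_trans h1)// ltnW// (ltn_trans (jn k'))// nj.
by rewrite (leq_trans h2)// ltnW// (ltn_trans (nj k'))// jn.
Qed.

Lemma free_scalesT k e : (j k <= e < n k)%N -> free_scales e.
Proof. by move=> h; apply/asboolP; exists k. Qed.

Lemma free_scalesF k e : (n k <= e < j k.+1)%N -> ~~ free_scales e.
Proof.
move=> /andP[h1 h2]; apply/negP => /asboolP[k' /andP[h3 h4]].
have [kk|kk] := leqP k' k.
  have [_ h] := scales_mono kk.
  by have := leq_trans h4 (leq_trans h h1); rewrite ltnn.
have [h _] := scales_mono kk.
by have := leq_trans h2 (leq_trans h h3); rewrite ltnn.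
Qed.

Lemma free_scales0 e : (e < j 0)%N -> ~~ free_scales e.
Proof.
move=> h; apply/negP => /asboolP[k' /andP[h3 h4]].
have [h' _] := scales_mono (leq0n k').
by have := leq_trans h (leq_trans h' h3); rewrite ltnn.
Qed.

Lemma scales_ge k : (k <= n k)%N.
Proof.
elim: k => [//|k IH]; apply: (leq_ltn_trans IH).
exact: ltn_trans (nj k) (jn k.+1).
Qed.

(** The proportion of free digits is least at the end of a block of zeros, where the hypothesis
    bounds it; along a free block every scale adds one, at least the slope [a]. *)
Lemma nfree_growth (R : realType) (a : R) k0 : 0 <= a <= 1 ->
  (forall k, (k0 <= k)%N -> a * (j k.+1)%:R <= (n k)%:R - (j k)%:R) ->
  forall m, (n k0 <= m)%N -> a * m%:R <= (nfree free_scales m)%:R.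
Proof.
move=> /andP[a0 a1] H m mk0.
have ninc k : (n k < n k.+1)%N by exact: ltn_trans (nj k) (jn k.+1).
have [k [kk /andP[h1 h2]]] := increasing_find ninc mk0.
have cn : (n k - j k <= nfree free_scales (n k))%N.
  rewrite (nfree_block (ltnW (jn k))) ?leq_addl// => e; exact: free_scalesT.
have {}cn : (n k)%:R - (j k)%:R <= (nfree free_scales (n k))%:R :> R.
  by rewrite -natrB ?ler_nat// ltnW.
have [mj|jm] := leqP m (j k.+1).
  apply: (@le_trans _ _ (a * (j k.+1)%:R)).
    by rewrite ler_wpM2l// ler_nat.
  apply: (le_trans (H k kk)); apply: (le_trans cn); rewrite ler_nat.
  exact: nfree_le.
rewrite (nfree_block (ltnW jm)); last first.
  move=> e /andP[e1 e2]; apply: (@free_scalesT k.+1).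
  by rewrite e1 (leq_trans e2).
rewrite -{1}(subnKC (ltnW jm)) !natrD mulrDr lerD//.
  apply: (le_trans (H k kk)); apply: (le_trans cn); rewrite ler_nat.
  by apply: nfree_le; rewrite ltnW.
by rewrite ler_piMl.
Qed.

End Scales.

Lemma open_cube (R : realType) (d : nat) (B : set (@pt R d)) y :
  openRd B -> B y -> exists j, forall z, flr j z = flr j y -> B z.
Proof.
move=> oB By; have [e e0 He] := oB y By.
have d0 : 0 < d.+1%:R :> R by rewrite ltr0n.
have [m0 Hm0] := exists_powR_lt (@ltr01 R) (divr_gt0 e0 d0).
exists m0 => z zy; apply: He; apply: (le_lt_trans (flr_eq_edist (esym zy))).
rewrite mulrC -ltr_pdivlMr//; have := Hm0 m0 (leqnn _).
by rewrite mul1r powRN powR_mulrn.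
Qed.

(** * Cantor sets of points with large divergence exponent *)

Section Cantor_divergence.
Context {R : realType} {d N : nat}.
Local Notation pt := (@pt R d).
Local Notation idx := (idx d).
Local Notation Seq := (@Seq R d N).
Variables (s dp : R) (lo : nat -> R).
Variables (L : seq ('I_N * nat * idx)) (J0 : nat).
Variable psi : 'I_N -> pt -> R[i].
Variable C0 : R.
Hypothesis d_gt0 : (0 < d)%N.
Hypothesis J0_gt0 : (0 < J0)%N.
Hypothesis C0_gt0 : 0 < C0.
Hypothesis L_scale : forall l, l \in L -> (1 <= l.1.2 <= J0)%N.
Hypothesis L_cover : forall x : pt, (forall m, 0 <= x m < 1) ->
  exists2 l, l \in L & C0 <= cabs (wav psi l.1.1 l.1.2 l.2 x).
Hypothesis dp_ge0 : 0 <= dp.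
Hypothesis lo_small : forall e, 0 < e -> exists m0, forall m, (m0 <= m)%N ->
  lo m <= e * m%:R.
Variable C : Seq.
Hypothesis C_good : good_seq s dp lo L J0 C.

(** [r k] is picked after [j k] and beyond [(k + 1) (j k + 1)], so that earlier scales become
    negligible against [r k ^ 2]. *)
Lemma scales_exist (jz : nat -> nat) (R0 js : nat) :
  exists r j : nat -> nat, j 0%N = js /\ forall k,
  [/\ window_ok s dp lo L J0 C (r k), (R0 + k < r k)%N,
      (k.+1 * (j k).+1 <= r k ^ 2)%N & j k.+1 = (jz (r k) + r k * J0)%N].
Proof.
have h (kj : nat * nat) : exists r, window_ok s dp lo L J0 C r /\
    (R0 + kj.1 + kj.1.+1 * kj.2.+1 < r)%N.
  by have [r rr ok] := C_good (R0 + kj.1 + kj.1.+1 * kj.2.+1).+1; exists r.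
have [f Hf] := choice h.
pose j := fix j k := if k is m.+1 then (jz (f (m, j m)) + f (m, j m) * J0)%N else js.
exists (fun k => f (k, j k)), j; split=> // k.
have [h1 h2] := Hf (k, j k); rewrite /= in h2; split=> //.
  by apply: leq_ltn_trans h2; rewrite leq_addr.
have h3 : (k.+1 * (j k).+1 <= f (k, j k))%N.
  by rewrite ltnW// (leq_ltn_trans _ h2)// leq_addl.
by rewrite (leq_trans h3)// -{1}(expn1 (f _)) leq_pexp2l// (leq_trans _ h3).
Qed.

(** Zeros on [[n k, j k.+1)] keep the point in the corner of its cube of scale [n k] during the
    whole window, so whichever trial succeeds sees it. Its size is governed by the ratio of [n k] to
    [jz (r k)], which tends to [a]. *)
Lemma cantor_divergent (a : R) (B : set pt) : 0 <= a <= 1 ->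
  openRd B -> B !=set0 ->
  exists (x : (nat -> bool) -> pt) (nb : nat -> nat),
  [/\ (forall b b' m, flr m (x b) = flr m (x b') ->
        forall n, (n < nb m)%N -> b n = b' n),
      (forall t, t < d%:R * a ->
        exists2 K, 0 < K & forall m, 2 ^- (nb m) <= K * 2 `^ (- (t * m%:R))),
      (forall b, B (x b)) &
      (forall b, ((dp - s - a * dp)%:E <= divexp psi C (x b))%E)].
Proof.
move=> a01 oB [y By]; have [js Hjs] := open_cube oB By.
have [jz [[r1 Hr1] jz_le jz_ge]] := window_start a01.
(* The maximum bounds the chosen cube, so that the box condition of [window_ok] holds for all its
   points. *)
pose R0 := (r1 + \max_i (`|flr js y i|%N + 2))%N.
have [r [j [j0E Hrj]]] := scales_exist jz R0 js.
pose n k := (r k ^ 2)%N.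
have rk k : (R0 + k < r k)%N by have [] := Hrj k.
have r1r k : (r1 <= r k)%N.
  by apply: leq_trans (ltnW (rk k)); rewrite -addnA leq_addr.
have jn k : (j k < n k)%N.
  have [_ _ h _] := Hrj k; apply: leq_trans h.
  by rewrite leq_pmull.
have rpos k : (0 < r k)%N by exact: leq_ltn_trans (rk k).
have nj k : (n k < j k.+1)%N.
  have [_ _ _ ->] := Hrj k; have /andP[h _] := Hr1 _ (r1r k).
  by rewrite /n -[X in (X < _)%N]addn0 -addnS leq_add// muln_gt0 rpos.
pose free := free_scales j n.
have [||x Hx] := @cantor_point_abs R d free js (flr js y).
- move=> n0; exists (n n0); first exact: scales_ge jn nj n0.
  by apply: (@free_scalesF j n jn nj n0); rewrite leqnn nj.
- by move=> e ej; apply: (free_scales0 jn nj); rewrite j0E.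
exists x, (fun m => d * nfree free m)%N; split.
- by move=> b b' m; have [_ h _] := Hx b; exact: h.
- move=> t ta; have [t0|t0] := leP t 0.
    exists 1 => // m; rewrite mul1r; apply: (@le_trans _ _ 1).
      by rewrite invf_le1 ?exprn_gt0// exprn_ege1// ler1n.
    rewrite -[leLHS](powRr0 2); apply: pow2_le.
    by rewrite -mulNr mulr_ge0// oppr_ge0.
  have dR : 0 < d%:R :> R by rewrite ltr0n.
  pose a' := t / d%:R; have a'0 : 0 < a' by rewrite divr_gt0.
  have a'a : a' < a by rewrite ltr_pdivrMr// mulrC.
  have apos : 0 < a by exact: lt_trans a'a.
  have a1 : a <= 1 by case/andP: a01.
  (* Half of the relative slack between [a'] and [a]: one half absorbs the window length [r k * J0],
     the other the earlier scale [j k]. *)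
  pose dl := (1 - a' / a) / 2.
  have dl0 : 0 < dl by rewrite divr_gt0// subr_gt0 ltr_pdivrMr// mul1r.
  have [k0 Hk0] : exists k0 : nat, forall k, (k0 <= k)%N ->
      a' * J0%:R <= dl * k%:R /\ 1 <= dl * k.+1%:R.
    exists (Num.truncn ((a' * J0%:R + 1) / dl)).+1 => k kk.
    have : (a' * J0%:R + 1) / dl < k%:R.
      by apply: (lt_le_trans (truncnS_gt _)); rewrite ler_nat.
    rewrite ltr_pdivrMr// -natr1 => h.
    have : 0 <= a' * J0%:R by rewrite mulr_ge0// ltW.
    by move=> h'; split; lra.
  have grow k : (k0 <= k)%N -> a' * (j k.+1)%:R <= (n k)%:R - (j k)%:R.
    move=> kk; have [h1 h2] := Hk0 k kk; have [_ _ h3 ->] := Hrj k.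
    have rkk : (k%:R : R) <= (r k)%:R.
      by rewrite ler_nat ltnW// (leq_ltn_trans _ (rk k))// leq_addl.
    rewrite natrD mulrDr natrM.
    have p1 : a' * (jz (r k))%:R <= a' / a * (n k)%:R.
      rewrite -mulrA ler_wpM2l ?(ltW a'0)// mulrC ler_pdivlMr// mulrC.
      exact: jz_le.
    have p2 : a' * ((r k)%:R * J0%:R) <= dl * (n k)%:R.
      rewrite /n natrX expr2 mulrCA mulrA [dl * _]mulrC.
      rewrite -mulrA -[leRHS]mulrA ler_wpM2l//.
      by apply: (le_trans h1); rewrite [leRHS]mulrC ler_wpM2l// ltW.
    have p3 : (j k)%:R <= dl * (n k)%:R.
      have : (k.+1 * (j k))%:R <= (n k)%:R :> R.
        by rewrite ler_nat (leq_trans _ h3)// leq_mul2l leqnSn orbT.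
      rewrite natrM => h4.
      apply: (@le_trans _ _ (dl * (k.+1%:R * (j k)%:R))).
        by rewrite mulrA ler_peMl.
      by rewrite ler_wpM2l// ltW.
    have : a' / a * (n k)%:R + 2 * dl * (n k)%:R = (n k)%:R.
      by rewrite /dl; field; rewrite gt_eqF.
    lra.
  have a'01 : 0 <= a' <= 1 by rewrite ltW//= (le_trans (ltW a'a)).
  have G := nfree_growth jn nj a'01 grow.
  exists (2 `^ (t * (n k0)%:R)) => [|m]; first exact: pow2_gt0.
  rewrite -pow2D -powR_mulrn// -powRN; apply: pow2_le.
  have [mk|km] := leqP (n k0) m.
    have := G m mk; rewrite /a' mulrAC ler_pdivrMr// [_ * d%:R]mulrC => h.
    rewrite natrM -/free in h *.
    have : 0 <= t * (n k0)%:R by rewrite mulr_ge0// ltW.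
    lra.
  have : t * m%:R <= t * (n k0)%:R by rewrite ler_wpM2l ?(ltW t0)// ler_nat ltnW.
  have : 0 <= (d * nfree free m)%:R :> R by [].
  lra.
- by move=> b; apply: Hjs; have [] := Hx b.
- move=> b; apply/lee_subgt0Pr => e e0; rewrite -EFinB.
  apply: (divexp_ge_of C0_gt0) => m0.
  (* Half of [e] pays for replacing the ratio of scales by [a], the other half for the loss [lo]. *)
  pose e' := e / (2 * (dp + 1)).
  have dp1 : 0 < dp + 1 by rewrite ltr_wpDl.
  have e'0 : 0 < e' by rewrite divr_gt0// mulr_gt0.
  have e'dp : dp * e' <= e / 2.
    rewrite (_ : e / 2 = (dp + 1) * e'); last by rewrite /e'; field; rewrite gt_eqF.
    by rewrite ler_wpM2r ?(ltW e'0)// lerDl.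
  have [m1 Hm1] := lo_small (divr_gt0 e0 (@ltr0n R 2)).
  have [r2 Hr2] := jz_ge _ e'0.
  pose k := (m0 + m1 + r2)%N.
  have [ok _ _ jk1] := Hrj k.
  have [m0r m1r r2r] : [/\ (m0 <= r k)%N, (m1 <= r k)%N & (r2 <= r k)%N].
    have := rk k; rewrite /k => h; clear -h; split; lia.
  have [xjs _ xz] := Hx b.
  have /andP[jz1 jz2] := Hr1 _ (r1r k).
  have [||i|t tr] := ok (n k) (jz (r k)) (flr (n k) (x b)).
  + by rewrite leqnn leq_addr.
  + by rewrite jz1 jz2.
  + apply: flr_box.
    have Rr : (`|flr js y i|%N + 2 <= r k)%N.
      apply: leq_trans (ltnW (rk k)); rewrite /R0 -addnA addnCA.
      apply: (@leq_trans (\max_i (`|flr js y i|%N + 2))); last exact: leq_addr.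
      exact: (leq_bigmax i).
    have Rr' : `|(flr js y i)%:~R| + 2 <= (r k)%:R :> R.
      rewrite -intr_norm -abszE -[(`|_|%N%:Z)%:~R]/(`|flr js y i|%N%:R : R).
      by rewrite -natrD ler_nat.
    have /andP[h1 h2] := flr_itv js (x b) i; rewrite xjs in h1 h2.
    have E1 : 1 <= 2 ^+ js :> R by rewrite exprn_ege1// ler1n.
    set z := (flr js y i)%:~R in Rr' h1 h2.
    have zn := ler_norm z; have zn' := ler_norm (- z); rewrite normrN in zn'.
    have h3 : `|2 ^+ js * x b i| <= `|z| + 1 by rewrite ler_norml; apply/andP; split; lra.
    rewrite normrM (ger0_norm (le_trans ler01 E1)) in h3.
    have : `|x b i| <= 2 ^+ js * `|x b i| by rewrite ler_peMl.
    lra.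
  pose jt := trial_scale J0 (jz (r k)) t; rewrite -/jt.
  have njt : (n k <= jt)%N by rewrite (leq_trans jz1)// leq_addr.
  have jtj : (jt < j k.+1)%N.
    by rewrite jk1 /jt /trial_scale ltn_add2l ltn_mul2r J0_gt0.
  have jsn : (js <= n k)%N.
    rewrite -j0E; have [h _] := scales_mono jn nj (leq0n k).
    by rewrite (leq_trans h)// ltnW.
  rewrite (minn_idPl njt).
  move=> /(trial_hit (psi := psi) C0_gt0 L_scale L_cover (x := x b) njt)[|i [j' [kk [jj' Hk]]]].
    move=> i; rewrite [anc _ _ _ _]ffunE subnn expr0 divz1; apply: xz => //.
    move=> e2 /andP[e3 e4]; apply: (@free_scalesF j n jn nj k).
    by rewrite e3 (ltn_trans e4).
  have jj1 : (jt <= j')%N by case/andP: jj'.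
  have jzj' : (jz (r k) <= j')%N by rewrite (leq_trans _ jj1)// leq_addr.
  have rj' : (r k <= j')%N.
    rewrite (leq_trans _ jzj')// (leq_trans _ jz1)//.
    by rewrite -{1}(expn1 (r k)) leq_pexp2l.
  exists i, j', kk; split; first exact: leq_trans m0r rj'.
  apply: le_trans Hk; rewrite ler_wpM2l ?(ltW C0_gt0)//.
  apply: pow2_le; have lj' := Hm1 j' (leq_trans m1r rj').
  have nk := Hr2 _ r2r; rewrite -/(n k) in nk.
  have jzR : (jz (r k))%:R <= j'%:R :> R by rewrite ler_nat.
  have a0 : 0 <= a by case/andP: a01.
  have p1 : (n k)%:R <= (a + e') * j'%:R.
    by apply: (le_trans nk); rewrite ler_wpM2l// addr_ge0// ltW.
  have p2 : dp * (n k)%:R <= dp * ((a + e') * j'%:R) by rewrite ler_wpM2l.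
  have p3 : dp * e' * j'%:R <= e / 2 * j'%:R by rewrite ler_wpM2r.
  lra.
Qed.

End Cantor_divergence.

(** * Good sequences are maximally divergent *)

Section Max_divergence.
Context {R : realType} {d N : nat}.
Local Notation pt := (@pt R d).
Local Notation idx := (idx d).
Local Notation Seq := (@Seq R d N).
Variables (s : R) (p q : \bar R) (lo : nat -> R).
Variables (L : seq ('I_N * nat * idx)) (J0 : nat).
Variable psi : 'I_N -> pt -> R[i].
Variable C0 : R.
Hypothesis d_gt0 : (0 < d)%N.
Hypothesis N_gt0 : (0 < N)%N.
Hypothesis p_gt0 : (0 < p)%E.
Hypothesis q_gt0 : (0 < q)%E.
Hypothesis psi_decay : fast_decay psi.
Hypothesis J0_gt0 : (0 < J0)%N.
Hypothesis C0_gt0 : 0 < C0.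
Hypothesis L_scale : forall l, l \in L -> (1 <= l.1.2 <= J0)%N.
Hypothesis L_cover : forall x : pt, (forall m, 0 <= x m < 1) ->
  exists2 l, l \in L & C0 <= cabs (wav psi l.1.1 l.1.2 l.2 x).
Hypothesis lo_small : forall e, 0 < e -> exists m0, forall m, (m0 <= m)%N ->
  lo m <= e * m%:R.
Variable C : Seq.
Hypothesis C_inB : inB s p q C.
Hypothesis C_good : good_seq s (d_over d p) lo L J0 C.

Lemma d_over_ge0 : 0 <= d_over d p.
Proof.
case: p p_gt0 => [r| |]//=; rewrite lte_fin => r0.
by rewrite divr_ge0// ltW.
Qed.

Lemma divexp_real x : exists2 v : R, divexp psi C x = v%:E &
  - s <= v <= d_over d p - s.
Proof.
have h1 := divexp_ge_minus_s C0_gt0 L_scale L_cover d_over_ge0 lo_small x C_good.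
have h2 := divexp_le N_gt0 psi_decay x p_gt0 q_gt0 C_inB.
by case: (divexp psi C x) h1 h2 => [v| |]//; rewrite !lee_fin => h1 h2;
  exists v; rewrite ?h1.
Qed.

Lemma divexp_neq_gt x g : (g%:E <= divexp psi C x)%E -> divexp psi C x <> g%:E ->
  exists n : nat, ((g + n.+1%:R^-1)%:E < divexp psi C x)%E.
Proof.
have [v -> _] := divexp_real x; rewrite lee_fin => gv vg.
have vg0 : 0 < v - g by rewrite subr_gt0 lt_def gv andbT; apply/eqP => h; apply: vg; rewrite h.
exists (Num.truncn (v - g)^-1); rewrite lte_fin -ltrBrDl.
by rewrite invf_plt ?posrE// ?truncnS_gt// ltr0n.
Qed.

Lemma lnull_divexp r : p = r%:E -> lnull [set x | divexp psi C x <> (- s)%:E].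
Proof.
move=> pr; have r0 : 0 < r by rewrite -lte_fin -pr.
apply: dnull_lnull => //.
apply: (@dnull_sub _ _ _ _ (\bigcup_n [set x | ((- s + n.+1%:R^-1)%:E < divexp psi C x)%E])).
  move=> x /= xs; have h := divexp_ge_minus_s C0_gt0 L_scale L_cover d_over_ge0
    lo_small x C_good.
  by have [n Hn] := divexp_neq_gt h xs; exists n.
have CB : inB s r%:E q C by rewrite -pr.
apply: dnull_bigcup => n; apply: (dnull_divexp_gt N_gt0 psi_decay r0 q_gt0 CB).
have : 0 < n.+1%:R^-1 * r by rewrite mulr_gt0// invr_gt0 ltr0n.
by move: (n.+1%:R^-1) => u; rewrite mulrDl mulNr; lra.
Qed.

(** The Cantor points have exponent at least [g]; those above [g] lie in countably many sets of
    dimension below [tau], so the level set cannot be null for any exponent below [tau]. *)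
Lemma dimH_divexp r (B : set pt) (g : R) : p = r%:E -> openRd B -> B !=set0 ->
  - s <= g <= d_over d p - s ->
  dimH [set x | B x /\ divexp psi C x = g%:E] = (d%:R - s * r - g * r)%:E.
Proof.
move=> pr oB B0 /andP[g1 g2].
have r0 : 0 < r by rewrite -lte_fin -pr.
have CB : inB s r%:E q C by rewrite -pr.
have dpE : d_over d p = d%:R / r by rewrite pr.
have dR : 0 < d%:R :> R by rewrite ltr0n.
set S := [set x | _]; pose tau := d%:R - s * r - g * r; rewrite -/tau.
have tau0 : 0 <= tau.
  have : (g + s) * r <= d%:R.
    by rewrite -ler_pdivlMr// -dpE; lra.
  by rewrite /tau; lra.
have taud : tau <= d%:R.
  have : 0 <= (g + s) * r by rewrite mulr_ge0 ?(ltW r0)//; lra.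
  by rewrite /tau; lra.
(* For this [a] the Cantor exponent [d / p - s - a d / p] equals [g] and the Cantor dimension [d a]
   equals [tau]. *)
pose a := tau / d%:R.
have a01 : 0 <= a <= 1.
  by rewrite divr_ge0 ?(ltW dR)//= ler_pdivrMr// mul1r.
have ag : d_over d p - s - a * d_over d p = g.
  rewrite dpE /a /tau; field; rewrite (gt_eqF dR) (gt_eqF r0)//.
have atau : d%:R * a = tau by rewrite /a mulrC divfK// gt_eqF.
have [x [nb [xinj Hnb xB xg]]] := cantor_divergent d_gt0 J0_gt0 C0_gt0 L_scale
  L_cover d_over_ge0 lo_small C_good a01 oB B0.
rewrite ag in xg; rewrite atau in Hnb.
have nS t1 : t1 < tau -> ~ dnull t1 S.
  move=> t1tau nS1.
  pose A n := if n is m.+1 then [set x | ((g + m.+1%:R^-1)%:E < divexp psi C x)%E] else S.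
  (* Strictly between the dimension bound [tau - r / (m + 1)] of [A m.+1] and [tau]. *)
  pose t n := if n is m.+1 then tau - r / (2 * m.+1%:R) else t1.
  have rn m : 0 < r / (2 * m.+1%:R) by rewrite divr_gt0// mulr_gt0// ltr0n.
  apply: (cantor_not_dnull (A := A) (t := t) xinj).
  - move=> n; apply: Hnb; case: n => [|m] //=.
    by rewrite ltrBlDr ltrDl rn.
  - case=> [//|m] /=; apply: (dnull_divexp_gt N_gt0 psi_decay r0 q_gt0 CB).
    have h : m.+1%:R^-1 * r = 2 * (r / (2 * m.+1%:R)).
      have : m.+1%:R != 0 :> R by rewrite pnatr_eq0.
      by move: m.+1%:R => u u0; field.
    have := rn m; rewrite (mulrDl g) h /tau; move: (r / _) => u. lra.
  - move=> b; have [e|ne] := pselect (divexp psi C (x b) = g%:E).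
      by exists 0%N.
    by have [m Hm] := divexp_neq_gt (xg b) ne; exists m.+1.
(* [dimH] is [-oo] on the empty set. If [tau = 0], then [g] is the maximal exponent and any Cantor
   point attains it; otherwise emptiness would contradict [nS] at exponent 0. *)
have S0 : S <> set0.
  move=> SE; have [tau00|taun] := eqVneq tau 0.
    have : S (x (fun=> false)).
      split => //; apply/eqP; rewrite eq_le xg andbT.
      apply: (le_trans (divexp_le N_gt0 psi_decay _ p_gt0 q_gt0 C_inB)).
      rewrite lee_fin dpE -subr_ge0; move: tau00; rewrite /tau => h.
      have -> : g = d%:R / r - s.
        apply: (mulIf (lt0r_neq0 r0)); rewrite mulrBl divfK ?gt_eqF//; lra.
      lra.
    by rewrite SE.
  have taupos : 0 < tau by rewrite lt_def taun.
  apply: (nS 0 taupos); rewrite SE => eta eta0; exists set0 => //.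
  by rewrite esum_set0 lee_fin ltW.
rewrite /dimH; case: pselect => // ?; apply/eqP; rewrite eq_le; apply/andP; split.
  apply/lee_addgt0Pr => e e0; apply: ereal_inf_lbound; exists (tau + e) => //.
  split; first by rewrite addr_ge0// ltW.
  apply: dnull_hmeasure; first by rewrite ltr_wpDl.
  have er : 0 < e / (2 * r) by rewrite divr_gt0// mulr_gt0.
  apply: (@dnull_sub _ _ _ _ [set x | ((g - e / (2 * r))%:E < divexp psi C x)%E]).
    by move=> z [_ /= ->]; rewrite lte_fin; lra.
  apply: (dnull_divexp_gt N_gt0 psi_decay r0 q_gt0 CB).
  have -> : d%:R - s * r - (g - e / (2 * r)) * r = tau + e / 2.
    by rewrite /tau; field; rewrite gt_eqF.
  lra.
apply: le_ereal_inf_tmp => _ [t [t0 Ht] <-]; rewrite lee_fin leNgt; apply/negP => ttau.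
(* The midpoint is positive even for [t = 0], as [hmeasure_dnull] demands. *)
have h1 : t <= (t + tau) / 2 by lra.
have h2 : (t + tau) / 2 < tau by lra.
have h3 : 0 < (t + tau) / 2 by lra.
exact: nS _ h2 (hmeasure_dnull t0 h1 h3 Ht).
Qed.

Lemma max_divergent_of_good : max_divergent s p psi C [set: pt].
Proof.
have main x : ((- s)%:E <= divexp psi C x <= (d_over d p - s)%:E)%E.
  rewrite (divexp_ge_minus_s C0_gt0 L_scale L_cover d_over_ge0 lo_small x C_good).
  exact: (divexp_le N_gt0 psi_decay x p_gt0 q_gt0 C_inB).
case E : p p_gt0 => [r| |]// _.
- rewrite E in main; split=> //; split.
    rewrite (_ : [set x | _] = [set x | divexp psi C x <> (- s)%:E]).
      exact: lnull_divexp E.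
    by apply/seteqP; split=> [x []|x].
  by move=> B oB B0 _ g; rewrite -E; exact: dimH_divexp.
- move=> x _; apply/eqP; rewrite eq_le; have := main x.
  by rewrite E /= sub0r => /andP[-> ->].
Qed.

End Max_divergence.

(** * The random probe *)

Definition isqrt (j : nat) : nat := \max_(r < j.+1 | (r ^ 2 <= j)%N) r.

Lemma isqrt_le j : (isqrt j ^ 2 <= j)%N.
Proof.
rewrite /isqrt; have [r rj ->] : {r : 'I_j.+1 | (r ^ 2 <= j)%N &
    \max_(r < j.+1 | (r ^ 2 <= j)%N) r = r}.
  by apply: eq_bigmax_cond; apply/card_gt0P; exists ord0; rewrite unfold_in.
exact: rj.
Qed.

Lemma isqrt_ge r j : (r ^ 2 <= j)%N -> (r <= isqrt j)%N.
Proof.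
move=> rj; have rj' : (r < j.+1)%N.
  rewrite ltnS (leq_trans _ rj)//; case: r {rj} => // r.
  by rewrite -{1}(expn1 r.+1) leq_pexp2l.
exact: (@leq_bigmax_cond _ (fun r : 'I_j.+1 => r ^ 2 <= j)%N (fun r => r : nat) (Ordinal rj')).
Qed.

Section SmallLoss.
Context {R : realType}.

Definition log2 (x : R) : R := ln x / ln 2.

Lemma ln2_gt0 : 0 < ln 2 :> R. Proof. by rewrite ln_gt0// ltr1n. Qed.

Lemma pow2_log2 (x : R) : 0 < x -> 2 `^ log2 x = x.
Proof.
move=> x0; rewrite /powR pnatr_eq0/= /log2 divfK ?gt_eqF ?ln2_gt0//.
by rewrite lnK.
Qed.

Lemma log2_small (e : R) : 0 < e -> exists m0, forall m, (m0 <= m)%N ->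
  log2 m.+1%:R <= e * m%:R.
Proof.
move=> e0; pose f := e / 2 * ln 2; have f0 : 0 < f by rewrite mulr_gt0 ?ln2_gt0// divr_gt0.
have [m0 Hm0] := nat_above (1 / f ^+ 2); exists m0 => m /Hm0.
rewrite ltr_pdivrMr ?exprn_gt0// => h.
have ltn0 : 0 < m.+1%:R :> R by rewrite ltr0n.
suff : m.+1%:R <= 2 `^ (e * m%:R) :> R.
  rewrite -{1}(pow2_log2 ltn0); apply: contraTT; rewrite -!ltNge => h'.
  by rewrite /powR pnatr_eq0/= ltr_expR ltr_pM2r// ln2_gt0.
have y1 : 1 + f * m%:R <= 2 `^ (e / 2 * m%:R).
  by rewrite /powR pnatr_eq0/= (_ : e / 2 * m%:R * ln 2 = f * m%:R) ?expR_ge1Dx// /f; ring.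
have -> : 2 `^ (e * m%:R) = 2 `^ (e / 2 * m%:R) * 2 `^ (e / 2 * m%:R) :> R.
  by rewrite -pow2D; congr (_ `^ _); field.
have fm : 0 <= f * m%:R by rewrite mulr_ge0// ltW.
apply: (@le_trans _ _ ((1 + f * m%:R) * (1 + f * m%:R))); last first.
  by apply: ler_pM => //; rewrite addr_ge0.
rewrite -natr1; move: (m%:R : R) h fm (ler0n R m) => x h fm x0; nra.
Qed.

Lemma isqrt_small (e : R) : 0 < e -> exists m0, forall m, (m0 <= m)%N ->
  (isqrt m)%:R <= e * m%:R.
Proof.
move=> e0; have [m0 Hm0] := nat_above (e ^+ 2)^-1; exists m0 => m /Hm0.
rewrite -div1r ltr_pdivrMr ?exprn_gt0// => h.
have : (isqrt m ^ 2)%:R <= m%:R :> R by rewrite ler_nat isqrt_le.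
rewrite natrX; move: (m%:R : R) (ler0n R m) h => x x0 h.
move: ((isqrt m)%:R : R) (ler0n R (isqrt m)) => y y0 yx.
have [ye|ye] := leP (1 / e) y.
  by rewrite ler_pdivrMr// in ye; nra.
by rewrite ltr_pdivlMr// in ye; nra.
Qed.

End SmallLoss.

Section Amplitude.
Context {R : realType} {d N : nat}.
Local Notation pt := (@pt R d).
Local Notation idx := (idx d).
Local Notation Seq := (@Seq R d N).
Variables (s : R) (p q : \bar R).
Variable L : seq ('I_N * nat * idx).
Hypothesis N_gt0 : (0 < N)%N.
Hypothesis p_gt0 : (0 < p)%E.
Hypothesis q_gt0 : (0 < q)%E.

Definition einv (x : \bar R) : R := if x is r%:E then r^-1 else 0.

Lemma einv_ge0 (x : \bar R) : (0 < x)%E -> 0 <= einv x.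
Proof. by case: x => [r| |]//=; rewrite lte_fin => r0; rewrite invr_ge0 ltW. Qed.

Lemma d_overE : d_over d p = d%:R * einv p.
Proof. by case: (p) => [r| |] /=; rewrite ?mulr0. Qed.

Definition boxr (J j : nat) : nat := (j.+1 * 2 ^ J)%N.

Definition boxpos J j (u : {ffun 'I_d -> 'I_(boxr J j).*2.+1}) (k : idx) : idx :=
  subpos J j [ffun i => (u i)%:Z - (boxr J j)%:Z] k.

(* Counts, with weight 2^{-dJ}, the positions of scale j obtained by shifting by
   the covering triplets the corners of the dyadic cubes of scale J <= j in a
   growing box; its 1/p-th power is the saturating profile of the probe. *)
Definition gsum (j : nat) (k : idx) : R :=
  \sum_(J < j.+1) \sum_(l <- L) \sum_(u : {ffun 'I_d -> 'I_(boxr J j).*2.+1})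
     (if k == boxpos u l.2 then 2 `^ (- (d%:R * J%:R)) else 0).

Lemma gsum_ge0 j k : 0 <= gsum j k.
Proof.
apply: sumr_ge0 => J _; apply: sumr_ge0 => l _; apply: sumr_ge0 => u _.
by case: ifP => // _; exact: powR_ge0.
Qed.

Lemma gsum_ge j (J : 'I_j.+1) l u : l \in L ->
  2 `^ (- (d%:R * J%:R)) <= gsum j (@boxpos J j u l.2).
Proof.
move=> lL; rewrite /gsum (bigD1 J)//= (big_rem l lL)/= (bigD1 u)//= eqxx.
rewrite -addrA -addrA lerDl !addr_ge0//.
- by apply: sumr_ge0 => v _; case: ifP => // _; exact: powR_ge0.
- apply: sumr_ge0 => l' _; apply: sumr_ge0 => v _.
  by case: ifP => // _; exact: powR_ge0.
- apply: sumr_ge0 => J' _; apply: sumr_ge0 => l' _; apply: sumr_ge0 => v _.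
  by case: ifP => // _; exact: powR_ge0.
Qed.

Definition gsupp (j : nat) : seq idx :=
  flatten [seq flatten [seq [seq boxpos u l.2 |
     u <- enum {: {ffun 'I_d -> 'I_(boxr J j).*2.+1}}] | l <- L] | J <- iota 0 j.+1].

Lemma gsum_supp j k : k \notin gsupp j -> gsum j k = 0.
Proof.
move=> kn; apply: big1 => J _; apply: big1_seq => l /andP[_ lL].
apply: big1 => u _; case: eqP => // kE; exfalso; move/negP: kn; apply.
apply/flatten_mapP; exists (J : nat); first by rewrite mem_iota /= add0n ltn_ord.
by apply/flatten_mapP; exists l => //; apply/mapP; exists u; rewrite ?mem_enum.
Qed.

Lemma esum_pred1 (T : choiceType) (y : T) (c : R) : 0 <= c ->
  \esum_(k in [set: T]) (if k == y then c else 0)%:E = c%:E.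
Proof.
move=> c0; rewrite -[RHS](@esum_set1 _ _ y (fun=> c%:E)) ?lee_fin//.
rewrite [RHS]esum_mkcond; apply: eq_esum => k _.
by rewrite in_set1; case: eqP.
Qed.

Lemma gsum_esum j : (\esum_(k in [set: idx]) (gsum j k)%:E
  <= ((size L)%:R * 3 ^+ d * j.+1%:R ^+ d.+1)%:E)%E.
Proof.
rewrite (eq_esum (b := fun k => (\sum_(J < j.+1) \sum_(l <- L)
   \sum_(u : {ffun 'I_d -> 'I_(boxr J j).*2.+1})
     (if k == boxpos u l.2 then 2 `^ (- (d%:R * J%:R)) else 0)%:E)%E)); last first.
  move=> k _; rewrite /gsum -sumEFin; apply: eq_bigr => J _.
  by rewrite -sumEFin; apply: eq_bigr => l _; rewrite -sumEFin.
have w0 (k k' : idx) (J : nat) :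
    (0 <= (if k == k' then 2 `^ (- (d%:R * J%:R)) else 0 : R)%:E)%E.
  by rewrite lee_fin; case: ifP => // _; exact: powR_ge0.
rewrite esum_sum; last first.
  by move=> k J _ _; apply: sume_ge0 => l _; apply: sume_ge0 => u _; exact: w0.
apply: (@le_trans _ _ (\sum_(J < j.+1) ((size L)%:R * 3 ^+ d * j.+1%:R ^+ d : R)%:E)%E).
  apply: lee_sum => J _; rewrite esum_sum; last first.
    by move=> k l _ _; apply: sume_ge0 => u _; exact: w0.
  rewrite (eq_bigr (fun=> ((boxr J j).*2.+1%:R ^+ d * 2 `^ (- (d%:R * J%:R)) : R)%:E)); last first.
    move=> l _; rewrite esum_sum; last by move=> k u _ _; exact: w0.
    rewrite (eq_bigr (fun=> (2 `^ (- (d%:R * J%:R)) : R)%:E)); last first.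
      by move=> u _; rewrite esum_pred1// powR_ge0.
    rewrite sumEFin; congr EFin.
    by rewrite sumr_const card_ffun !card_ord -[LHS]mulr_natl natrX.
  rewrite sumEFin lee_fin big_const_seq count_predT iter_addr_0 -[leLHS]mulr_natl.
  rewrite -!mulrA ler_wpM2l//.
  apply: (@le_trans _ _ ((3 * (j.+1%:R * 2 ^+ J)) ^+ d * 2 `^ (- (d%:R * J%:R)))).
    rewrite ler_wpM2r ?powR_ge0// lerXn2r ?nnegrE ?mulr_ge0 ?exprn_ge0//.
    rewrite -natrX -!natrM ler_nat /boxr.
    have : (0 < j.+1 * 2 ^ J)%N by rewrite muln_gt0 expn_gt0.
    by move: (j.+1 * 2 ^ J)%N => A A0; rewrite -muln2; lia.
  rewrite 2!exprMn -!mulrA ler_wpM2l ?exprn_ge0// ler_piMr ?exprn_ge0//.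
  rewrite -natrM powRN powR_mulrn// -exprM mulnC divff ?expf_neq0 ?pnatr_eq0//.
rewrite sumEFin lee_fin sumr_const card_ord -[leLHS]mulr_natl exprS.
by rewrite le_eqVlt; apply/orP; left; apply/eqP; ring.
Qed.

(** [(d + 1) / p] cancels the growth [j ^ (d + 1)] of the total of [gsum]; [2 / q] makes the levels
    summable in [l^q]; the final 1 makes tails vanish also for [q = +oo]. *)
Definition decay_exp : R := d.+1%:R * einv p + 2 * einv q + 1.

(** The test matters for [p = +oo], where [einv p = 0] and the power of a vanishing [gsum] would be
    1. *)
Definition amp (j : nat) (k : idx) : R :=
  if gsum j k == 0 then 0 else
  j.+1%:R `^ (- decay_exp) * 2 `^ ((d_over d p - s) * j%:R) * gsum j k `^ einv p.

Lemma amp_ge0 j k : 0 <= amp j k.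
Proof. by rewrite /amp; case: ifP => // _; rewrite !mulr_ge0 ?powR_ge0. Qed.

Lemma amp_supp j k : k \notin gsupp j -> amp j k = 0.
Proof. by move=> /gsum_supp h; rewrite /amp h eqxx. Qed.

Lemma amp_ge j (J : 'I_j.+1) l u : l \in L ->
  2 `^ ((d_over d p - s) * j%:R - d_over d p * J%:R - decay_exp * log2 j.+1%:R)
   <= amp j (@boxpos J j u l.2).
Proof.
move=> lL; have h := gsum_ge u lL.
have g0 : 0 < gsum j (boxpos u l.2) by rewrite (lt_le_trans _ h)// pow2_gt0.
rewrite /amp gt_eqF//.
have -> : j.+1%:R `^ (- decay_exp) = 2 `^ (- (decay_exp * log2 j.+1%:R)) :> R.
  by rewrite -{1}(pow2_log2 (ltr0Sn R j)) -powRrM mulrN [log2 _ * _]mulrC.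
rewrite -pow2D [X in 2 `^ X](_ : _ =
   - (decay_exp * log2 j.+1%:R) + (d_over d p - s) * j%:R + - (d%:R * J%:R) * einv p).
  rewrite [leLHS]pow2D ler_wpM2l ?powR_ge0// powRrM.
  by apply: ge0_ler_powR; rewrite ?einv_ge0// nnegrE ?powR_ge0// ltW.
by rewrite d_overE; ring.
Qed.

Definition dominated (C : Seq) : Prop := forall i j k, cabs (C i j k) <= amp j k.

Lemma level_dominated : exists2 K : R, 0 < K & forall C, dominated C ->
  forall j, (level s p C j <= (K * j.+1%:R `^ (- (2 * einv q + 1)))%:E)%E.
Proof.
have e0 : 0 <= einv p by exact: einv_ge0.
have q0' : 0 <= einv q by exact: einv_ge0.
pose B : R := N%:R * ((size L)%:R * 3 ^+ d) + 1.
have B0 : 0 < B by rewrite ltr_wpDl// !mulr_ge0// exprn_ge0.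
exists (B `^ einv p); first exact: powR_gt0.
move=> C Cd j; rewrite level_lq; pose y : R := j.+1%:R.
have y1 : 1 <= y by rewrite /y ler1n.
have y0 : 0 < y by exact: lt_le_trans y1.
pose g (ik : 'I_N * idx) : R := y `^ (- decay_exp) * gsum j ik.2 `^ einv p *
  (gsum j ik.2 != 0)%:R.
have wg ik : (wcoef s p C j ik <= (g ik)%:E)%E.
  rewrite lee_fin; apply: (@le_trans _ _ (amp j ik.2 * 2 `^ ((s - d_over d p) * j%:R))).
    by rewrite ler_wpM2r ?powR_ge0.
  rewrite /g /amp; case: eqP => _; first by rewrite mul0r mulr0.
  have e1 : 2 `^ ((d_over d p - s) * j%:R) * 2 `^ ((s - d_over d p) * j%:R) = 1 :> R.
    by rewrite -pow2D (_ : _ + _ = 0) ?powRr0//; ring.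
  rewrite mulr1 -/y mulrAC -(mulrA (y `^ _)) e1 mulr1; exact: lexx.
have g0 ik : 0 <= g ik by rewrite !mulr_ge0 ?powR_ge0.
apply: (le_trans (lq_le p_gt0 (@wcoef_ge0 _ _ _ s p C j) wg)).
have := p_gt0; case E : p => [r| |]//=.
  rewrite lte_fin => r0; have rn0 : r != 0 by rewrite gt_eqF.
  have ei : einv p = r^-1 by rewrite E.
  pose c := y `^ (- decay_exp * r).
  have gr ik : poweR (g ik)%:E r = (c * gsum j ik.2)%:E.
    rewrite poweR_EFin /g; congr EFin; have [->|n0] := eqVneq (gsum j ik.2) 0.
      by rewrite mulr0 powR0// mulr0.
    rewrite mulr1 powRM ?powR_ge0// -!powRrM ei mulVf// powRr1//; exact: gsum_ge0.
  have c0 : 0 <= c by exact: powR_ge0.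
  rewrite (eq_esum (b := fun ik : 'I_N * idx => (c * gsum j ik.2)%:E)); last first.
    by move=> ik _; exact: gr.
  have S : (\esum_(ik in [set: 'I_N * idx]) (c * gsum j ik.2)%:E <=
      (c * (B * y ^+ d.+1))%:E)%E.
    rewrite (_ : [set: 'I_N * idx] = [set: 'I_N] `*`` (fun=> [set: idx])); last first.
      by apply/seteqP; split.
    rewrite -(esum_esum (a := fun (i : 'I_N) (k : idx) => (c * gsum j k)%:E)); last first.
      by move=> i k _ _; rewrite lee_fin mulr_ge0// gsum_ge0.
    apply: (@le_trans _ _ (\esum_(i in [set: 'I_N])
       (c * ((size L)%:R * 3 ^+ d * y ^+ d.+1) : R)%:E)%E).
      apply: le_esum => i _; rewrite EFinM.
      apply: (@le_trans _ _ (c%:E * \esum_(k in [set: idx]) (gsum j k)%:E)%E).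
        apply: (@esumZl R idx setT c (fun k => (gsum j k)%:E) c0) => k.
        by rewrite lee_fin gsum_ge0.
      by apply: lee_wpmul2l; rewrite ?lee_fin//; exact: gsum_esum.
    have Y0 : 0 <= y ^+ d.+1 by rewrite exprn_ge0// ltW.
    rewrite esum_finType; last by move=> i; rewrite lee_fin !mulr_ge0// exprn_ge0.
    rewrite sumEFin lee_fin sumr_const card_ord -[leLHS]mulr_natl.
    by rewrite mulrCA ler_wpM2l// mulrA ler_wpM2r// /B lerDl.
  apply: (@le_trans _ _ (poweR (c * (B * y ^+ d.+1))%:E r^-1)).
    apply: poweR_le => //; first by rewrite invr_ge0 ltW.
    by apply: esum_ge0 => ik _; rewrite lee_fin mulr_ge0// gsum_ge0.
  rewrite poweR_EFin lee_fin powRM ?mulr_ge0 ?exprn_ge0 ?(ltW B0) ?(ltW y0)//.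
  rewrite powRM ?exprn_ge0 ?(ltW B0) ?(ltW y0)//.
  rewrite mulrCA ler_wpM2l ?powR_ge0// -(powR_mulrn _ (ltW y0)) -!powRrM.
  rewrite -powRD; last by rewrite (gt_eqF y0) implybT.
  rewrite le_eqVlt; apply/orP; left; apply/eqP; congr (_ `^ _).
  by rewrite /decay_exp ei; field.
move=> _; have ei : einv p = 0 by rewrite E.
rewrite powRr0 mul1r; apply: ge_ereal_sup => _ [ik _ <-]; rewrite lee_fin /g ei.
rewrite powRr0 mulr1 -[leRHS]mulr1; apply: ler_pM; rewrite ?powR_ge0//.
  by rewrite /decay_exp ei mulr0 add0r.
by case: eqP.
Qed.

(** A uniform rate for the tails: this is what makes the probe continuous in its bits, hence its
    range compact. *)
Lemma bnorm_dominated : exists K th : R, [/\ 0 < K, 0 < th & forall C j1,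
  dominated C -> (forall i j k, (j < j1)%N -> C i j k = 0) ->
  (bnorm s p q C <= (K * j1.+1%:R `^ (- th))%:E)%E].
Proof.
have [K K0 HK] := level_dominated.
have y0 j : 0 < j.+1%:R :> R by rewrite ltr0n.
have lvl0 (C : Seq) j : (forall i k, C i j k = 0) -> level s p C j = 0%E.
  move=> C0; apply/eqP; rewrite eq_le level_ge0// andbT level_lq.
  apply: (@le_trans _ _ (lq p (fun _ : 'I_N * idx => 0%E : \bar R))).
    apply: lq_le => //; first by move=> ik; exact: wcoef_ge0.
    by move=> ik; rewrite /wcoef C0 /cabs ComplexField.Normc.normc0 mul0r.
  move: (p) p_gt0; clear; case=> [r| |] h0.
  - rewrite lte_fin in h0; rewrite /lq esum1 ?poweR0r ?invr_eq0 ?gt_eqF//.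
  - by rewrite /lq; apply: ge_ereal_sup => _ [? _ <-].
  - by [].
have := q_gt0; case E : q => [r| |]//=.
  rewrite lte_fin => r0; have ei : einv q = r^-1 by rewrite E.
  exists ((K `^ r * 2) `^ r^-1), r^-1; split; rewrite ?invr_gt0 ?powR_gt0 ?mulr_gt0 ?powR_gt0//.
  move=> C j1 Cd C0.
  (* Telescoping majorant, from [1 / (j + 1)^2 <= 2 / ((j + 1) (j + 2))]. *)
  pose u j : R := K `^ r * 2 / j.+1%:R.
  have u0 j : 0 <= u j by rewrite divr_ge0// mulr_ge0// powR_ge0.
  have uS j : u j - u j.+1 = K `^ r * 2 / (j.+1%:R * j.+2%:R).
    rewrite /u -[j.+2%:R]natr1; move: (y0 j); move: (j.+1%:R : R) => y yp.
    by field; rewrite !gt_eqF// addr_gt0.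
  have S : (\esum_(j in [set: nat]) poweR (level s p C j) r <= (u j1)%:E)%E.
    apply: le_trans (esum_telescope j1 u0 _); last first.
      move=> j; rewrite -subr_ge0 uS divr_ge0 ?mulr_ge0 ?powR_ge0//.
    rewrite [leRHS]esum_mkcond; apply: le_esum => j _.
    case: ifPn => [_|]; last first.
      rewrite notin_setE /= => /negP; rewrite -ltnNge => jj.
      by rewrite lvl0 ?poweR0r ?gt_eqF// => i k; exact: C0.
    apply: (@le_trans _ _ (poweR (K * j.+1%:R `^ (- (2 * einv q + 1)))%:E r)).
      by apply: poweR_le; rewrite ?(ltW r0) ?level_ge0//; exact: HK.
    rewrite poweR_EFin lee_fin powRM ?powR_ge0 ?(ltW K0)// uS -mulrA.
    rewrite ler_wpM2l ?powR_ge0// -powRrM ei.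
    apply: (@le_trans _ _ (j.+1%:R `^ (- 2%:R))).
      apply: ler_powR; first by rewrite ler1n.
      have -> : - (2 * r^-1 + 1) * r = - 2 - r by field; rewrite gt_eqF.
      lra.
    rewrite powR_invn// -div1r ler_pdivrMr ?exprn_gt0// mulrAC ler_pdivlMr ?mulr_gt0//.
    rewrite mul1r -[j.+2%:R]natr1.
    have : 1 <= j.+1%:R :> R by rewrite ler1n.
    by move: (j.+1%:R : R) => y y1; nra.
  apply: (@le_trans _ _ (poweR (u j1)%:E r^-1)).
    apply: poweR_le => //; first by rewrite invr_ge0 ltW.
    by apply: esum_ge0 => *; exact: poweR_ge0.
  rewrite poweR_EFin lee_fin /u powRM ?mulr_ge0 ?powR_ge0 ?invr_ge0//.
  have -> : j1.+1%:R^-1 `^ r^-1 = j1.+1%:R `^ (- r^-1) :> R.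
    by rewrite -(powR_inv1 (ltW (y0 j1))) -powRrM mulN1r.
  exact: lexx.
move=> _; exists K, 1; split=> // C j1 Cd C0.
have ei : einv q = 0 by rewrite E.
apply: ge_ereal_sup => _ [j _ <-]; have [jj|jj] := ltnP j j1.
  rewrite lvl0; first by rewrite lee_fin mulr_ge0 ?powR_ge0// ltW.
  by move=> i k; exact: C0.
apply: (le_trans (HK _ Cd j)); rewrite lee_fin ei mulr0 add0r.
rewrite ler_wpM2l ?(ltW K0)// !powRN !powRr1 ?lef_pV2 ?posrE ?ltr0n//.
by rewrite ler_nat ltnS.
Qed.

End Amplitude.

(** * Binary words and compactness *)

Lemma binsum_inj m (b b' : nat -> bool) :
  (\sum_(e < m) b e * 2 ^ e = \sum_(e < m) b' e * 2 ^ e)%N ->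
  forall e, (e < m)%N -> b e = b' e.
Proof.
elim: m b b' => [//|m IH] b b'; rewrite !big_ord_recl !muln1.
have sh (c : nat -> bool) : (\sum_(i < m) c (lift ord0 i) * 2 ^ lift ord0 i =
    (\sum_(i < m) c i.+1 * 2 ^ i) * 2)%N.
  rewrite big_distrl/=; apply: eq_bigr => i _.
  by rewrite -mulnA -expnSr.
rewrite !sh; set S := (\sum_(i < m) b i.+1 * 2 ^ i)%N.
set S' := (\sum_(i < m) b' i.+1 * 2 ^ i)%N => h.
have [h0 hS] : b 0%N = b' 0%N /\ S = S'.
  by move: h; clear; case: (b 0%N); case: (b' 0%N) => /= h; split=> //; lia.
by case=> [//|e]; rewrite ltnS; exact: (IH (fun i => b i.+1) (fun i => b' i.+1)).
Qed.

Lemma binsum_lt m (b : nat -> bool) : (\sum_(e < m) b e * 2 ^ e < 2 ^ m)%N.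
Proof.
elim: m => [|m IH]; first by rewrite big_ord0.
rewrite big_ord_recr/= expnS mul2n -addnn; case: (b m); rewrite ?mul1n ?mul0n.
  by rewrite ltn_add2r.
by rewrite addn0 ltn_addl.
Qed.

(** Compactness of the Cantor space by König's lemma: a word whose cylinder has no finite subcover
    has a one-letter extension with the same defect, and the infinite branch [c] so obtained
    contradicts the local hypothesis. *)
Lemma konig_cover (E : Type) (Phi : (nat -> bool) -> E) (G : set (set E)) :
  (forall c, exists2 U, G U & exists M, forall c',
     (forall n, (n < M)%N -> c' n = c n) -> U (Phi c')) ->
  exists2 F : seq (set E), {subset F <= G} &
    range Phi `<=` \bigcup_(U in [set` F]) U.
Proof.
move=> loc.
pose ext (c : nat -> bool) (a : seq bool) :=
  forall n, (n < size a)%N -> c n = nth false a n.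
pose good a := exists2 F : seq (set E), {subset F <= G} &
  forall c, ext c a -> exists2 U, U \in F & U (Phi c).
suff : good [::].
  by move=> [F FG HF]; exists F => // _ [c _ <-]; have [//|U] := HF c; exists U.
apply: contrapT => bad0.
have step a : exists c, ~ good a -> ~ good (rcons a c).
  have [gf|bf] := pselect (good (rcons a false)); last by exists false.
  have [gt|bt] := pselect (good (rcons a true)); last by exists true.
  exists false => bad; exfalso; apply: bad.
  have [F FG HF] := gf; have [F' FG' HF'] := gt; exists (F ++ F').
    by move=> U; rewrite mem_cat => /orP[/FG|/FG'].
  move=> c ca; case E1 : (c (size a)).
    have [n|U UF ?] := HF' c; last by exists U => //; rewrite mem_cat UF orbT.
    rewrite size_rcons nth_rcons ltnS => na; case: ltngtP na => // [na _|-> _].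
      exact: ca.
    exact: E1.
  have [n|U UF ?] := HF c; last by exists U => //; rewrite mem_cat UF.
  rewrite size_rcons nth_rcons ltnS => na; case: ltngtP na => // [na _|-> _].
    exact: ca.
  exact: E1.
have [f Hf] := choice step.
pose pa := fix pa n := if n is m.+1 then rcons (pa m) (f (pa m)) else [::].
pose c n := f (pa n).
have paE n : pa n = mkseq c n.
  by elim: n => [//|n IH] /=; rewrite mkseqS -IH.
have bad n : ~ good (pa n) by elim: n => [//|n IH] /=; exact: Hf.
have [U GU [M HM]] := loc c; apply: (bad M); exists [:: U].
  by move=> V; rewrite inE => /eqP->; rewrite in_setE.
move=> c' c'M; exists U; first by rewrite inE.
apply: HM => n nM; have := c'M n; rewrite paE size_mkseq nth_mkseq//; exact.
Qed.

Lemma cabs_realB (R : realType) (x y : R) : cabs (x%:C - y%:C)%C = `|x - y|.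
Proof. by rewrite -cabs_real; congr cabs; rewrite rmorphB. Qed.

Section Probe.
Context {R : realType} {d N : nat}.
Local Notation pt := (@pt R d).
Local Notation idx := (idx d).
Local Notation Seq := (@Seq R d N).
Variables (s : R) (p q : \bar R).
Variable L : seq ('I_N * nat * idx).
Variable c0 : nat.
Hypothesis N_gt0 : (0 < N)%N.
Hypothesis p_gt0 : (0 < p)%E.
Hypothesis q_gt0 : (0 < q)%E.
Local Notation amp := (amp s p q L).

(** At scales [j >= r ^ 2] this is at least [c0 * r], and it is still [o(j)]. *)
Definition nbits (j : nat) : nat := (c0 * isqrt j)%N.

(** [pickle] gives different coefficients disjoint sets of bits, which makes them independent. *)
Definition bitpos (i : 'I_N) (j : nat) (k : idx) (e : nat) : nat :=
  pickle (i, j, k, e).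

Definition xi (b : nat -> bool) (i : 'I_N) (j : nat) (k : idx) : nat :=
  (\sum_(e < nbits j) b (bitpos i j k e) * 2 ^ e)%N.

Definition probe (b : nat -> bool) : Seq := fun i j k =>
  (amp j k * (xi b i j k)%:R / 2 ^+ nbits j)%:C%C.

Lemma cabs_probe_sub b b' i j k : cabs (probe b i j k - probe b' i j k) =
  amp j k * `|(xi b i j k)%:R - (xi b' i j k)%:R| / 2 ^+ nbits j.
Proof.
rewrite /probe cabs_realB -mulrBl -mulrBr !normrM.
rewrite (ger0_norm (amp_ge0 _ _ _ _ _ _)); congr (_ * _).
by rewrite ger0_norm// invr_ge0 exprn_ge0.
Qed.

Lemma dominated_probe_sub b b' :
  dominated s p q L (ssub (probe b) (probe b')).
Proof.
move=> i j k; rewrite /ssub cabs_probe_sub ler_pdivrMr ?exprn_gt0//.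
rewrite ler_wpM2l ?amp_ge0//.
have lt (c : nat -> bool) : (xi c i j k)%:R <= 2 ^+ nbits j :> R.
  by rewrite -natrX ler_nat ltnW// (binsum_lt _ (fun e => c (bitpos i j k e))).
have := lt b; have := lt b'; have := ler0n R (xi b i j k).
have := ler0n R (xi b' i j k); rewrite ler_norml => ? ? ? ?.
by apply/andP; split; lra.
Qed.

Lemma probe0 : probe (fun=> false) = (fun _ _ _ => 0).
Proof.
apply/funext => i; apply/funext => j; apply/funext => k; rewrite /probe /xi.
by rewrite big1// mulr0 mul0r.
Qed.

Lemma probe_inB b : inB s p q (probe b).
Proof.
have [K [th [K0 th0 HK]]] := bnorm_dominated s L N_gt0 p_gt0 q_gt0.
apply: le_lt_trans (ltry _); apply: (HK _ 0%N) => //.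
have := @dominated_probe_sub b (fun=> false).
by rewrite (_ : ssub _ _ = probe b)// /ssub probe0; apply/funext => i;
  apply/funext => j; apply/funext => k; rewrite subr0.
Qed.

(** [amp] has finite support at each scale, so the coefficients below scale [j1] read finitely many
    bits. *)
Lemma probe_local j1 : exists M, forall b b',
  (forall n, (n < M)%N -> b' n = b n) ->
  forall i j k, (j < j1)%N -> probe b' i j k = probe b i j k.
Proof.
pose P : seq nat := flatten [seq flatten [seq flatten [seq [seq bitpos i j k e |
  e <- iota 0 (nbits j)] | k <- gsupp L j] | i <- enum 'I_N] | j <- iota 0 j1].
exists (\max_(n <- P) n).+1 => b b' bb' i j k jj; rewrite /probe.
have [kj|kj] := boolP (k \in gsupp L j); last by rewrite amp_supp// !mul0r.
suff -> : xi b' i j k = xi b i j k by [].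
apply: eq_bigr => e _; rewrite bb'// ltnS.
apply: (@leq_bigmax_seq _ _ xpredT id) => //.
apply/flatten_mapP; exists j; first by rewrite mem_iota.
apply/flatten_mapP; exists i; first by rewrite mem_enum.
apply/flatten_mapP; exists k => //; apply/mapP; exists (e : nat) => //.
by rewrite mem_iota /= add0n.
Qed.

Lemma probe_open (U : set Seq) b : openB s p q U -> U (probe b) ->
  exists M, forall b', (forall n, (n < M)%N -> b' n = b n) -> U (probe b').
Proof.
move=> [_ oU] Ub; have [r r0 Hr] := oU _ Ub.
have [K [th [K0 th0 HK]]] := bnorm_dominated s L N_gt0 p_gt0 q_gt0.
have [j1 Hj1] : exists j1, K * j1.+1%:R `^ (- th) < r.
  have [m Hm] := @nat_above R ((K / r) `^ th^-1); exists m.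
  have y0 : 0 < m.+1%:R :> R by rewrite ltr0n.
  have := Hm m.+1 (leqnSn _) => h.
  rewrite powRN ltr_pdivrMr ?powR_gt0// mulrC -ltr_pdivrMr//.
  have Kr : 0 <= K / r by rewrite divr_ge0// ltW.
  have := @gt0_ltr_powR R th th0 _ _ _ _ h; rewrite !nnegrE powR_ge0 => /(_ isT (ltW y0)).
  by rewrite -powRrM mulVf ?gt_eqF// powRr1.
have [M HM] := probe_local j1; exists M => b' bb'; apply: Hr; split.
  exact: probe_inB.
apply: (@le_lt_trans _ _ (K * j1.+1%:R `^ (- th))%:E); last by rewrite lte_fin.
apply: HK; first exact: dominated_probe_sub.
by move=> i j k jj; rewrite /ssub (HM b b')// subrr.
Qed.

Lemma probe_compact : compactB s p q (range probe).
Proof.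
split=> [_ [b _ <-]|G Gop Gcov]; first exact: probe_inB.
apply: konig_cover => c.
have [|U GU Uc] := Gcov (probe c); first by exists c.
by exists U => //; exact: probe_open (Gop _ GU) Uc.
Qed.

(** The values at one coefficient are spaced by [amp j k / 2 ^+ nbits j]; at most one lies within
    half of that from [z], and it determines the bits. *)
Lemma probe_near_bits (z : R[i]) b b' i j k :
  cabs (probe b i j k - z) < amp j k / (2 * 2 ^+ nbits j) ->
  cabs (probe b' i j k - z) < amp j k / (2 * 2 ^+ nbits j) ->
  forall e, (e < nbits j)%N -> b (bitpos i j k e) = b' (bitpos i j k e).
Proof.
move=> h1 h2.
have P : 0 < 2 ^+ nbits j :> R by rewrite exprn_gt0.
have : cabs (probe b i j k - probe b' i j k) < amp j k / 2 ^+ nbits j.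
  rewrite (_ : probe b i j k - probe b' i j k =
     (probe b i j k - z) + - (probe b' i j k - z)); last by ring.
  apply: (le_lt_trans (cabs_triangle _ _)); rewrite cabsN.
  apply: (lt_le_trans (ltrD h1 h2)); rewrite le_eqVlt; apply/orP; left; apply/eqP.
  by field; rewrite gt_eqF.
rewrite cabs_probe_sub ltr_pM2r ?invr_gt0// => h.
have A0 : 0 < amp j k.
  rewrite lt_def amp_ge0 andbT; apply/eqP => A0.
  by move: h; rewrite A0 mul0r ltxx.
rewrite -[ltRHS]mulr1 ltr_pM2l// in h.
have xx : xi b i j k = xi b' i j k.
  move: h; rewrite ltr_norml => /andP[x1 x2].
  have : (xi b i j k)%:R < (xi b' i j k).+1%:R :> R by rewrite -natr1; lra.
  have : (xi b' i j k)%:R < (xi b i j k).+1%:R :> R by rewrite -natr1; lra.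
  rewrite !ltr_nat !ltnS => l1 l2; apply/eqP; rewrite eqn_leq l1 l2//.
exact: (binsum_inj (b := fun e => b (bitpos i j k e)) (b' := fun e => b' (bitpos i j k e))).
Qed.

End Probe.

(** * Almost sure largeness *)

Section MeasurableGood.
Context {R : realType} {d N : nat} {dd : measure_display} {T : measurableType dd}.
Local Notation Seq := (@Seq R d N).
Variables (s dp : R) (lo : nat -> R) (L : seq ('I_N * nat * idx d)) (J0 : nat).
Variable X : T -> Seq.
Hypothesis mX : forall i j k (v : R), measurable [set w | v <= cabs (X w i j k)].

Lemma measurable_window r : measurable [set w | window_ok s dp lo L J0 (X w) r].
Proof.
apply: measurable_forall => H; apply: measurable_forall => j0.
apply: measurable_forall => v; do 3 apply: measurable_imp.
rewrite (_ : [set w | _] = [set w | exists t : nat, (t < r)%N /\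
    trial_ok s dp lo L (X w) (minn H (trial_scale J0 j0 t)) (trial_scale J0 j0 t)
    (anc H (minn H (trial_scale J0 j0 t)) v)]); last first.
  by apply/seteqP; split=> w /= [t]; [exists t|case=> ? ?; exists t].
apply: measurable_exists => t; apply: measurable_and.
apply: measurable_forall => l; apply: measurable_imp; exact: mX.
Qed.

Lemma measurable_good : measurable [set w | good_seq s dp lo L J0 (X w)].
Proof.
apply: measurable_forall => r0.
rewrite (_ : [set w | _] = [set w | exists r : nat, (r0 <= r)%N /\
    window_ok s dp lo L J0 (X w) r]); last first.
  by apply/seteqP; split=> w /= [r]; [exists r|case=> ? ?; exists r].
apply: measurable_exists => r; apply: measurable_and; exact: measurable_window.
Qed.

End MeasurableGood.

Lemma natrX_int (a n : nat) : (a ^ n)%N%:Z = a%:Z ^+ n.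
Proof. by rewrite -!natz natrX. Qed.

Section BadWindow.
Context {R : realType} {d N : nat}.
Local Notation pt := (@pt R d).
Local Notation idx := (idx d).
Local Notation Seq := (@Seq R d N).
Variables (s : R) (p q : \bar R).
Variables (L : seq ('I_N * nat * idx)) (J0 : nat).
Hypothesis N_gt0 : (0 < N)%N.
Hypothesis p_gt0 : (0 < p)%E.
Hypothesis q_gt0 : (0 < q)%E.
Hypothesis L_scale : forall l, l \in L -> (1 <= l.1.2 <= J0)%N.

(* Entropy of the set of trials in the r-th window is at most
   [entropy_rate * r ^ 2], so one more unit in the number of bits makes the
   union bound summable. *)
Definition entropy_rate : nat := (J0 + 4 + d * (4 + J0) + size L)%N.

Local Notation c0 := entropy_rate.+1.
Local Notation amp := (amp s p q L).
Local Notation nbits := (nbits c0).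
Local Notation probe := (probe s p q L c0).

(** The polynomial factor in [amp], the resolution of the probe, and the factor 2 of the half
    spacing. *)
Definition loss (j : nat) : R :=
  decay_exp (d := d) p q * log2 j.+1%:R + (nbits j)%:R + 1.

Lemma loss_small e : 0 < e -> exists m0, forall m, (m0 <= m)%N ->
  loss m <= e * m%:R.
Proof.
move=> e0; have e3 : 0 < e / 3 by rewrite divr_gt0.
have D0 : 0 < decay_exp (d := d) p q.
  by rewrite /decay_exp ltr_wpDl// addr_ge0 ?mulr_ge0 ?einv_ge0.
have [m1 H1] := @log2_small R _ (divr_gt0 e3 D0).
have [m2 H2] := @isqrt_small R _ (divr_gt0 e3 (ltr0Sn R entropy_rate)).
have [m3 H3] := @nat_above R (e / 3)^-1.
exists (m1 + m2 + m3)%N => m mm.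
have [{}mm1 mm2 mm3] : [/\ (m1 <= m)%N, (m2 <= m)%N & (m3 <= m)%N].
  by clear -mm; split; lia.
have {}H1 := H1 m mm1; have {}H2 := H2 m mm2; have {}H3 := H3 m mm3.
have l1 : decay_exp (d := d) p q * log2 m.+1%:R <= e / 3 * m%:R.
  rewrite mulrAC ler_pdivlMr// in H1; by rewrite mulrC.
have l2 : (nbits m)%:R <= e / 3 * m%:R.
  rewrite /nbits natrM mulrAC ler_pdivlMr ?ltr0Sn// in H2 *; by rewrite mulrC.
have l3 : 1 <= e / 3 * m%:R.
  by rewrite -ler_pdivrMl// mulr1 ltW.
rewrite /loss (_ : e * m%:R = e / 3 * m%:R + e / 3 * m%:R + e / 3 * m%:R); last by field.
by rewrite !lerD.
Qed.

(** Brings the threshold below the half spacing of the probe, so that [probe_near_bits] applies to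
    the coefficient of a failed trial. *)
Lemma vthr_le_amp l J j (K : idx) : l \in L -> (J <= j)%N ->
  (forall i, `|K i| <= (boxr J j)%:Z) ->
  vthr s (d_over d p) loss J j <= amp j (subpos J j K l.2) / (2 * 2 ^+ nbits j).
Proof.
move=> lL Jj KB; pose u : {ffun 'I_d -> 'I_(boxr J j).*2.+1} :=
  [ffun i => inord `|(K i + (boxr J j)%:Z)%R|%N].
have uE i : u i = `|(K i + (boxr J j)%:Z)%R|%N :> nat.
  have := KB i; rewrite [u i]ffunE => h; rewrite inordK//; clear -h; lia.
have -> : subpos J j K l.2 = boxpos u l.2.
  rewrite /boxpos; congr subpos; apply/ffunP => i; rewrite [RHS]ffunE uE.
  move: (KB i); move: (K i) (boxr J j) => a b h; clear -h.
  rewrite gez0_abs; lia.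
have := @amp_ge R d N s p q L p_gt0 j (Ordinal (Jj : (J < j.+1)%N)) l u lL.
rewrite /= => h; rewrite ler_pdivlMr ?mulr_gt0 ?exprn_gt0//.
apply: le_trans h; rewrite /vthr /loss.
rewrite (_ : 2 * 2 ^+ nbits j = 2 `^ (1 + (nbits j)%:R) :> R); last first.
  by rewrite pow2D powRr1// pow2_nat.
by rewrite -pow2D; apply: pow2_le; lra.
Qed.

Variable r : nat.
Hypothesis r_gt0 : (0 < r)%N.

Definition wbox : nat := (r * 2 ^ (r ^ 2 + r * J0))%N.

(** Finite certificate of a failed window: offsets of [H] and [j0] from [r ^ 2], the cube index, and
    for each trial a triplet whose coefficient is too small. *)
Definition wtrial : finType :=
  ('I_(r * J0).+1 * 'I_(r ^ 4).+1 * {ffun 'I_d -> 'I_wbox.*2.+1} *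
   {ffun 'I_r -> 'I_(size L)})%type.

Section Positions.
Variable I : wtrial.
Definition wH : nat := (r ^ 2 + I.1.1.1)%N.
Definition wj0 : nat := (r ^ 2 + I.1.1.2)%N.
Definition wv : idx := [ffun i => (I.1.2 i)%:Z - wbox%:Z].
Definition wl (t : 'I_r) := tnth (in_tuple L) (I.2 t).
Definition wJ (t : nat) : nat := minn wH (trial_scale J0 wj0 t).
Definition wj (t : 'I_r) : nat := (trial_scale J0 wj0 t + (wl t).1.2)%N.
Definition wk (t : 'I_r) : idx := subpos (wJ t) (wj t) (anc wH (wJ t) wv) (wl t).2.
Definition wbits : seq nat := [seq bitpos (wl t).1.1 (wj t) (wk t) e |
  t <- enum 'I_r, e <- iota 0 (nbits (wj t))].

Lemma wl_in t : wl t \in L. Proof. exact: mem_tnth. Qed.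

Lemma wj_ge t : (r ^ 2 <= wj t)%N.
Proof. by rewrite /wj /trial_scale /wj0 -!addnA leq_addr. Qed.

(** A triplet shifts the scale by at least 1 and at most the spacing [J0] of the trials. Different
    trials therefore read disjoint bits. *)
Lemma wj_lt (t t' : 'I_r) : (t < t')%N -> (wj t < wj t')%N.
Proof.
move=> tt'; have /andP[_ h1] := L_scale (wl_in t).
have /andP[h2 _] := L_scale (wl_in t').
have key (a x y m m' J : nat) : (m <= J)%N -> (0 < m')%N -> (J + x <= y)%N ->
    (a + x + m < a + y + m')%N by clear; lia.
by apply: key h1 h2 _; rewrite -mulSn leq_mul2r tt' orbT.
Qed.

Lemma wj_inj : injective wj.
Proof.
move=> t t' e; apply: val_inj => /=.
case: (ltngtP (t : nat) t') => // /wj_lt; by rewrite e ltnn.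
Qed.

Lemma wbits_uniq : uniq wbits.
Proof.
apply: allpairs_uniq_dep; first exact: enum_uniq.
  by move=> t _; exact: iota_uniq.
move=> [t e] [t' e'] _ _ /= /(pcan_inj pickleK) [_ h _ ee].
by have tt := wj_inj h; rewrite tt ee.
Qed.

Lemma wbits_size : (c0 * r ^ 2 <= size wbits)%N.
Proof.
rewrite size_allpairs_dep sumnE big_map big_enum /=.
apply: (@leq_trans (\sum_(t < r) c0 * r)).
  by rewrite sum_nat_const card_ord mulnCA mulnn.
apply: leq_sum => t _; rewrite size_iota /nbits leq_mul2l; apply/orP; right.
by apply: isqrt_ge; exact: wj_ge.
Qed.

End Positions.

Variable f : Seq.

Definition near_f (b : nat -> bool) i j k : Prop :=
  cabs (probe b i j k - f i j k) < amp j k / (2 * 2 ^+ nbits j).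

(** One [a], depending on [f] but not on the certificate, suffices: it stores for each coefficient
    the bits of a probe value near [f], if there is one. A coefficient that fails is near [f] too,
    hence has the same bits. *)
Lemma bad_window_bits : exists a : nat -> bool, forall b,
  ~ window_ok s (d_over d p) loss L J0 (ssub (probe b) f) r ->
  exists I : wtrial, forall n, n \in wbits I -> b n = a n.
Proof.
have href (z : 'I_N * nat * idx) : exists b : nat -> bool,
    (exists b', near_f b' z.1.1 z.1.2 z.2) -> near_f b z.1.1 z.1.2 z.2.
  have [[b nb]|n] := pselect (exists b', near_f b' z.1.1 z.1.2 z.2); first by exists b.
  by exists (fun=> false) => /n.
have [ref Href] := choice href.
exists (fun n => if (pickle_inv n : option ('I_N * nat * idx * nat)) is Some z
  then ref z.1 n else false) => b nok.
have [H [j0 [v [[/andP[H1 H2] /andP[j1 j2] vB] bad]]]] : exists H j0 (v : idx),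
  [/\ (r ^ 2 <= H <= r ^ 2 + r * J0)%N, (r ^ 2 <= j0 <= r ^ 4)%N &
    (forall i, `|v i| <= r%:Z * 2 ^+ H)] /\ forall t, (t < r)%N ->
    ~ trial_ok s (d_over d p) loss L (ssub (probe b) f)
      (minn H (trial_scale J0 j0 t)) (trial_scale J0 j0 t)
      (anc H (minn H (trial_scale J0 j0 t)) v).
  apply: contrapT => none; apply: nok => H j0 v hH hj hv.
  apply: contrapT => nt; apply: none; exists H, j0, v; split=> // t tr ok.
  by apply: nt; exists t.
have hl (t : 'I_r) : exists m : 'I_(size L),
    cabs (ssub (probe b) f (tnth (in_tuple L) m).1.1
      (trial_scale J0 j0 t + (tnth (in_tuple L) m).1.2)%N
      (subpos (minn H (trial_scale J0 j0 t))
        (trial_scale J0 j0 t + (tnth (in_tuple L) m).1.2)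
        (anc H (minn H (trial_scale J0 j0 t)) v) (tnth (in_tuple L) m).2)) <
    vthr s (d_over d p) loss (minn H (trial_scale J0 j0 t))
       (trial_scale J0 j0 t + (tnth (in_tuple L) m).1.2).
  apply: contrapT => none; apply: (bad t (ltn_ord t)) => l lL.
  rewrite leNgt; apply/negP => h; apply: none.
  have [m lm] := tnthP (in_tuple L) l lL.
  by exists m; rewrite -lm.
have [lam Hlam] := choice hl.
have vB' i : `|v i| <= wbox%:Z.
  apply: (le_trans (vB i)); rewrite /wbox PoszM ler_wpM2l//.
  by rewrite -natrX_int lez_nat leq_pexp2l.
have hH : (H - r ^ 2 < (r * J0).+1)%N by rewrite ltnS leq_subLR.
have hj : (j0 - r ^ 2 < (r ^ 4).+1)%N.
  by rewrite ltnS (leq_trans (leq_subr _ _)).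
pose u : {ffun 'I_d -> 'I_wbox.*2.+1} := [ffun i => inord `|(v i + wbox%:Z)%R|%N].
have uE i : u i = `|(v i + wbox%:Z)%R|%N :> nat.
  have := vB' i; rewrite [u i]ffunE => h; rewrite inordK//; clear -h; lia.
pose I : wtrial := ((Ordinal hH, Ordinal hj), u, [ffun t => lam t]).
have IH : wH I = H by rewrite /wH /= subnKC.
have Ij0 : wj0 I = j0 by rewrite /wj0 /= subnKC.
have Iv : wv I = v.
  apply/ffunP => i; rewrite [LHS]ffunE /= uE; move: (vB' i); move: (v i) wbox => x y h.
  clear -h; rewrite gez0_abs; lia.
have Il t : wl I t = tnth (in_tuple L) (lam t) by rewrite /wl /= ffunE.
exists I => n /allpairsPdep[t [e [_ eb ->]]].
rewrite mem_iota /= add0n in eb.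
rewrite /bitpos pickleK_inv /=.
have nb : near_f b (wl I t).1.1 (wj I t) (wk I t).
  have := Hlam t; rewrite -Il -IH -Ij0 -[v]Iv -/(wJ I t) -/(wj I t) -/(wk I t).
  move=> h; apply: (lt_le_trans h); apply: vthr_le_amp; first exact: wl_in.
    by apply: (leq_trans (geq_minr _ _)); exact: leq_addr.
  move=> i; rewrite [anc _ _ _ i]ffunE IH Iv.
  have JH : (wJ I t <= H)%N by rewrite -IH geq_minl.
  have := vB i; rewrite -{1}(subnK JH) exprD => hv.
  have E0 : 0 < 2 ^+ (H - wJ I t) :> int by rewrite exprn_gt0.
  have rb : (r * 2 ^ wJ I t <= boxr (wJ I t) (wj I t))%N.
    rewrite /boxr leq_mul2r; apply/orP; right; rewrite leqW//.
    apply: leq_trans (wj_ge I t); rewrite -{1}(expn1 r) leq_pexp2l//.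
  apply: (@le_trans _ _ (r * 2 ^ wJ I t)%N%:Z); last by rewrite lez_nat.
  rewrite PoszM (natrX_int 2).
  move: hv E0; rewrite mulrCA; move: (2 ^+ (H - wJ I t)) (r%:Z * 2 ^+ wJ I t) => D B hv D0.
  move: hv; rewrite !ler_norml => /andP[v1 v2]; apply/andP; split.
    by rewrite lez_divRL// mulNr mulrC.
  apply: (le_trans (lez_pdiv2r (ltW D0) v2)).
  by rewrite mulKz ?lt0r_neq0.
have nr : near_f (ref ((wl I t).1.1, wj I t, wk I t)) (wl I t).1.1 (wj I t) (wk I t).
  by apply: (Href ((wl I t).1.1, wj I t, wk I t)); exists b.
exact: probe_near_bits nb nr e eb.
Qed.

End BadWindow.

(** The four factors count [H], [j0], the cube index and the failing triplets; each is bounded by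
    the power of two of one summand of the exponent. *)
Lemma trial_count (d J0 l r : nat) : (0 < r)%N ->
  ((r * J0).+1 * (r ^ 4).+1 * ((r * 2 ^ (r ^ 2 + r * J0)).*2.+1) ^ d * l ^ r
   <= 2 ^ ((J0 + 4 + d * (4 + J0) + l) * r ^ 2))%N.
Proof.
move=> r0; have rr : (r <= r ^ 2)%N by rewrite -{1}(expn1 r) leq_pexp2l.
rewrite (_ : ((J0 + 4 + d * (4 + J0) + l) * r ^ 2 = J0 * r ^ 2 + 4 * r ^ 2 +
    (4 + J0) * r ^ 2 * d + l * r ^ 2)%N); last first.
  by rewrite mulnDl mulnDl mulnDl; congr (_ + _ + _)%N; rewrite mulnAC mulnC mulnA mulnAC [(_ * d)%N]mulnC mulnA.
have e4 x y z t : (2 ^ (x + y + z + t) = 2 ^ x * 2 ^ y * 2 ^ z * 2 ^ t)%N.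
  by rewrite 3!expnD.
rewrite e4; apply: leq_mul; [apply: leq_mul; [apply: leq_mul|]|].
- apply: (leq_trans (ltn_expl (r * J0) (ltnSn 1))).
  by rewrite leq_pexp2l// mulnC leq_mul2l rr orbT.
- apply: (@leq_trans (2 ^ (4 * r))); last by rewrite leq_pexp2l// leq_mul2l rr orbT.
  by rewrite mulnC expnM ltn_exp2r// ltn_expl.
- rewrite expnM; case: d => [|d]; rewrite ?expn0// leq_exp2r//.
  set X := (r ^ 2 + r * J0)%N.
  apply: (@leq_trans (2 ^ (r + X).+1)).
    have : (r * 2 ^ X < 2 ^ (r + X))%N by rewrite expnD ltn_pmul2r ?expn_gt0// ltn_expl.
    by rewrite expnS; move: (r * 2 ^ X)%N (2 ^ (r + X))%N; clear; lia.
  rewrite leq_pexp2l// /X; have : (r * J0 <= J0 * r ^ 2)%N by rewrite mulnC leq_mul2l rr orbT.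
  by move: (r * J0)%N (J0 * r ^ 2)%N (r ^ 2)%N rr r0 => A B Y; clear; rewrite mulnDl; lia.
- apply: (@leq_trans ((2 ^ l) ^ r)).
    by case: r r0 {rr} => // r _; rewrite leq_exp2r// ltnW// ltn_expl.
  by rewrite -expnM leq_pexp2l// leq_mul2l rr orbT.
Qed.

Section Almost_sure.
Context {R : realType} {d N : nat} {dd : measure_display} {T : measurableType dd}.
Local Notation Seq := (@Seq R d N).
Variables (P : probability T R) (b : nat -> T -> bool).
Hypothesis mb : forall n, measurable [set w | b n w].
Hypothesis Pb : forall (S : seq nat) (a : nat -> bool), uniq S ->
  (P [set w | forall i, i \in S -> b i w = a i] <= (2 ^- size S)%:E)%E.
Variables (s : R) (p q : \bar R).
Variables (L : seq ('I_N * nat * idx d)) (J0 : nat).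
Hypothesis N_gt0 : (0 < N)%N.
Hypothesis p_gt0 : (0 < p)%E.
Hypothesis q_gt0 : (0 < q)%E.
Hypothesis L_scale : forall l, l \in L -> (1 <= l.1.2 <= J0)%N.
Variable f : Seq.
Local Notation probe := (probe s p q L (entropy_rate L J0).+1).
Local Notation X := (fun w => ssub (probe (b ^~ w)) f).
Local Notation window := (window_ok s (d_over d p) (loss p q L J0) L J0).
Local Notation good := (good_seq s (d_over d p) (loss p q L J0) L J0).

Lemma measurable_probe_coef i j k (v : R) : measurable [set w | v <= cabs (X w i j k)].
Proof.
apply: (measurable_local mb (Q := fun c => v <= cabs (probe c i j k - f i j k))).
move=> c hc; have [M HM] := probe_local s p q L (entropy_rate L J0).+1 j.+1.
by exists M => c' cc'; rewrite (HM c c').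
Qed.

Lemma bad_window_prob r : (0 < r)%N ->
  (P [set w | ~ window (X w) r] <= (2 ^- (r ^ 2))%:E)%E.
Proof.
move=> r0; have [a Ha] := bad_window_bits s q L J0 p_gt0 r0 f.
pose E (I : wtrial L J0 r) := [set w | forall n, n \in wbits I -> b n w = a n].
apply: (@le_trans _ _ (\esum_(I in [set: wtrial L J0 r]) P (E I))%E).
  apply: measure_cover_le.
  - by apply: measurable_not; apply: measurable_window; exact: measurable_probe_coef.
  - by move=> I; exact: (measurable_bits mb a (fun n => n \in wbits I)).
  - by move=> w /Ha [I HI]; exists I.
apply: (@le_trans _ _ (\esum_(I in [set: wtrial L J0 r])
    (2 ^- ((entropy_rate L J0).+1 * r ^ 2) : R)%:E)%E).
  apply: le_esum => I _; apply: (le_trans (Pb a (wbits_uniq L_scale I))).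
  rewrite lee_fin lef_pV2 ?posrE ?exprn_gt0// ler_eXn2l ?ltr1n//.
  exact: wbits_size.
rewrite esum_finType; last by move=> I; rewrite lee_fin invr_ge0 exprn_ge0.
rewrite sumEFin lee_fin sumr_const -[leLHS]mulr_natl ler_pdivrMr ?exprn_gt0//.
rewrite mulSn exprD mulrA mulVf ?expf_neq0 ?pnatr_eq0// mul1r -natrX ler_nat.
rewrite /wtrial !card_prod !card_ffun !card_ord.
exact: trial_count.
Qed.

(** If goodness fails, all windows from some [r0] on fail. That event is contained in the failure of
    any single later window, whose probability is arbitrarily small. *)
Lemma bad_prob0 : P [set w | ~ good (X w)] = 0%E.
Proof.
have mw r : measurable [set w | ~ window (X w) r].
  by apply: measurable_not; apply: measurable_window; exact: measurable_probe_coef.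
pose E r0 := [set w | forall r, (r0 <= r)%N -> ~ window (X w) r].
have mE r0 : measurable (E r0).
  by apply: measurable_forall => r; apply: measurable_imp.
have E0 r0 : P (E r0) = 0%E.
  apply/eqP; rewrite eq_le measure_ge0 andbT; apply/lee_addgt0Pr => e e0.
  rewrite add0e; have [m Hm] := exists_powR_lt (@ltr01 R) e0.
  pose r := (r0 + m).+1.
  apply: (@le_trans _ _ (2 ^- (r ^ 2))%:E); last first.
    rewrite lee_fin ltW//; have := Hm (r ^ 2)%N; rewrite mul1r powRN powR_mulrn//.
    apply; apply: (@leq_trans r); first by rewrite /r leqW// leq_addl.
    by rewrite -{1}(expn1 r) leq_pexp2l.
  apply: le_trans (bad_window_prob (ltn0Sn _)).
  apply: le_measure; rewrite ?inE; [exact: mE|exact: mw|].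
  by move=> w; apply; rewrite /r leqW// leq_addr.
apply/eqP; rewrite eq_le measure_ge0 andbT.
apply: (@le_trans _ _ (\esum_(r0 in [set: nat]) P (E r0))%E).
  apply: measure_cover_le => //.
    by apply: measurable_not; apply: measurable_good; exact: measurable_probe_coef.
  move=> w /= ng; apply: contrapT => none; apply: ng => r0.
  apply: contrapT => nr; apply: none; exists r0 => // r rr wr.
  by apply: nr; exists r.
by rewrite esum1// => r0 _; exact: E0.
Qed.

End Almost_sure.

(** * Borel structure, translation and prevalence *)

Lemma open_coef_lt (R : realType) (d N : nat) (s : R) (p q : \bar R) i j k (v : R) :
  (0 < N)%N -> (0 < p)%E -> (0 < q)%E ->
  openB s p q [set C : @Seq R d N | inB s p q C /\ cabs (C i j k) < v].
Proof.
move=> N0 p0 q0; split=> [C []//|C [CB Cv]].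
pose w : R := 2 `^ ((s - d_over d p) * j%:R).
have w0 : 0 < w by exact: pow2_gt0.
exists ((v - cabs (C i j k)) * w); first by rewrite mulr_gt0// subr_gt0.
move=> C' [C'B nC']; split=> //.
have h : (wcoef s p (ssub C' C) j (i, k) < ((v - cabs (C i j k)) * w)%:E)%E.
  apply: le_lt_trans nC'; apply: (le_trans (coef_le_level _ _ _ _ _ p0)).
  exact: level_le_bnorm.
rewrite lte_fin /= ltr_pM2r// ltrBrDl in h; apply: le_lt_trans h.
apply: le_trans (cabs_triangle _ _); rewrite /ssub addrC subrK; exact: lexx.
Qed.

Lemma openB_inB (R : realType) (d N : nat) (s : R) (p q : \bar R) :
  openB s p q (@inB R d N s p q).
Proof. by split=> // C _; exists 1 => // C' []. Qed.

Lemma sadd_image (R : realType) (d N : nat) (x C : @Seq R d N) (A : set (@Seq R d N)) :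
  (sadd x @` A) C <-> A (ssub C x).
Proof.
split=> [[D AD <-]|AC].
  rewrite (_ : ssub _ _ = D)//; apply/funext => i; apply/funext => j.
  by apply/funext => k; rewrite /ssub /sadd addrC addKr.
exists (ssub C x) => //; apply/funext => i; apply/funext => j.
by apply/funext => k; rewrite /ssub /sadd addrC subrK.
Qed.

Theorem mainTheorem11 (R : realType) (d N : nat) (d_ge1 : (1 <= d)%N)
  (N_ge1 : (1 <= N)%N) (psi : 'I_N -> pt d -> R[i])
  (s : R) (p q : \bar R) (p_gt0 : (0 < p)%E) (q_gt0 : (0 < q)%E) :
  fast_decay psi -> dyadic_covering psi ->
  @prevalent R d N s p q
    [set C | @inB R d N s p q C /\ max_divergent s p psi C [set: pt d]].
Proof.
move=> psi_decay [C0 C0_gt0 [L [L1 Lcov]]].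
pose J0 := (\max_(l <- L) l.1.2).+1.
have L_scale l : l \in L -> (1 <= l.1.2 <= J0)%N.
  move=> lL; rewrite L1//= leqW//.
  exact: (@leq_bigmax_seq _ _ xpredT (fun l => l.1.2)).
pose lo := loss p q L J0.
pose good := good_seq s (d_over d p) lo L J0.
(* [good] is a countable combination of coefficient inequalities, so its failure is Borel, and it
   contains the failure of maximal divergence. *)
pose A : set (@Seq R d N) := [set C | inB s p q C /\ ~ good C].
exists A.
  move=> C [CB nmax]; split=> // gC; apply: nmax; split=> //.
  exact: (max_divergent_of_good d_ge1 N_ge1 p_gt0 q_gt0 psi_decay (ltn0Sn _)
    C0_gt0 L_scale Lcov (loss_small L J0 p_gt0 q_gt0) CB gC).
split; [by move=> C []|split].
  (* The carrier contains all sequences, while strict coefficient bounds define open sets only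
     inside the space; sequences outside are sent to 0. *)
  pose X (C : @Seq R d N) : @Seq R d N := if pselect (inB s p q C) then C else (fun _ _ _ => 0).
  have XE C : inB s p q C -> X C = C.
    by move=> CB; rewrite /X; case: (pselect (inB s p q C)).
  have X0 C : ~ inB s p q C -> X C = (fun _ _ _ => 0).
    by move=> CB; rewrite /X; case: (pselect (inB s p q C)).
  have mB : measurable (@inB R d N s p q : set (BorelB d N s p q)).
    by apply: sub_sigma_algebra; exact: openB_inB.
  rewrite (_ : A = inB s p q `&` [set C | ~ good (X C)]); last first.
    by apply/seteqP; split=> C [CB h]; split=> //; move: h; rewrite /= XE.
  apply: measurableI => //; apply: measurable_not.
  apply: (@measurable_good R d N _ (BorelB d N s p q) s (d_over d p) lo L J0 X).
  move=> i j k v; pose V := [set C : @Seq R d N | inB s p q C /\ cabs (C i j k) < v].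
  have mV : measurable (V : set (BorelB d N s p q)).
    by apply: sub_sigma_algebra; exact: open_coef_lt.
  have [v0|v0] := leP v 0.
    rewrite (_ : [set w | _] = setT)//; apply/seteqP; split=> // C _ /=.
    by rewrite (le_trans v0)// cabs_ge0.
  rewrite (_ : [set w | _] = inB s p q `&` ~` V).
    by apply: measurableI => //; exact: measurableC.
  apply/seteqP; split=> C /=.
    have [CB|nB] := pselect (inB s p q C).
      by rewrite XE// => h; split=> // -[_]; rewrite ltNge h.
    by rewrite X0// /cabs ComplexField.Normc.normc0 leNgt v0.
  by move=> [CB h]; rewrite XE// leNgt; apply/negP => h'; exact: h.
have [dd [T [P [b [mb Pb]]]]] := fair_bits R.
pose probe := probe s p q L (entropy_rate L J0).+1.
pose Phi (w : T) : BorelB d N s p q := probe (b ^~ w).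
(* The preimage of an open set is open in the bits by [probe_open]. *)
have mPhi : measurable_fun setT Phi.
  apply: (measurability (openB s p q : set (set (BorelB d N s p q)))) => // _ [U oU <-].
  rewrite setTI; apply: (measurable_local mb (Q := fun c => U (probe c))).
  by move=> c; exact: probe_open oU.
pose X : {mfun T >-> BorelB d N s p q} := HB.pack Phi (isMeasurableFun.Build _ _ _ _ Phi mPhi).
exists (distribution P X : probability (BorelB d N s p q) R); split.
  exists (range probe); first exact: probe_compact.
  rewrite /= /distribution /pushforward (_ : _ @^-1` _ = setT) ?probability_setT//.
  by apply/seteqP; split=> // w _; exists (b ^~ w).
(* The probe lies in [x + A] when its difference with [x] fails [good]; this is the almost sure
   statement with [f = x]. *)
move=> x xB; rewrite /= /distribution /pushforward.
rewrite (_ : _ @^-1` _ = [set w | ~ good (ssub (probe (b ^~ w)) x)]).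
  exact: bad_prob0.
apply/seteqP; split=> w /=; first by move=> /sadd_image [].
move=> h; apply/sadd_image; split=> //; apply: inB_sub => //.
exact: probe_inB.
Qed.
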